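(* Let $\lambda>1$ and $\lambda_1>\lambda$, and let $\vartheta=\vartheta_{\lambda,\lambda_1}$ and $b=b(\lambda,\lambda_1)$. Then the function $U^{\lambda_1,\vartheta}$, together with the vector field $q^{\mathrm{ext}}_{\lambda_1}$, is a supersolution for the parameter $\lambda$.
   Context: Points of $\mathbb R^2$ are written $(y,z)$; $\Omega=(-1,1)\times(-\infty,0)$. $\mathcal X=\{u\in W^{1,2}(\Omega): u(\pm1,\cdot)=0,\ z\nabla u\in L^1(\Omega,\mathbb R^2)\}$ and $\Lambda=\{q\in L^2_{\mathrm{loc}}(\Omega,\mathbb R^2):|q|\le1\text{ a.e.}\}$. Supersolution for the parameter $\lambda$: a pair $(u,q)$ with $u\in\mathcal X$, $u\ge0$, $q\in\Lambda$, such that $\int_\Omega\nabla u\cdot\nabla\varphi+|z|q\cdot\nabla\varphi\ge\lambda\int_\Omega\varphi$ for all $\varphi\in\mathcal X$ with $\varphi\ge0$, and $q\cdot\nabla u=|\nabla u|$ a.e. in $\Omega$. For $\lambda>1$ and $Z\in[\frac1\lambda,\frac1{\lambda-1}]$ set $$f_\lambda(Z)=\frac{1}{(\lambda^2-1)^{3/2}}\Big\{\mathrm{Arcsin}\big[(\lambda^2-1)Z-\lambda\big]-\lambda\sqrt{1-\big((\lambda^2-1)Z-\lambda\big)^2}\Big\}$$ (strictly increasing), and $$K(\lambda)=\frac{1}{f_\lambda(\frac1\lambda)-f_\lambda(\frac1{\lambda-1})}<0,\qquad \phi_{K(\lambda)}(y)=K(\lambda)\,f_\lambda^{-1}\Big(f_\lambda\big(\tfrac{1}{\lambda-1}\big)+\tfrac{|y|}{K(\lambda)}\Big),\quad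 y\in[-1,1].$$ For $\lambda_1>\lambda>1$ set $$\vartheta_{\lambda,\lambda_1}=\frac{\lambda_1-\lambda}{2\big(1+(\lambda_1/K(\lambda_1))^2\big)},\qquad b(\lambda,\lambda_1)=1+\sqrt{\frac{\lambda_1}{2\vartheta_{\lambda,\lambda_1}}}.$$ Let $\mathcal C_{\lambda_1}=\{(y,z)\in\mathbb R^2: |y|<z\lambda_1/K(\lambda_1)\}$. For $(y,z)\in\mathcal C_{\lambda_1}\cap\Omega$ let $L=L(y,z)\in(0,+\infty)$ be the unique number with $|y|\le L$ and $z=L\,\phi_{K(\lambda_1)}(y/L)$, and set $$q_{\lambda_1}(y,z)=\frac{(-\phi_{K(\lambda_1)}'(y/L),\,1)}{\sqrt{1+|\phi_{K(\lambda_1)}'(y/L)|^2}}.$$ Sets such as $\{1\le L\le b\}$ are subsets of $\mathcal C_{\lambda_1}\cap\Omega$, and $\{z>\phi_{K(\lambda_1)}\}=\{(y,z)\in\Omega: z>\phi_{K(\lambda_1)}(y)\}$; one has $\{L\ge1\}=\{(y,z)\in\Omega: z\le\phi_{K(\lambda_1)}(y)\}$. Define in $\Omega$ $$u_1^{\lambda_1}(y,z)=\frac{\lambda_1}{2}(1-y^2),\qquad u_2^{\lambda_1,\vartheta}(y,z)=\begin{cases}+\infty&\text{in }\{z>\phi_{K(\lambda_1)}\},\\ \vartheta(L(y,z)-b)^2&\text{in }\{1\le L\le b\},\\ 0&\text{in }\{b\le L\},\end{cases}$$ $$U^{\lambda_1,\vartheta}=\min\{u_1^{\lambda_1},u_2^{\lambda_1,\vartheta}\},$$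 and, for a.e. $(y,z)\in\Omega$, $$q^{\mathrm{ext}}_{\lambda_1}(y,z)=\begin{cases}\big(-\frac{y}{|y|},0\big)&\text{in }\Big(\big\{1\le L<b-\sqrt{\tfrac{\lambda_1}{2\vartheta}(1-y^2)}\big\}\cup\{z>\phi_{K(\lambda_1)}\}\Big)\cap\{y\ne0\},\\ q_{\lambda_1}(y,z)&\text{in }\big\{b-\sqrt{\tfrac{\lambda_1}{2\vartheta}(1-y^2)}<L\big\}.\end{cases}$$ *)

(* Defs.v *)
From HB Require Import structures.
From mathcomp Require Import all_boot all_order all_algebra.
From mathcomp Require Import all_classical all_reals all_analysis.

Set Implicit Arguments.
Unset Strict Implicit.
Unset Printing Implicit Defensive.

Import Order.TTheory GRing.Theory Num.Theory.
Import numFieldNormedType.Exports.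

Local Open Scope classical_set_scope.
Local Open Scope ring_scope.

Notation leb := lebesgue_measure.
Notation leb2 := (lebesgue_measure \x lebesgue_measure)%E.

(* The plane as the measurable space underlying leb2. *)
Notation plane R := (measurableTypeR R * measurableTypeR R)%type.

Section Plane.
Context {R : realType}.
Implicit Types (u psi : R * R -> R) (g q : R * R -> R * R) (p : R * R).

(* The norm of the product type R * R in the library is the maximum norm,
   hence a separate Euclidean norm. *)
Definition dot (v w : R * R) : R := v.1 * w.1 + v.2 * w.2.
Definition enorm (v : R * R) : R := Num.sqrt (dot v v).

Definition Omega : set (R * R) := [set p | -1 < p.1 < 1 /\ p.2 < 0].

Definition ey : R * R := (1, 0).
Definition ez : R * R := (0, 1).

Fixpoint Ck (k : nat) (psi : R * R -> R) : Prop :=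
  if k is j.+1 then
    [/\ continuous psi,
        forall p, derivable psi p ey /\ derivable psi p ez,
        Ck j (fun p => 'D_ey psi p) & Ck j (fun p => 'D_ez psi p)]
  else continuous psi.

Definition tsupport (psi : R * R -> R) : set (R * R) :=
  closure [set p | psi p != 0].

Definition test_function (psi : R * R -> R) : Prop :=
  [/\ forall k, Ck k psi, compact (tsupport psi) & tsupport psi `<=` Omega].

Definition inL2 u : Prop :=
  measurable_fun (Omega : set (plane R)) u /\
  leb2.-integrable Omega (fun p => (u p ^+ 2)%:E).

Definition weak_gradient u g : Prop :=
  forall psi, test_function psi ->
    (\int[leb2]_(p in Omega) (u p * 'D_ey psi p)%:E =
       - \int[leb2]_(p in Omega) ((g p).1 * psi p)%:E)%E /\
    (\int[leb2]_(p in Omega) (u p * 'D_ez psi p)%:E =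
       - \int[leb2]_(p in Omega) ((g p).2 * psi p)%:E)%E.

(* u is in W^{1,2}(Omega) and g represents its weak gradient. *)
Definition W12 u g : Prop :=
  [/\ inL2 u, inL2 (fun p => (g p).1), inL2 (fun p => (g p).2) &
      weak_gradient u g].

(* The trace operator W^{1,2}(Omega) -> L^2 on the lateral sides y = -1 and
   y = 1 is the continuous extension of the restriction of C^1_c(R^2)
   functions; tm and tp are the traces on y = -1 and y = 1. *)
Definition lateral_trace u g (tm tp : R -> R) : Prop :=
  exists v : nat -> R * R -> R,
  [/\ forall n, Ck 1 (v n) /\ compact (tsupport (v n)),
      (\int[leb2]_(p in Omega) ((v n p - u p) ^+ 2)%:E)%E
        @[n --> \oo] --> 0%E,
      (\int[leb2]_(p in Omega)
          (('D_ey (v n) p - (g p).1) ^+ 2 +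
           ('D_ez (v n) p - (g p).2) ^+ 2)%:E)%E @[n --> \oo] --> 0%E,
      (\int[leb]_(z in `]-oo, (0 : R)%R[) ((v n (-1, z) - tm z) ^+ 2)%:E)%E
        @[n --> \oo] --> 0%E &
      (\int[leb]_(z in `]-oo, (0 : R)%R[) ((v n (1, z) - tp z) ^+ 2)%:E)%E
        @[n --> \oo] --> 0%E].

(* u belongs to the space X and g represents its weak gradient. *)
Definition calX u g : Prop :=
  [/\ W12 u g, lateral_trace u g (cst 0) (cst 0),
      leb2.-integrable Omega (fun p => (p.2 * (g p).1)%:E) &
      leb2.-integrable Omega (fun p => (p.2 * (g p).2)%:E)].

Definition Lam q : Prop :=
  [/\ measurable_fun (Omega : set (plane R)) (fun p => (q p).1),
      measurable_fun (Omega : set (plane R)) (fun p => (q p).2),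
      forall C : set (R * R), compact C -> C `<=` Omega ->
        (\int[leb2]_(p in C) (enorm (q p) ^+ 2)%:E < +oo)%E &
      {ae leb2, forall p, Omega p -> enorm (q p) <= 1}].

Definition supersolution (lam : R) u q : Prop :=
  exists g,
  [/\ calX u g,
      {ae leb2, forall p, Omega p -> 0 <= u p},
      Lam q,
      forall phi gphi, calX phi gphi ->
        {ae leb2, forall p, Omega p -> 0 <= phi p} ->
        (lam%:E * \int[leb2]_(p in Omega) (phi p)%:E <=
         \int[leb2]_(p in Omega)
           (dot (g p) (gphi p) + `|p.2| * dot (q p) (gphi p))%:E)%E &
      {ae leb2, forall p, Omega p -> dot (q p) (g p) = enorm (g p)}].

End Plane.

Section Profile.
Context {R : realType}.
Implicit Types (lam th b y t : R) (p : R * R).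

Definition ff lam (Z : R) : R :=
  ((lam ^+ 2 - 1) `^ (3 / 2))^-1 *
  (asin ((lam ^+ 2 - 1) * Z - lam) -
   lam * Num.sqrt (1 - ((lam ^+ 2 - 1) * Z - lam) ^+ 2)).

(* Inverse of ff lam on its domain [1/lam, 1/(lam-1)]. *)
Definition ffinv lam t : R :=
  get [set Z | lam^-1 <= Z <= (lam - 1)^-1 /\ ff lam Z = t].

Definition KK lam : R := (ff lam lam^-1 - ff lam (lam - 1)^-1)^-1.

(* The profile phi_{K(lam)}; meaningful for y in [-1, 1]. *)
Definition phiK lam y : R :=
  KK lam * ffinv lam (ff lam (lam - 1)^-1 + `|y| / KK lam).

Definition theta lam lam1 : R :=
  (lam1 - lam) / (2 * (1 + (lam1 / KK lam1) ^+ 2)).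

Definition bb lam lam1 : R := 1 + Num.sqrt (lam1 / (2 * theta lam lam1)).

Definition cone lam1 : set (R * R) :=
  [set p | `|p.1| < p.2 * lam1 / KK lam1].

(* Meaningful for p in cone lam1 `&` Omega. *)
Definition LL lam1 p : R :=
  get [set L | [/\ 0 < L, `|p.1| <= L & p.2 = L * phiK lam1 (p.1 / L)]].

Definition qcone lam1 p : R * R :=
  let d := derive1 (phiK lam1) (p.1 / LL lam1 p) in
  (- d / Num.sqrt (1 + d ^+ 2), (Num.sqrt (1 + d ^+ 2))^-1).

Definition u1 lam1 p : R := lam1 / 2 * (1 - p.1 ^+ 2).

Definition u2 lam1 th b p : \bar R :=
  if phiK lam1 p.1 < p.2 then +oo%E
  else if (p \in cone lam1) && (1 <= LL lam1 p <= b)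
  then (th * (LL lam1 p - b) ^+ 2)%:E
  else 0%E.

Definition UU lam1 th b p : R :=
  fine (Order.min (u1 lam1 p)%:E (u2 lam1 th b p)).

(* The level of L at which u1 = u2. *)
Definition Lint lam1 th b y : R :=
  b - Num.sqrt (lam1 / (2 * th) * (1 - y ^+ 2)).

(* q^ext is prescribed only almost everywhere; it is set to 0 on the
   remaining (negligible) part of Omega. *)
Definition qext lam1 th b p : R * R :=
  if ((p \in cone lam1) && (1 <= LL lam1 p < Lint lam1 th b p.1)
      || (phiK lam1 p.1 < p.2)) && (p.1 != 0)
  then (- (p.1 / `|p.1|), 0)
  else if (p \in cone lam1) && (Lint lam1 th b p.1 < LL lam1 p)
  then qcone lam1 p
  else (0, 0).

End Profile.

(* Main.v *)
(* Write x = - z, k = - K(lam1) and let a be the angle of the normal to the level lines of L.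
   In terms of a the function f_lam1 becomes an explicit primitive, and L = x ell(y / x) with
   grad L = (sin a, - cos a) / (k D(a)), where D(a)^2 (k^2 + lam1^2) >= 1 by convexity of the
   profile; this lower bound on D is what the choice of theta exploits.

   The pair (grad U, q^ext) is the limit of regularised fields F_e obtained by smoothing the
   minimum of the two barriers, the square in u_2 and the sign of y. Pointwise
   - div F_e >= lam: where u_1 is the minimum it is lam1 up to a nonnegative term, where u_2
   is the minimum the loss is at most 2 theta |grad L|^2 <= lam1 - lam, and the transition
   layer contributes with the good sign because both fields come from the monotone operator
   p |-> p + x p / |p|. The F_e are regular enough to be integrated by parts slice by slice
   against the smooth approximants that define the zero trace of a function phi in X. Taking
   (- y, 0) as the field gives phi in L^1, so the truncation in z can be removed, and e -> 0
   yields the inequality by dominated convergence. The regularised minima, cut off, are also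
   the C^1_c approximants showing that U lies in X with zero trace. *)
Require Import Defs.
From mathcomp Require Import all_boot all_order all_algebra.
From mathcomp Require Import all_classical all_reals all_analysis.
From mathcomp Require Import measurable_realfun ring lra.

Set Implicit Arguments.
Unset Strict Implicit.
Unset Printing Implicit Defensive.

Import Order.TTheory GRing.Theory Num.Theory.
Import numFieldNormedType.Exports.

Local Open Scope classical_set_scope.
Local Open Scope ring_scope.

(** Functions of X are not prescribed on z = 0, so the field must have no vertical component there.
    This holds because u_1 does not depend on z and q^ext is horizontal wherever u_1 is the minimum,
    which includes a whole layer under z = 0. The value of b makes u_2 equal to lam1 / 2 = max u_1
    on L = 1, so that neither the infinite value of u_2 nor the outside of the cone is seen by the
    minimum. The regularisation respects this exactly: the square is approximated from above, hence
    the second barrier stays switched off wherever it was, in particular near the edge of the cone,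
    where the angle has a corner as a function of y / x. What remains singular is the origin, where
    the regularised sign, a function of y / x, has no limit; divergences are therefore only asked to
    be bounded and to exist on slices. Inside the cone x q has divergence exactly - lam1, which is
    the equation satisfied by the profile; the whole of lam1 - lam is then available for the
    Laplacian of u_2. *)

Local Notation measOmega f := (measurable_fun (Omega : set (plane _)) f).
Local Notation intOmega f := (leb2.-integrable (Omega : set (plane _)) (EFin \o f)).

(** * The half-strip *)

Section PlaneMeasure.
Context {R : realType}.
Implicit Types (f g : R * R -> R) (p : R * R).

(** The sigma-algebra of the plane is the product one; an open set belongs to it as the countable
    union of the squares with rational centre and half-side that it contains. *)
Lemma open_measurable_plane (U : set (R * R)) :
  open U -> measurable (U : set (plane R)).
Proof.
move=> oU.
pose B (t : rat * rat * rat) : set (R * R) :=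
  [set p | `|ratr t.1.1 - p.1| < ratr t.2 /\ `|ratr t.1.2 - p.2| < ratr t.2].
pose F t := if pselect (B t `<=` U) then B t else set0.
have -> : U = \bigcup_t F t.
  apply/seteqP; split => [[y z] /= Up|p [t _]]; last first.
    by rewrite /F; case: pselect => [BU /BU|nBU] //.
  have /nbhs_ballP[e /= e0 eU] := open_nbhs_nbhs (conj oU Up).
  have e2 : 0 < e / 2 by rewrite divr_gt0.
  have [r re] : exists r : rat, (ratr r : R) \in `]0, e / 2[.
    by have [r] := rat_in_itvoo e2; exists r.
  move: re; rewrite in_itv /= => /andP[r0 re].
  have lt1 : forall c : R, c - ratr r < c + ratr r by move=> c; lra.
  have [y' hy] := rat_in_itvoo (lt1 y).
  have [z' hz] := rat_in_itvoo (lt1 z).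
  exists (y', z', r) => //; rewrite /F; case: pselect => [BU|nBU]; last first.
    exfalso; apply: nBU => -[a b] [/= h1 h2]; apply: eU; split => /=; rewrite /ball /=.
      move: hy h1; rewrite !in_itv /= !ltr_norml => /andP[? ?] /andP[? ?].
      by apply/andP; split; lra.
    move: hz h2; rewrite !in_itv /= !ltr_norml => /andP[? ?] /andP[? ?].
    by apply/andP; split; lra.
  by split => /=; move: hy hz; rewrite !in_itv /= !ltr_norml => /andP[? ?] /andP[? ?];
    apply/andP; split; lra.
apply: countable_bigcupT_measurable => [|t]; first exact: countableP.
rewrite /F; case: pselect => [BU|nBU]; last exact: measurable0.
rewrite /=; clear BU; have -> : B t = (fun y : R => `|ratr t.1.1 - y|) @^-1` `]-oo, ratr t.2[ `*`
               (fun y : R => `|ratr t.1.2 - y|) @^-1` `]-oo, ratr t.2[.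
  by apply/seteqP; split => -[a b] /=; rewrite !in_itv.
have md (c e : R) : measurable ((fun y : R => `|c - y|) @^-1` `]-oo, e[).
  rewrite -[X in measurable X]setTI.
  have : measurable_fun setT (fun y : R => `|c - y|).
    by apply: measurableT_comp => //; exact: measurable_funB.
  by apply => //; exact: measurable_itv.
by apply: measurableX; exact: md.
Qed.

Lemma open_continuous_measurable_plane (D : set (R * R)) f : open D ->
  (forall p, D p -> {for p, continuous f}) -> measurable_fun (D : set (plane R)) f.
Proof.
move=> oD cf; apply: (measurability _ (RGenOpens.measurableE R)).
move=> _ [_ [a [b ->] <-]]; apply: open_measurable_plane.
rewrite openE => p [Dp fp]; apply: filterI; first exact: open_nbhs_nbhs.
apply: cf => //; apply: open_nbhs_nbhs; split => //; exact: interval_open.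
Qed.

Lemma continuous_measurable_plane f :
  continuous f -> measurable_fun (setT : set (plane R)) f.
Proof.
by move=> cf; apply: open_continuous_measurable_plane => [|p _]; [exact: openT|exact: cf].
Qed.

(** Fields are controlled on all of z < 0 rather than on [Omega], since their values on the sides y
    = -1 and y = 1 enter the boundary terms. *)
Definition lower : set (R * R) := [set p | p.2 < 0].

Lemma open_lower : open lower.
Proof.
have -> : lower = snd @^-1` [set z : R | z < 0] by [].
by apply: open_comp => [p _|]; [exact: cvg_snd|exact: open_lt].
Qed.

Lemma measurable_lower : measurable (lower : set (plane R)).
Proof. exact: open_measurable_plane open_lower. Qed.

Lemma compact_measurable_plane (C : set (R * R)) :
  compact C -> measurable (C : set (plane R)).
Proof.
move=> /compact_closed cC; rewrite -(setCK C); apply: measurableC.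
apply: open_measurable_plane; apply: closed_openC; apply: cC.
exact: norm_hausdorff.
Qed.

Definition strip : set R := `]-oo, 0[%classic.

Lemma OmegaE : Omega = `](-1), 1[%classic `*` strip :> set (R * R).
Proof. by apply/seteqP; split => -[y z]; rewrite /Omega /strip /= !in_itv. Qed.

Lemma measurable_strip : measurable (strip : set (measurableTypeR R)).
Proof. exact: measurable_itv. Qed.

Lemma measurable_Omega : measurable (Omega : set (plane R)).
Proof. by rewrite OmegaE; apply: measurableX; exact: measurable_itv. Qed.

Lemma open_Omega : open (Omega : set (R * R)).
Proof.
have -> : Omega = [set p : R * R | -1 < p.1] `&` [set p : R * R | p.1 < 1] `&` lower.
  apply/seteqP; split=> p; first by move=> [/andP[? ?] ?].
  by move=> [[h1 h2] h3]; split=> //; rewrite h1 h2.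
apply: openI; last exact: open_lower.
apply: openI.
  have -> : [set p : R * R | -1 < p.1] = fst @^-1` [set y : R | -1 < y] by [].
  by apply: open_comp => [p _|]; [exact: cvg_fst|exact: open_gt].
have -> : [set p : R * R | p.1 < 1] = fst @^-1` [set y : R | y < 1] by [].
by apply: open_comp => [p _|]; [exact: cvg_fst|exact: open_lt].
Qed.

Lemma continuous_measurable_Omega f : (forall p, Omega p -> {for p, continuous f}) ->
  measOmega f.
Proof. exact: open_continuous_measurable_plane open_Omega. Qed.

(** The truncation at depth [M], of finite measure: its indicator dominates whatever is bounded and
    supported there. *)
Definition Omegab (M : R) : set (R * R) :=
  `](-1), 1[%classic `*` `[-M, 0[%classic.

Lemma measurable_Omegab M : measurable (Omegab M : set (plane R)).
Proof. by apply: measurableX; exact: measurable_itv. Qed.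

Lemma OmegabE M p : (p \in Omegab M) = [&& -1 < p.1 < 1, -M <= p.2 & p.2 < 0].
Proof.
by apply/idP/idP; rewrite inE /Omegab /= !in_itv /=; [case=> -> /= | case/andP].
Qed.

Lemma leb2_Omegab M : (leb2 (Omegab M) < +oo :> \bar R)%E.
Proof.
rewrite /Omegab product_measure1E//=; [|exact: measurable_itv..].
rewrite (lebesgue_measure_itv `](-1), 1[) (lebesgue_measure_itv `[-M, 0[) /= !lte_fin.
by case: ifP => _; case: ifP => _; rewrite -?EFinB -?EFinM ?mule0 ?mul0e ?ltry.
Qed.

End PlaneMeasure.

(** * Real-valued integrals: domination and L2 pairings *)

Section RealIntegral.
Context d (T : measurableType d) {R : realType}.
Variables (mu : {measure set T -> \bar R}) (D : set T).
Hypothesis mD : measurable D.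
Implicit Types (f g w : T -> R).

Lemma EFin_Rintegral f : mu.-integrable D (EFin \o f) ->
  (\int[mu]_(x in D) (f x)%:E = (\int[mu]_(x in D) f x)%R%:E)%E.
Proof. by move=> fi; rewrite /Rintegral fineK//; exact: integrable_fin_num. Qed.

Lemma le_integrableR f g : measurable_fun D f ->
  (forall x, D x -> `|f x| <= g x) -> mu.-integrable D (EFin \o g) ->
  mu.-integrable D (EFin \o f).
Proof.
move=> mf fg; apply: le_integrable => //; first exact/measurable_EFinP.
by move=> x Dx /=; rewrite lee_fin (le_trans (fg x Dx))// ler_norm.
Qed.

Lemma integrableDR f g : mu.-integrable D (EFin \o f) ->
  mu.-integrable D (EFin \o g) -> mu.-integrable D (EFin \o (fun x => f x + g x)).
Proof.
move=> fi gi; apply: eq_integrable (integrableD mD fi gi) => // x _ /=.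
Qed.

Lemma integrableZR c f : mu.-integrable D (EFin \o f) ->
  mu.-integrable D (EFin \o (fun x => c * f x)).
Proof.
move=> fi; apply: eq_integrable (integrableZl mD c fi) => // x _ /=.
Qed.

Lemma integrable_normR f : mu.-integrable D (EFin \o f) ->
  mu.-integrable D (EFin \o (fun x => `|f x|)).
Proof.
by move=> fi; apply: eq_integrable (integrable_abse fi) => // x _.
Qed.

(** Completing the square leaves t (a - s b / (2 t))^2 + 3 b^2 / (4 t), where s = 1 or s = -1 takes
    care of the absolute value. The free weight [t] lets this inequality do the work of
    Cauchy-Schwarz. *)
Lemma ler_normM_young (t a b : R) : 0 < t ->
  `|a * b| <= t * a ^+ 2 + t^-1 * b ^+ 2.
Proof.
move=> t0; have u0 : 0 < t^-1 by rewrite invr_gt0.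
have tu : t * t^-1 = 1 by rewrite divff// gt_eqF.
move: (t^-1) u0 tu => u u0 tu.
have key (s : R) : s ^+ 2 = 1 -> s * (a * b) <= t * a ^+ 2 + u * b ^+ 2.
  move=> s2; rewrite -subr_ge0.
  have -> : t * a ^+ 2 + u * b ^+ 2 - s * (a * b) =
      t * (a - s * u * b / 2) ^+ 2 + 3 / 4 * (u * b ^+ 2).
    rewrite [in RHS]sqrrB !exprMn s2.
    have -> : t * (a ^+ 2 - a * (s * u * b / 2) *+ 2 + 1 * u ^+ 2 * b ^+ 2 * 2^-1 ^+ 2)
      = t * a ^+ 2 - (t * u) * (s * a * b) + (t * u) * u * b ^+ 2 / 4 by field.
    by rewrite tu; field.
  have h1 : 0 <= t * (a - s * u * b / 2) ^+ 2 by rewrite mulr_ge0 ?sqr_ge0 ?ltW.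
  have h2 : 0 <= u * b ^+ 2 by rewrite mulr_ge0 ?sqr_ge0 ?ltW.
  by lra.
have := key 1 (expr1n _ _); have := key (-1) _.
rewrite sqrrN expr1n ler_norml => /(_ erefl) h1 h2.
by apply/andP; split; lra.
Qed.

Lemma integrable_mul_L2 f g : measurable_fun D f -> measurable_fun D g ->
  mu.-integrable D (EFin \o (fun x => f x ^+ 2)) ->
  mu.-integrable D (EFin \o (fun x => g x ^+ 2)) ->
  mu.-integrable D (EFin \o (fun x => f x * g x)).
Proof.
move=> mf mg fi gi.
apply: (@le_integrableR _ (fun x => f x ^+ 2 + g x ^+ 2)).
- exact: measurable_funM.
- by move=> x _; have := ler_normM_young (f x) (g x) ltr01; rewrite invr1 !mul1r.
- exact: integrableDR.
Qed.

Lemma Rdominated_cvg (f_ : nat -> T -> R) f g :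
  (forall n, measurable_fun D (f_ n)) -> measurable_fun D f ->
  (forall x, D x -> f_ n x @[n --> \oo] --> f x) ->
  mu.-integrable D (EFin \o g) ->
  (forall n x, D x -> `|f_ n x| <= g x) ->
  \int[mu]_(x in D) f_ n x @[n --> \oo] --> \int[mu]_(x in D) f x.
Proof.
move=> mf_ mf ff ig fg.
have [] := @dominated_convergence _ _ _ mu D mD (fun n => EFin \o f_ n)
  (EFin \o f) (EFin \o g).
- by move=> n; exact/measurable_EFinP.
- exact/measurable_EFinP.
- by apply: aeW => x Dx; apply: cvg_EFin; [near=> n|exact: ff].
- exact: ig.
- by apply: aeW => x n Dx /=; rewrite lee_fin fg.
move=> fi _; rewrite [X in _ --> X]EFin_Rintegral// => h.
exact: fine_cvg h.
Unshelve. all: by end_near. Qed.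

(** A small weight [t] in Young's inequality makes the fixed factor [g] contribute at most e / 2;
    for this [t] the null sequence contributes at most e / 2 once n is large. Square-integrability
    of [w_ n] for large n comes from the convergence itself, a null sequence of extended reals being
    eventually finite. *)
Lemma L2_pairing_cvg0 g (w_ : nat -> T -> R) :
  measurable_fun D g -> mu.-integrable D (EFin \o (fun x => g x ^+ 2)) ->
  (forall n, measurable_fun D (w_ n)) ->
  (\int[mu]_(x in D) (w_ n x ^+ 2)%:E @[n --> \oo] --> 0)%E ->
  \int[mu]_(x in D) (g x * w_ n x) @[n --> \oo] --> (0 : R).
Proof.
move=> mg ig mw w0.
apply/cvgr0Pnorm_le => e e0.
set I := \int[mu]_(x in D) (g x ^+ 2).
have I0 : 0 <= I by apply: Rintegral_ge0 => x _; exact: sqr_ge0.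
pose t := e / (2 * (I + 1)).
have t0 : 0 < t by rewrite divr_gt0// mulr_gt0//; lra.
have [w1 /cvgr0Pnorm_le w2] := (fine_cvgP _ _).1 w0.
have te : 0 < t * (e / 2) by rewrite mulr_gt0// divr_gt0.
near=> n.
have wi : mu.-integrable D (EFin \o (fun x => w_ n x ^+ 2)).
  apply/integrableP; split.
    by apply/measurable_EFinP; exact: measurable_funX.
  under eq_integral do rewrite /= ger0_norm ?sqr_ge0//.
  by rewrite ltey_eq; apply/orP; left; near: n.
have gwi : mu.-integrable D (EFin \o (fun x => g x * w_ n x)).
  exact: integrable_mul_L2.
have bi : mu.-integrable D (EFin \o (fun x => t * g x ^+ 2 + t^-1 * w_ n x ^+ 2)).
  by apply: integrableDR; exact: integrableZR.
have Wn : \int[mu]_(x in D) (w_ n x ^+ 2) <= t * (e / 2).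
  rewrite (le_trans (ler_norm _))//; near: n; exact: w2.
apply: (le_trans (le_normr_Rintegral mD gwi)).
apply: (@le_trans _ _ (\int[mu]_(x in D) (t * g x ^+ 2 + t^-1 * w_ n x ^+ 2))).
  apply: le_Rintegral => //; first exact: integrable_normR.
  by move=> x _; exact: ler_normM_young.
rewrite RintegralD//; [|exact: integrableZR..].
rewrite !RintegralZl// -/I.
have -> : e = e / 2 + e / 2 by lra.
apply: lerD.
  rewrite /t mulrAC ler_pdivrMr; last by lra.
  by nra.
by rewrite ler_pdivrMl.
Unshelve. all: by end_near. Qed.

End RealIntegral.

(** * Integration over slices *)

Section SliceIntegration.
Context {R : realType}.
Implicit Types (P dP f : R * R -> R) (p : R * R).

Lemma FTC_is_derive (F f : R -> R) (a b : R) : a < b ->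
  (forall x, a <= x <= b -> is_derive x 1 F (f x)) ->
  (forall x, a <= x <= b -> {for x, continuous f}) ->
  (\int[leb]_(x in `[a, b]) (f x)%:E = (F b - F a)%:E)%E.
Proof.
move=> ab dF cf; rewrite (continuous_FTC2 ab (F := F)) ?EFinB//.
- apply: continuous_in_subspaceT => x; rewrite inE /= in_itv /=; exact: cf.
- have cF x : a <= x <= b -> {for x, continuous F}.
    move=> /dF h; apply: differentiable_continuous.
    by apply/derivable1_diffP; exact: ex_derive.
  split.
  + by move=> x; rewrite in_itv /= => /andP[/ltW ax /ltW xb];
      apply: ex_derive; apply: dF; rewrite ax.
  + by apply: cvg_at_right_filter; apply: cF; rewrite lexx ltW.
  + by apply: cvg_at_left_filter; apply: cF; rewrite lexx ltW.
- move=> x; rewrite in_itv /= => /andP[/ltW ax /ltW xb].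
  by rewrite derive1E; apply: derive_val; apply: dF; rewrite ax.
Qed.

Lemma integrable_bsupp f (M C : R) :
  measOmega f ->
  (forall p, Omega p -> `|f p| <= C) ->
  (forall p, Omega p -> p.2 < -M -> f p = 0) ->
  intOmega f.
Proof.
move=> mf fC f0.
have mO := @measurable_Omega R; have mOM := @measurable_Omegab R M.
apply: (@le_integrableR _ _ _ leb2 _ mO _
  (fun p => C * \1_(Omegab M : set (plane R)) p)) => //.
  move=> p Op; rewrite indicE OmegabE.
  case: (leP (- M) p.2) => [Mp|pM]; last first.
    by rewrite f0// normr0 andbF mulr0.
  by have [-> ->] : -1 < p.1 < 1 /\ p.2 < 0 := Op; rewrite mulr1 fC.
apply: integrableZR => //.
apply/integrableP; split; first exact/measurable_EFinP.
under eq_integral do rewrite /= ger0_norm//.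
rewrite integral_indic// (le_lt_trans _ (leb2_Omegab M))//.
by apply: le_measure; rewrite ?inE//; exact: measurableI.
Qed.

(** Fubini reduces the identity to the fundamental theorem of calculus on each line z = const.
    Regularity is asked along these lines and for z < 0 only, because the first component of the
    fields to come does not extend to the origin. *)
Lemma integral_slice_y P dP (M C : R) :
  measOmega dP ->
  (forall p, Omega p -> `|dP p| <= C) ->
  (forall p, Omega p -> p.2 < -M -> dP p = 0) ->
  (forall y z : R, z < 0 -> -1 <= y <= 1 ->
    is_derive y 1 (fun t => P (t, z)) (dP (y, z))) ->
  (forall y z : R, z < 0 -> -1 <= y <= 1 ->
    {for y, continuous (fun t => dP (t, z))}) ->
  \int[leb2]_(p in Omega) dP p = \int[leb]_(z in strip) (P (1, z) - P (-1, z)).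
Proof.
move=> mdP dPC dP0 dPE cdP.
have mO := @measurable_Omega R.
have iO : intOmega dP.
  exact: (integrable_bsupp mdP dPC dP0).
rewrite /Rintegral; congr fine.
rewrite integral_mkcond -integral21_prod_meas1; last first.
  exact: ((integrable_mkcond _ mO).1 iO).
rewrite [RHS]integral_mkcond; apply: eq_integral => z _.
rewrite /fubini_G /patch.
case: ifPn => [|/negP zs]; last first.
  rewrite integral0_eq// => y _; rewrite ifF//.
  by apply/negbTE/negP; rewrite !inE in zs *; case.
rewrite inE /strip /= in_itv /= => z0.
have lt11 : (-1 : R) < 1 by lra.
rewrite -(FTC_is_derive lt11 (fun y => @dPE y z z0) (fun y => @cdP y z z0)).
rewrite integral_itv_bndoo; last first.
  apply/measurable_EFinP; apply: open_continuous_measurable_fun => // y.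
  by rewrite inE /= in_itv /= => /andP[/ltW ? /ltW ?]; apply: cdP; lra.
rewrite [RHS]integral_mkcond; apply: eq_integral => y _.
rewrite /patch; case: ifPn => yy; case: ifPn => y1 //; exfalso.
  by move: yy y1; rewrite !inE OmegaE => -[/= h _] /negP; apply; rewrite inE.
move: yy => /negP; apply; rewrite inE OmegaE; split => /=.
  by rewrite inE in y1.
by rewrite /strip /= in_itv.
Qed.

(** Here the slices reach z = 0, where test functions of X are free: the upper boundary term
    disappears through [P] itself, the lower one through its bounded depth. *)
Lemma integral_slice_z P dP (M C : R) : 0 <= M ->
  measOmega dP ->
  (forall p, Omega p -> `|dP p| <= C) ->
  (forall p, p.2 < - M -> dP p = 0) ->
  (forall p, p.2 < - M -> P p = 0) ->
  (forall y : R, -1 < y < 1 -> P (y, 0) = 0) ->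
  (forall y z : R, -1 < y < 1 -> z <= 0 ->
    is_derive z 1 (fun t => P (y, t)) (dP (y, z))) ->
  (forall y z : R, -1 < y < 1 -> z <= 0 ->
    {for z, continuous (fun t => dP (y, t))}) ->
  \int[leb2]_(p in Omega) dP p = 0.
Proof.
move=> M0 mdP dPC dP0 P0 Pz0 dPE cdP.
have mO := @measurable_Omega R.
have iO : intOmega dP.
  by apply: (integrable_bsupp mdP dPC (M := M)) => p _; exact: dP0.
rewrite /Rintegral integral_mkcond -integral12_prod_meas1; last first.
  exact: ((integrable_mkcond _ mO).1 iO).
rewrite (_ : (\int[_]_x _)%E = 0%E)//.
rewrite integral0_eq// => y _; rewrite /fubini_F.
have [y1|y1] := pselect (-1 < y < 1); last first.
  rewrite integral0_eq// => z _; rewrite /patch ifF//.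
  by apply/negbTE/negP; rewrite !inE => -[].
(* [P] vanishes strictly below - [M], hence a lower endpoint strictly below it. *)
pose N := M + 1.
have FTC : (\int[leb]_(z in `[(- N)%R, 0%R]) (dP (y, z))%:E = 0)%E.
  have N0 : - N < 0 by rewrite /N; lra.
  have dF (z : R) (h : - N <= z <= 0) := dPE y z y1 (proj2 (andP h)).
  have cF (z : R) (h : - N <= z <= 0) := cdP y z y1 (proj2 (andP h)).
  by rewrite (FTC_is_derive N0 dF cF) Pz0// P0 ?subrr// /= /N; lra.
rewrite -[RHS]FTC integral_itv_bndoo; last first.
  apply/measurable_EFinP; apply: open_continuous_measurable_fun => // z.
  by rewrite inE /= in_itv /= => /andP[_ /ltW ?]; apply: cdP; lra.
rewrite [RHS]integral_mkcond; apply: eq_integral => z _.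
rewrite /patch; case: ifPn => yy; case: ifPn => z1 //.
  move: yy z1; rewrite !inE => -[_ /= z0] /negP; rewrite inE /= in_itv /= z0 andbT => /negP zN.
  by rewrite dP0// /=; move: zN; rewrite -leNgt /N; lra.
exfalso; move: yy => /negP; apply; rewrite inE; split => //=.
by move: z1; rewrite inE /= in_itv /= => /andP[].
Qed.

End SliceIntegration.

(** * Fluxes against functions with zero trace *)

Section Flux.
Context {R : realType}.
Implicit Types (v u : R * R -> R) (p : R * R).

(** Along the line through [p] in direction [w] both difference quotients are the same function of
    h; this translates partial derivatives into one-variable ones and back. *)
Lemma is_derive_slice v p w (g : R -> R) (s d : R) :
  (forall h, v (h *: w + p) = g (h + s)) -> is_derive p w v d <-> is_derive s 1 g d.
Proof.
move=> vg; have v0 : v p = g s by have := vg 0; rewrite scale0r !add0r.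
have e : (fun h : R => h^-1 *: ((v \o shift p) (h *: w) - v p)) =
  (fun h => h^-1 *: ((g \o shift s) (h *: 1) - g s)).
  by apply/funext => h /=; rewrite v0 vg [h *: 1]mulr1.
split=> -[dv ev].
- have dv' : derivable g s 1 by rewrite /derivable -e.
  by apply: (DeriveDef dv'); rewrite -ev /derive -e.
- have dv' : derivable v p w by rewrite /derivable e.
  by apply: (DeriveDef dv'); rewrite -ev /derive e.
Qed.

Lemma is_derive_ey v (y z d : R) :
  is_derive (y, z) (ey : R * R) v d <-> is_derive y 1 (fun t => v (t, z)) d.
Proof.
apply: is_derive_slice => h; congr v; apply/pair_equal_spec.
by rewrite /= scaler0 add0r [h *: 1]mulr1.
Qed.

Lemma is_derive_ez v (y z d : R) :
  is_derive (y, z) (ez : R * R) v d <-> is_derive z 1 (fun t => v (y, t)) d.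
Proof.
apply: is_derive_slice => h; congr v; apply/pair_equal_spec.
by rewrite /= scaler0 add0r [h *: 1]mulr1.
Qed.

Lemma Ck1P v (dy dz : R * R -> R) :
  continuous v -> continuous dy -> continuous dz ->
  (forall y z : R, is_derive y 1 (fun t => v (t, z)) (dy (y, z))) ->
  (forall y z : R, is_derive z 1 (fun t => v (y, t)) (dz (y, z))) ->
  [/\ Ck 1 v, (fun p => 'D_ey v p) = dy & (fun p => 'D_ez v p) = dz].
Proof.
move=> cv cdy cdz hy hz.
have hy' p : is_derive p (ey : R * R) v (dy p) by case: p => y z; exact/is_derive_ey.
have hz' p : is_derive p (ez : R * R) v (dz p) by case: p => y z; exact/is_derive_ez.
have ey' : (fun p => 'D_ey v p) = dy by apply/funext => p; exact: derive_val.
have ez' : (fun p => 'D_ez v p) = dz by apply/funext => p; exact: derive_val.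
split; [|exact: ey'|exact: ez'].
split; [exact: cv| |by rewrite ey'|by rewrite ez'].
by move=> p; split; exact: ex_derive.
Qed.

Lemma Ck1_slices v : Ck 1 v ->
  [/\ continuous v, continuous (fun p => 'D_ey v p), continuous (fun p => 'D_ez v p),
   (forall y z : R, is_derive y 1 (fun t => v (t, z)) ('D_ey v (y, z))) &
   (forall y z : R, is_derive z 1 (fun t => v (y, t)) ('D_ez v (y, z)))].
Proof.
move=> [cv dv cy cz]; split; [exact: cv|exact: cy|exact: cz| |] => y z.
  by apply/is_derive_ey; apply: derivableP; have [] := dv (y, z).
by apply/is_derive_ez; apply: derivableP; have [] := dv (y, z).
Qed.

Lemma continuous_slice_y v (y z : R) : {for (y, z), continuous v} ->
  {for y, continuous (fun t => v (t, z))}.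
Proof.
move=> cv; apply: (@cvg_comp _ _ _ (fun t : R => (t, z)) v) cv.
have h1 : (id t) @[t --> y] --> y by exact: cvg_id.
have h2 : (cst z t) @[t --> y] --> z by exact: cvg_cst.
exact: (cvg_pair h1 h2).
Qed.

Lemma continuous_slice_z v (y z : R) : {for (y, z), continuous v} ->
  {for z, continuous (fun t => v (y, t))}.
Proof.
move=> cv; apply: (@cvg_comp _ _ _ (fun t : R => (y, t)) v) cv.
have h1 : (cst y t) @[t --> z] --> y by exact: cvg_cst.
have h2 : (id t) @[t --> z] --> z by exact: cvg_id.
exact: (cvg_pair h1 h2).
Qed.

Lemma continuous_bounded_box v (a M : R) :
  (forall p, -1 <= p.1 <= 1 -> - M <= p.2 <= a -> {for p, continuous v}) ->
  exists2 C, 0 <= C & forall p, -1 <= p.1 <= 1 -> - M <= p.2 <= a -> `|v p| <= C.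
Proof.
move=> cv.
have /compact_bounded[K [_ hK]] : compact (v @` (`[-1, 1] `*` `[- M, a])).
  apply: continuous_compact; last by apply: compact_setX; exact: segment_compact.
  apply: continuous_in_subspaceT => p; rewrite inE => -[/= p1 p2].
  by apply: cv; [move: p1|move: p2]; rewrite in_itv.
exists (`|K| + 1); first by rewrite addr_ge0.
move=> p p1 p2; apply: hK; first by rewrite (le_lt_trans (ler_norm _))// ltrDl.
by exists p => //; split; rewrite /= in_itv.
Qed.

(* A compactly supported field whose divergence is only required to exist slice by slice. *)
Record flux (M C : R) (G1 G2 dG1 dG2 : R * R -> R) : Prop := {
  flux_ge0 : 0 <= M;
  flux_meas1 : measurable_fun (lower : set (plane R)) G1;
  flux_meas2 : measurable_fun (lower : set (plane R)) G2;
  flux_dmeas1 : measurable_fun (lower : set (plane R)) dG1;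
  flux_dmeas2 : measurable_fun (lower : set (plane R)) dG2;
  flux_bnd : forall p, -1 <= p.1 <= 1 -> p.2 < 0 ->
    [/\ `|G1 p| <= C, `|G2 p| <= C, `|dG1 p| <= C & `|dG2 p| <= C];
  flux_supp : forall p, p.2 < - M ->
    [/\ G1 p = 0, G2 p = 0, dG1 p = 0 & dG2 p = 0];
  flux_top : forall y : R, -1 < y < 1 -> G2 (y, 0) = 0;
  flux_dy : forall y z : R, z < 0 -> -1 <= y <= 1 ->
    is_derive y 1 (fun t => G1 (t, z)) (dG1 (y, z));
  flux_cy : forall y z : R, z < 0 -> -1 <= y <= 1 ->
    {for y, continuous (fun t => dG1 (t, z))};
  flux_dz : forall y z : R, -1 < y < 1 -> z <= 0 ->
    is_derive z 1 (fun t => G2 (y, t)) (dG2 (y, z));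
  flux_cz : forall y z : R, -1 < y < 1 -> z <= 0 ->
    {for z, continuous (fun t => dG2 (y, t))} }.

Lemma is_derive_continuous (f : R -> R) (x d : R) :
  is_derive x 1 f d -> {for x, continuous f}.
Proof.
move=> h; apply: differentiable_continuous.
by apply/derivable1_diffP; exact: ex_derive.
Qed.

Lemma integrable_strip_bsupp (f : R -> R) (M C : R) : measurable_fun strip f ->
  (forall z, z < 0 -> `|f z| <= C) -> (forall z, z < - M -> f z = 0) ->
  leb.-integrable strip (EFin \o f).
Proof.
move=> mf fC f0; have mS := @measurable_strip R.
apply: (@le_integrableR _ _ _ leb _ mS _
  (fun z => C * \1_(`[- M, 0[%classic : set R) z)) => //.
  move=> z; rewrite /strip /= in_itv /= => z0; rewrite indicE mem_setE in_itv /= z0 andbT.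
  by case: (leP (- M) z) => [_|/f0 ->]; rewrite ?mulr1 ?fC// mulr0 normr0.
apply: integrableZR => //.
have mI : measurable (`[- M, 0[%classic : set R) by exact: measurable_itv.
apply/integrableP; split; first by apply/measurable_EFinP; exact: measurable_indic.
under eq_integral do rewrite /= ger0_norm//.
rewrite integral_indic// (@le_lt_trans _ _ (leb (`[- M, 0[%classic : set R)))//.
  by apply: le_measure; rewrite ?inE//; exact: measurableI.
by rewrite lebesgue_measure_itv /=; case: ifP => _; rewrite -?EFinB ltry.
Qed.

Lemma side_bounds : -1 <= (1 : R) <= 1 /\ -1 <= (-1 : R) <= 1.
Proof. by lra. Qed.

(** The A's stand for the pairings with phi, the e's for those with an approximant: [e1 + e3] is the
    lateral boundary term and [e2 + e4 = 0] the identity on vertical slices. *)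
Lemma flux_arith (A1 A2 A3 A4 e1 e2 e3 e4 : R) : e2 + e4 = 0 ->
  A1 + A2 + (A3 + A4) = e1 + e3 - (e1 - A1) - (e2 - A2) - (e3 - A3) - (e4 - A4).
Proof. by move=> *; lra. Qed.

Section FluxTheory.
Variables (M C : R) (G1 G2 dG1 dG2 : R * R -> R).
Hypothesis hG : flux M C G1 G2 dG1 dG2.
Let M0 : 0 <= M := flux_ge0 hG.

Let Omega_closed p : Omega p -> -1 <= p.1 <= 1 /\ p.2 < 0.
Proof. by move=> [/andP[/ltW -> /ltW ->] ->]. Qed.

Let measurable_Omegafun (f : plane R -> R) : measurable_fun (lower : set (plane R)) f ->
  measOmega f.
Proof. by apply: measurable_funS; [exact: measurable_lower|move=> p []]. Qed.

Let measurable_Omegacont (f : R * R -> R) : continuous f ->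
  measurable_fun (lower : set (plane R)) f.
Proof. by move=> cf; apply: measurable_funTS; exact: continuous_measurable_plane. Qed.

Lemma flux_component (f : R * R -> R) : f \in [:: G1; G2; dG1; dG2] ->
  [/\ measurable_fun (lower : set (plane R)) f,
   (forall p, -1 <= p.1 <= 1 -> p.2 < 0 -> `|f p| <= C) &
   (forall p, p.2 < - M -> f p = 0)].
Proof.
move=> fG.
have [h1 h2] : (forall p, -1 <= p.1 <= 1 -> p.2 < 0 -> `|f p| <= C) /\
   (forall p, p.2 < - M -> f p = 0).
  by split=> p p1 => [p2|]; [have := flux_bnd hG p1 p2|have := flux_supp hG p1];
    case; move: fG; rewrite !inE => /or4P[] /eqP ->.
by split => //; move: fG; rewrite !inE => /or4P[] /eqP ->; case: hG.
Qed.

Lemma flux_integrable (f : R * R -> R) v : f \in [:: G1; G2; dG1; dG2] -> continuous v ->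
  intOmega (fun p => f p * v p).
Proof.
move=> /flux_component[mf fC f0] cv.
have [K K0 vK] := continuous_bounded_box (a := 0) (M := M) (fun p _ _ => cv p).
apply: (@integrable_bsupp _ _ M (C * K)).
- apply: measurable_Omegafun; apply: measurable_funM => //.
  exact: measurable_Omegacont.
- move=> p /Omega_closed[p1 p2].
  have [pM|Mp] := ltP p.2 (- M).
    rewrite f0// mul0r normr0 mulr_ge0//.
    by apply: le_trans (fC p p1 p2).
  by rewrite normrM ler_pM// ?fC// vK// Mp ltW.
- by move=> p _ pM; rewrite f0// mul0r.
Qed.

Lemma flux_slice_y v : Ck 1 v ->
  \int[leb2]_(p in Omega) (G1 p * 'D_ey v p + dG1 p * v p) =
  \int[leb]_(z in strip) (G1 (1, z) * v (1, z) - G1 (-1, z) * v (-1, z)).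
Proof.
move=> /Ck1_slices[cv cvy cvz dvy dvz].
have [K K0 vK] := continuous_bounded_box (a := 0) (M := M) (fun p _ _ => cv p).
have [K' K'0 vK'] := continuous_bounded_box (a := 0) (M := M) (fun p _ _ => cvy p).
apply: (@integral_slice_y _ (fun p => G1 p * v p) _ M (C * K' + C * K)) => //.
- apply: measurable_Omegafun; apply: measurable_funD; apply: measurable_funM.
  + exact: flux_meas1 hG.
  + exact: (measurable_Omegacont cvy).
  + exact: flux_dmeas1 hG.
  + exact: (measurable_Omegacont cv).
- move=> p /Omega_closed[p1 p2].
  have [g1 g2 g3 g4] := flux_bnd hG p1 p2.
  have [pM|Mp] := ltP p.2 (- M).
    have [-> _ -> _] := flux_supp hG pM; rewrite !mul0r addr0 normr0.
    have C0 : 0 <= C by apply: le_trans g1.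
    by rewrite addr_ge0// mulr_ge0.
  rewrite (le_trans (ler_normD _ _))// lerD// normrM ler_pM//.
    by rewrite vK'// Mp ltW.
  by rewrite vK// Mp ltW.
- by move=> p _ pM; have [-> _ -> _] := flux_supp hG pM; rewrite !mul0r addr0.
- move=> y z z0 y1.
  have d1 := flux_dy hG z0 y1; have d2 := dvy y z.
  by apply: is_derive_eq; rewrite /= /GRing.scale /= mulrC addrC mulrC; ring.
- move=> y z z0 y1.
  apply: continuousD; apply: continuousM.
  + exact: is_derive_continuous (flux_dy hG z0 y1).
  + exact: (@continuous_slice_y (fun p => 'D_ey v p) y z (cvy _)).
  + exact: (flux_cy hG z0 y1).
  + exact: (continuous_slice_y (cv _)).
Qed.

Lemma flux_slice_z v : Ck 1 v ->
  \int[leb2]_(p in Omega) (G2 p * 'D_ez v p + dG2 p * v p) = 0.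
Proof.
move=> /Ck1_slices[cv cvy cvz dvy dvz].
have [K K0 vK] := continuous_bounded_box (a := 0) (M := M) (fun p _ _ => cv p).
have [K' K'0 vK'] := continuous_bounded_box (a := 0) (M := M) (fun p _ _ => cvz p).
apply: (@integral_slice_z _ (fun p => G2 p * v p) _ M (C * K' + C * K)) => //.
- apply: measurable_Omegafun; apply: measurable_funD; apply: measurable_funM.
  + exact: flux_meas2 hG.
  + exact: (measurable_Omegacont cvz).
  + exact: flux_dmeas2 hG.
  + exact: (measurable_Omegacont cv).
- move=> p /Omega_closed[p1 p2].
  have [g1 g2 g3 g4] := flux_bnd hG p1 p2.
  have [pM|Mp] := ltP p.2 (- M).
    have [_ -> _ ->] := flux_supp hG pM; rewrite !mul0r addr0 normr0.
    have C0 : 0 <= C by apply: le_trans g1.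
    by rewrite addr_ge0// mulr_ge0.
  rewrite (le_trans (ler_normD _ _))// lerD// normrM ler_pM//.
    by rewrite vK'// Mp ltW.
  by rewrite vK// Mp ltW.
- by move=> p pM; have [_ -> _ ->] := flux_supp hG pM; rewrite !mul0r addr0.
- by move=> p pM; have [_ -> _ _] := flux_supp hG pM; rewrite mul0r.
- by move=> y y1; rewrite (flux_top hG)// mul0r.
- move=> y z y1 z0.
  have d1 := flux_dz hG y1 z0; have d2 := dvz y z.
  by apply: is_derive_eq; rewrite /= /GRing.scale /= mulrC addrC mulrC; ring.
- move=> y z y1 z0.
  apply: continuousD; apply: continuousM.
  + exact: is_derive_continuous (flux_dz hG y1 z0).
  + exact: (@continuous_slice_z (fun p => 'D_ez v p) y z (cvz _)).
  + exact: (flux_cz hG y1 z0).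
  + exact: (continuous_slice_z (cv _)).
Qed.

Lemma flux_sqr_integrable (f : R * R -> R) : f \in [:: G1; G2; dG1; dG2] ->
  intOmega (fun p => f p ^+ 2).
Proof.
move=> /flux_component[mf fC f0].
apply: (@integrable_bsupp _ _ M (C * C)).
- by apply: measurable_Omegafun; exact: measurable_funX.
- by move=> p /Omega_closed[p1 p2]; rewrite normrX expr2 ler_pM// fC.
- by move=> p _ pM; rewrite f0// expr0n.
Qed.

Lemma flux_integrable_L2 (f w : R * R -> R) : f \in [:: G1; G2; dG1; dG2] ->
  inL2 w -> intOmega (fun p => f p * w p).
Proof.
move=> fG [mw iw].
apply: integrable_mul_L2 => //; first exact: measurable_Omega.
  by apply: measurable_Omegafun; move: fG; rewrite !inE => /or4P[] /eqP ->; case: hG.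
exact: flux_sqr_integrable.
Qed.

Lemma flux_side_measurable (a : R) : measurable_fun (strip : set R) (fun z => G1 (a, z)).
Proof.
apply: (@measurable_comp _ _ _ _ _ _ (lower : set (plane R)) G1) => //.
- exact: measurable_lower.
- by move=> _ [z zs <-]; move: zs; rewrite /strip /lower /= in_itv.
- exact: flux_meas1 hG.
- by apply: measurable_funTS; exact: measurable_pair1.
Qed.

Lemma flux_side_integrable (a : R) : -1 <= a <= 1 ->
  leb.-integrable (strip : set R) (EFin \o (fun z => G1 (a, z) ^+ 2)).
Proof.
move=> a1.
apply: (@integrable_strip_bsupp _ M (C * C)).
- by apply: measurable_funX; exact: flux_side_measurable.
- by move=> z z0; have [g _ _ _] := flux_bnd hG (p := (a, z)) a1 z0; rewrite normrX expr2 ler_pM.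
- by move=> z zM; have [-> _ _ _] := flux_supp hG (p := (a, z)) zM; rewrite expr0n.
Qed.

Lemma flux_side_integrableM (a : R) v : -1 <= a <= 1 -> continuous v ->
  leb.-integrable (strip : set R) (EFin \o (fun z => G1 (a, z) * v (a, z))).
Proof.
move=> a1 cv.
have [K K0 vK] := continuous_bounded_box (a := 0) (M := M) (fun p _ _ => cv p).
apply: (@integrable_strip_bsupp _ M (C * K)).
- apply: measurable_funM; first exact: flux_side_measurable.
  apply: measurable_funTS.
  exact: measurableT_comp (continuous_measurable_plane cv) (measurable_pair1 _).
- move=> z z0; have [g _ _ _] := flux_bnd hG (p := (a, z)) a1 z0; rewrite normrM.
  have [zM|Mz] := ltP z (- M).
    have [-> _ _ _] := flux_supp hG (p := (a, z)) zM.
    by rewrite normr0 mul0r mulr_ge0// (le_trans _ g).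
  by rewrite ler_pM// vK//= Mz ltW.
- by move=> z zM; have [-> _ _ _] := flux_supp hG (p := (a, z)) zM; rewrite mul0r.
Qed.

(* Only the approximants defining the trace enter, not the weak gradient of phi: the latter
   can therefore be recovered by taking test functions as fluxes. *)
Lemma flux_trace0 (phi : R * R -> R) (gphi : R * R -> R * R) : inL2 phi ->
  inL2 (fun p => (gphi p).1) -> inL2 (fun p => (gphi p).2) ->
  lateral_trace phi gphi (cst 0) (cst 0) ->
  \int[leb2]_(p in Omega) (G1 p * (gphi p).1 + G2 p * (gphi p).2) =
  - \int[leb2]_(p in Omega) ((dG1 p + dG2 p) * phi p).
Proof.
move=> L2phi L2g1 L2g2 [v [hv v0 dv0 vm vp]].
have mO := @measurable_Omega R.
have iphi f fG := @flux_integrable_L2 f phi fG L2phi.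
have ig1 f fG := @flux_integrable_L2 f _ fG L2g1.
have ig2 f fG := @flux_integrable_L2 f _ fG L2g2.
have i1 : G1 \in [:: G1; G2; dG1; dG2] by rewrite !inE eqxx.
have i2 : G2 \in [:: G1; G2; dG1; dG2] by rewrite !inE eqxx ?orbT.
have i3 : dG1 \in [:: G1; G2; dG1; dG2] by rewrite !inE eqxx ?orbT.
have i4 : dG2 \in [:: G1; G2; dG1; dG2] by rewrite !inE eqxx ?orbT.
have sl n := Ck1_slices (hv n).1.
have cv n : continuous (v n) by have [] := sl n.
have cvy n : continuous (fun p => 'D_ey (v n) p) by have [] := sl n.
have cvz n : continuous (fun p => 'D_ez (v n) p) by have [] := sl n.
have mvy n := measurable_Omegafun (measurable_Omegacont (cvy n)).
have mvz n := measurable_Omegafun (measurable_Omegacont (cvz n)).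
have mv n := measurable_Omegafun (measurable_Omegacont (cv n)).
have pair (f w : R * R -> R) (w_ : nat -> R * R -> R) :
    f \in [:: G1; G2; dG1; dG2] -> inL2 w -> (forall n, continuous (w_ n)) ->
    (\int[leb2]_(p in Omega) ((w_ n p - w p) ^+ 2)%:E @[n --> \oo] --> 0)%E ->
    \int[leb2]_(p in Omega) (f p * (w_ n p - w p)) @[n --> \oo] --> (0 : R).
  move=> fG [mw iw] cw w0.
  apply: L2_pairing_cvg0 => //.
  - by apply: measurable_Omegafun; move: fG; rewrite !inE => /or4P[] /eqP ->; case: hG.
  - exact: flux_sqr_integrable.
  - move=> n; apply: measurable_funB => //.
    exact: measurable_Omegafun (measurable_Omegacont (cw n)).
have dv_cvg (a : nat -> R * R -> R) :
    (forall n, measOmega (a n)) ->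
    (forall n p, a n p ^+ 2 <= ('D_ey (v n) p - (gphi p).1) ^+ 2 +
           ('D_ez (v n) p - (gphi p).2) ^+ 2) ->
    (\int[leb2]_(p in Omega) (a n p ^+ 2)%:E @[n --> \oo] --> 0)%E.
  move=> ma ale.
  apply: (@squeeze_cvge _ _ _ _ (cst 0%E) _ (fun n => \int[leb2]_(p in Omega)
          (('D_ey (v n) p - (gphi p).1) ^+ 2 +
           ('D_ez (v n) p - (gphi p).2) ^+ 2)%:E)%E) dv0; last exact: cvg_cst.
  apply: nearW => n; apply/andP; split.
    by apply: integral_ge0 => p _; rewrite lee_fin sqr_ge0.
  apply: ge0_le_integral => //.
  - by move=> p _; rewrite lee_fin sqr_ge0.
  - by apply/measurable_EFinP; exact: measurable_funX.
  - have [[m1 _] [m2 _]] := (L2g1, L2g2).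
    by apply/measurable_EFinP; apply: measurable_funD; apply: measurable_funX;
      exact: measurable_funB.
  - by move=> p _; rewrite lee_fin.
have dvy0 : (\int[leb2]_(p in Omega) (('D_ey (v n) p - (gphi p).1) ^+ 2)%:E
    @[n --> \oo] --> 0)%E.
  apply: (dv_cvg (fun n p => 'D_ey (v n) p - (gphi p).1)).
    by move=> n; apply: measurable_funB => //; have [] := L2g1.
  by move=> n p; rewrite lerDl sqr_ge0.
have dvz0 : (\int[leb2]_(p in Omega) (('D_ez (v n) p - (gphi p).2) ^+ 2)%:E
    @[n --> \oo] --> 0)%E.
  apply: (dv_cvg (fun n p => 'D_ez (v n) p - (gphi p).2)).
    by move=> n; apply: measurable_funB => //; have [] := L2g2.
  by move=> n p; rewrite lerDr sqr_ge0.
have side (a : R) : -1 <= a <= 1 ->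
    (\int[leb]_(z in strip) ((v n (a, z) - cst 0 z) ^+ 2)%:E @[n --> \oo] --> 0)%E ->
    \int[leb]_(z in strip) (G1 (a, z) * v n (a, z)) @[n --> \oo] --> (0 : R).
  move=> a1 va.
  apply: L2_pairing_cvg0 => //.
  - exact: measurable_itv.
  - exact: flux_side_measurable.
  - exact: flux_side_integrable.
  - move=> n; apply: measurable_funTS.
    exact: measurableT_comp (continuous_measurable_plane (cv n)) (measurable_pair1 _).
  - by move: va; under eq_fun do under eq_integral do rewrite /cst subr0.
have [a1 a2] := side_bounds.
(* [K] does not depend on n, yet for every n it is a combination of null sequences: the boundary
   term vanishes in the limit by the zero trace, the four errors by L2 convergence of the
   approximants and of their gradients. *)
pose K := \int[leb2]_(p in Omega) (G1 p * (gphi p).1 + G2 p * (gphi p).2) +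
   \int[leb2]_(p in Omega) ((dG1 p + dG2 p) * phi p).
pose B n := \int[leb]_(z in strip) (G1 (1, z) * v n (1, z)) -
  \int[leb]_(z in strip) (G1 (-1, z) * v n (-1, z)).
pose E1 n := \int[leb2]_(p in Omega) (G1 p * ('D_ey (v n) p - (gphi p).1)).
pose E2 n := \int[leb2]_(p in Omega) (G2 p * ('D_ez (v n) p - (gphi p).2)).
pose E3 n := \int[leb2]_(p in Omega) (dG1 p * (v n p - phi p)).
pose E4 n := \int[leb2]_(p in Omega) (dG2 p * (v n p - phi p)).
have KE n : K = B n - E1 n - E2 n - E3 n - E4 n.
  have S1 := flux_slice_y (hv n).1; have S2 := flux_slice_z (hv n).1.
  have I1 := flux_integrable i1 (cvy n); have I2 := flux_integrable i2 (cvz n).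
  have I3 := flux_integrable i3 (cv n); have I4 := flux_integrable i4 (cv n).
  have J1 := ig1 _ i1; have J2 := ig2 _ i2; have J3 := iphi _ i3; have J4 := iphi _ i4.
  have SB := RintegralB (@measurable_strip R) (flux_side_integrableM a1 (cv n))
    (flux_side_integrableM a2 (cv n)).
  rewrite SB (RintegralD mO I1 I3) in S1; rewrite (RintegralD mO I2 I4) in S2.
  rewrite /B -S1.
  have RB (f u w : R * R -> R) :
      intOmega (fun p => f p * u p) ->
      intOmega (fun p => f p * w p) ->
      \int[leb2]_(p in Omega) (f p * (u p - w p)) =
      \int[leb2]_(p in Omega) (f p * u p) - \int[leb2]_(p in Omega) (f p * w p).
    move=> fu fw; rewrite -RintegralB//.
    by apply: eq_Rintegral => p _; rewrite mulrBr.
  have KE : \int[leb2]_(p in Omega) ((dG1 p + dG2 p) * phi p) =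
      \int[leb2]_(p in Omega) (dG1 p * phi p) + \int[leb2]_(p in Omega) (dG2 p * phi p).
    by rewrite -RintegralD//; apply: eq_Rintegral => p _; rewrite mulrDl.
  rewrite /K /E1 /E2 /E3 /E4 KE (RB _ _ _ I1 J1) (RB _ _ _ I2 J2) (RB _ _ _ I3 J3).
  by rewrite (RB _ _ _ I4 J4) (RintegralD mO J1 J2); exact: flux_arith S2.
suff : K = 0 by move/eqP; rewrite addr_eq0 => /eqP.
have : cst K n @[n --> \oo] --> 0 - 0 - 0 - 0 - 0 - (0:R).
  rewrite (_ : cst K = fun n => B n - E1 n - E2 n - E3 n - E4 n); last first.
    by apply/funext => n; rewrite /cst; exact: KE.
  apply: cvgB; last exact: pair.
  apply: cvgB; last exact: pair.
  apply: cvgB; last exact: (pair G2 _ (fun n p => 'D_ez (v n) p) i2 L2g2 cvz dvz0).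
  apply: cvgB; last exact: (pair G1 _ (fun n p => 'D_ey (v n) p) i1 L2g1 cvy dvy0).
  by apply: cvgB; apply: side.
rewrite !subr0 => /cvg_lim <- //; apply/esym/cvg_lim => //; exact: cvg_cst.
Qed.

Lemma flux_calX (phi : R * R -> R) (gphi : R * R -> R * R) : calX phi gphi ->
  \int[leb2]_(p in Omega) (G1 p * (gphi p).1 + G2 p * (gphi p).2) =
  - \int[leb2]_(p in Omega) ((dG1 p + dG2 p) * phi p).
Proof. by move=> [[? ? ? _] ? _ _]; exact: flux_trace0. Qed.

End FluxTheory.

End Flux.

(** * Regularisations of one variable *)

Ltac nneg := repeat first [ assumption | by apply: ltW | exact: ler01 | exact: ler0n
  | exact: sqr_ge0 | exact: normr_ge0 | apply: addr_ge0 | apply: divr_ge0 | apply: mulr_ge0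
  | apply: exprn_ge0 ].

Section OneVariable.
Context {R : realType}.
Implicit Types (f g df : R -> R) (s t e : R).

Lemma is_derive1_compE f g (x a b : R) :
  is_derive (g x) 1 f a -> is_derive x 1 g b ->
  is_derive x 1 (fun t => f (g t)) (a * b).
Proof. exact: is_derive1_comp. Qed.

Lemma MVT_is_derive f df (a b : R) : a <= b ->
  (forall x, a <= x <= b -> is_derive x 1 f (df x)) ->
  exists2 c, a <= c <= b & f b - f a = df c * (b - a).
Proof.
move=> ab hf.
have [||c cab ->] := @MVT_segment R f df a b ab.
- by move=> x; rewrite in_itv /= => /andP[/ltW ax /ltW xb]; apply: hf; rewrite ax.
- apply: derivable_within_continuous => x; rewrite in_itv /= => h.
  by have hx := hf x h; exact: ex_derive.
by exists c => //; rewrite in_itv in cab.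
Qed.

Lemma le_is_derive f df (a b : R) : a <= b ->
  (forall x, a <= x <= b -> is_derive x 1 f (df x)) ->
  (forall x, a <= x <= b -> 0 <= df x) -> f a <= f b.
Proof.
move=> ab hf df0; have [c cab e] := MVT_is_derive ab hf.
by rewrite -subr_ge0 e mulr_ge0 ?df0// subr_ge0.
Qed.

Definition pos s : R := Num.max s 0.

Lemma pos_ge0 s : 0 <= pos s. Proof. by rewrite /pos le_max lexx orbT. Qed.
Lemma pos_ge s : s <= pos s. Proof. by rewrite /pos le_max lexx. Qed.
Lemma pos_id s : 0 <= s -> pos s = s. Proof. by rewrite /pos => /max_idPl. Qed.
Lemma pos0E s : s <= 0 -> pos s = 0. Proof. by rewrite /pos => /max_idPr. Qed.
Lemma pos0 : pos 0 = 0. Proof. by rewrite pos0E. Qed.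
Lemma le_pos s t : s <= t -> pos s <= pos t.
Proof. by move=> st; rewrite /pos ge_max !le_max st lexx orbT. Qed.

Lemma continuous_pos : continuous pos.
Proof.
by move=> s; apply: continuous_max; [exact: cvg_id|exact: cvg_cst].
Qed.

(* The corner of pos is harmless for functions whose derivative vanishes at 0. *)
Lemma is_derive_pos f df : (forall t, 0 <= t -> is_derive t 1 f (df t)) ->
  df 0 = 0 -> forall s, is_derive s 1 (fun s => f (pos s)) (df (pos s)).
Proof.
move=> hf df0 s.
have [s0|s0|<-] := ltgtP 0 s.
- rewrite pos_id ?ltW//; apply: (@near_eq_is_derive _ _ _ f) => //.
    near=> t; rewrite pos_id// ltW//; near: t; exact: lt_nbhsr.
  exact: hf (ltW s0).
- rewrite pos0E ?ltW// df0; apply: (@near_eq_is_derive _ _ _ (cst (f 0))) => //.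
  near=> t; rewrite pos0E// ltW//; near: t; exact: lt_nbhsl.
(* At the corner, the Caratheodory slope [g] of [f] composed with [pos] is again a slope: for t < 0
   it equals g 0 = 0, matching the constant value of the composite. *)
- rewrite pos0 df0.
  have := hf 0 (lexx _); rewrite df0 => /is_derive1_caratheodory[g [gE cg g0]].
  apply/is_derive1_caratheodory; exists (fun t => g (pos t)); rewrite !pos0; split=> //.
  + move=> t; have [t0|t0] := leP 0 t.
      by rewrite pos_id.
    by rewrite pos0E ?ltW// g0 subrr mul0r.
  + by apply: continuous_comp; [exact: continuous_pos|rewrite pos0].
Unshelve. all: by end_near. Qed.

Section Cvg.
Context {T : Type} {F : set_system T} {FF : Filter F}.
Implicit Types (u : T -> R) (a : R).

Lemma cvg_pos u a : u t @[t --> F] --> a -> pos (u t) @[t --> F] --> pos a.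
Proof. by move=> ua; exact: (cvg_comp _ _ ua (@continuous_pos a)). Qed.

Lemma cvg_sin u a : u t @[t --> F] --> a -> sin (u t) @[t --> F] --> sin a.
Proof. by move=> ua; exact: (cvg_comp _ _ ua (@continuous_sin _ a)). Qed.

Lemma cvg_cos u a : u t @[t --> F] --> a -> cos (u t) @[t --> F] --> cos a.
Proof. by move=> ua; exact: (cvg_comp _ _ ua (@continuous_cos _ a)). Qed.

Lemma cvg_sqrt u a : u t @[t --> F] --> a -> Num.sqrt (u t) @[t --> F] --> Num.sqrt a.
Proof. by move=> ua; exact: (cvg_comp _ _ ua (@sqrt_continuous _ a)). Qed.

Lemma cvg_exprn n u a : u t @[t --> F] --> a -> u t ^+ n @[t --> F] --> a ^+ n.
Proof. by move=> ua; exact: (cvg_comp _ _ ua (@exprn_continuous _ n a)). Qed.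

Lemma cvg_inv u a : a != 0 -> u t @[t --> F] --> a -> (u t)^-1 @[t --> F] --> a^-1.
Proof. exact: cvgV. Qed.

End Cvg.

(* hh tends to the indicator of s > 0 and is the derivative of mm, which tends to pos. *)
Definition hh e s : R := pos s ^+ 2 / (pos s ^+ 2 + e ^+ 2).
Definition dhh e s : R := 2 * pos s * e ^+ 2 / (pos s ^+ 2 + e ^+ 2) ^+ 2.
Definition mm e s : R := pos s - e * atan (pos s / e).
(* rr lies above pos^2 and its second derivative stays below that of the square. *)
Definition rr e s : R := (pos (s + e) ^+ 3 - pos s ^+ 3) / (3 * e).
Definition drr e s : R := (pos (s + e) ^+ 2 - pos s ^+ 2) / e.
Definition ddrr e s : R := 2 * (pos (s + e) - pos s) / e.
(* sg tends to the sign function; s * sg s >= s^2 on [-1, 1]. *)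
Definition sg e s : R := s / Num.sqrt (s ^+ 2 + e * (1 - s ^+ 2)).
Definition dsg e s : R := e / Num.sqrt (s ^+ 2 + e * (1 - s ^+ 2)) ^+ 3.

Section Regularisations.
Variable e : R.
Hypothesis e0 : 0 < e.

Let q_gt0 t : 0 < t ^+ 2 + e ^+ 2.
Proof. by rewrite ltr_wpDl ?sqr_ge0// exprn_gt0. Qed.

Let q_neq0 t : t ^+ 2 + e ^+ 2 != 0.
Proof. by rewrite gt_eqF. Qed.

Lemma hh_ge0 s : 0 <= hh e s.
Proof. by rewrite /hh divr_ge0 ?sqr_ge0// ltW ?q_gt0. Qed.

Lemma hh_le1 s : hh e s <= 1.
Proof. by rewrite /hh ler_pdivrMr ?q_gt0// mul1r lerDl sqr_ge0. Qed.

Lemma hh_le0 s : s <= 0 -> hh e s = 0.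
Proof. by move=> s0; rewrite /hh pos0E// expr0n /= mul0r. Qed.

Lemma dhh_le0 s : s <= 0 -> dhh e s = 0.
Proof. by move=> s0; rewrite /dhh pos0E// mulr0 !mul0r. Qed.

Lemma dhh_ge0 s : 0 <= dhh e s.
Proof.
rewrite /dhh; apply: divr_ge0; last exact: sqr_ge0.
by apply: mulr_ge0; [rewrite mulr_ge0 ?pos_ge0|exact: sqr_ge0].
Qed.

Lemma is_derive_hh s : is_derive s 1 (hh e) (dhh e s).
Proof.
apply: (is_derive_pos (f := fun t => t ^+ 2 / (t ^+ 2 + e ^+ 2))
  (df := fun t => 2 * t * e ^+ 2 / (t ^+ 2 + e ^+ 2) ^+ 2)); last by rewrite mulr0 !mul0r.
move=> t _; have qt := q_neq0 t.
by apply: is_derive_eq; rewrite /GRing.scale /=; field.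
Qed.

Lemma mm_le0 s : s <= 0 -> mm e s = 0.
Proof. by move=> s0; rewrite /mm pos0E// mul0r atan0 mulr0 subrr. Qed.

Lemma is_derive_mm s : is_derive s 1 (mm e) (hh e s).
Proof.
apply: (is_derive_pos (f := fun t => t - e * atan (t / e))
  (df := fun t => t ^+ 2 / (t ^+ 2 + e ^+ 2))); last by rewrite expr0n /= mul0r.
move=> t _; have qt := q_neq0 t.
have d1 : is_derive t 1 (fun t => atan (t / e)) ((1 + (t / e) ^+ 2)^-1 * e^-1).
  apply: is_derive1_compE; apply: is_derive_eq; rewrite /GRing.scale /=; ring.
apply: is_derive_eq; rewrite /GRing.scale /=; field.
by rewrite qt gt_eqF//= addrC qt.
Qed.

Lemma mm_ge0 s : 0 <= mm e s.
Proof.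
have [s0|s0] := leP s 0; first by rewrite mm_le0.
rewrite -(mm_le0 (lexx 0)); apply: (le_is_derive (ltW s0)) => x _.
  exact: is_derive_mm.
exact: hh_ge0.
Qed.

Lemma atan_ge0 t : 0 <= t -> 0 <= atan t :> R.
Proof. by move=> t0; rewrite -[leLHS]atan0; exact: le_atan. Qed.

Lemma mm_le s : mm e s <= pos s.
Proof.
rewrite /mm lerBlDr lerDl mulr_ge0 ?(ltW e0)// atan_ge0// divr_ge0 ?pos_ge0//.
exact: ltW.
Qed.

(** The gap is e atan (pos s / e), hence below e pi / 2. *)
Lemma mm_close s : pos s - mm e s <= 2 * e.
Proof.
rewrite /mm opprB addrCA subrr addr0 mulrC ler_wpM2r ?(ltW e0)//.
by rewrite (le_trans (ltW (atan_ltpi2 _)))// ltW// pihalf_lt2.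
Qed.

Lemma is_derive_rr s : is_derive s 1 (rr e) (drr e s).
Proof.
have d3 t : is_derive t 1 (fun s => pos s ^+ 3) (3 * pos t ^+ 2).
  apply: (is_derive_pos (f := fun t => t ^+ 3) (df := fun t => 3 * t ^+ 2)).
    by move=> x _; apply: is_derive_eq; rewrite /GRing.scale /=; ring.
  by rewrite expr0n mulr0.
have d3e : is_derive s 1 (fun s => pos (s + e) ^+ 3) (3 * pos (s + e) ^+ 2 * 1).
  apply: (is_derive1_compE (f := fun s => pos s ^+ 3) (g := fun s => s + e)).
  by apply: is_derive_eq; rewrite addr0.
have := d3 s => d3s.
rewrite /rr /drr; apply: is_derive_eq; rewrite /GRing.scale /=; field.
by rewrite gt_eqF.
Qed.

Lemma is_derive_drr s : is_derive s 1 (drr e) (ddrr e s).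
Proof.
have d3 t : is_derive t 1 (fun s => pos s ^+ 2) (2 * pos t).
  apply: (is_derive_pos (f := fun t => t ^+ 2) (df := fun t => 2 * t)).
    by move=> x _; apply: is_derive_eq; rewrite /GRing.scale /=; ring.
  by rewrite mulr0.
have d3e : is_derive s 1 (fun s => pos (s + e) ^+ 2) (2 * pos (s + e) * 1).
  apply: (is_derive1_compE (f := fun s => pos s ^+ 2) (g := fun s => s + e)).
  by apply: is_derive_eq; rewrite addr0.
have := d3 s => d3s.
rewrite /drr /ddrr; apply: is_derive_eq; rewrite /GRing.scale /=; field.
by rewrite gt_eqF.
Qed.

(** [rr e s] is the mean of [pos]^2 over [s, s + e], so monotonicity puts it between the values at
    the two endpoints. The interval lies to the right of s in order that the approximation be from
    above. *)
Lemma rr_ge s : pos s ^+ 2 <= rr e s.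
Proof.
have [s0|s0] := leP 0 s.
  rewrite /rr (pos_id s0) (pos_id (addr_ge0 s0 (ltW e0))) ler_pdivlMr ?mulr_gt0// -subr_ge0.
  rewrite (_ : _ - _ = 3 * s * e ^+ 2 + e ^+ 3); last by ring.
  by move: (e0) => ?; nneg.
rewrite /rr !(@pos0E s (ltW s0)) !expr0n /= subr0.
by move: (e0) (pos_ge0 (s + e)) => ? ?; nneg.
Qed.

Lemma rr_le s : rr e s <= pos (s + e) ^+ 2.
Proof.
rewrite /rr ler_pdivrMr ?mulr_gt0//.
have [s0|s0] := leP 0 s.
  rewrite (pos_id s0) (pos_id (addr_ge0 s0 (ltW e0))) -subr_ge0.
  rewrite (_ : _ - _ = e ^+ 2 * (3 * s + 2 * e)); last by ring.
  by move: (e0) => ?; nneg.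
rewrite !(@pos0E s (ltW s0)) !expr0n /= subr0 exprS mulrC.
rewrite ler_pM ?exprn_ge0 ?pos_ge0//.
rewrite /pos ge_max; apply/andP; split; last by move: (e0) => ?; nneg.
by have := e0; lra.
Qed.

Lemma drr_ge0 s : 0 <= drr e s.
Proof.
by rewrite /drr divr_ge0 ?(ltW e0)// subr_ge0 ler_pXn2r ?nnegrE ?pos_ge0// le_pos// lerDl ltW.
Qed.

(** [drr e s] is the mean of 2 [pos] over [s, s + e]. *)
Lemma drr_ge s : 2 * pos s <= drr e s.
Proof.
have [s0|s0] := leP 0 s; last by rewrite (pos0E (ltW s0)) mulr0 drr_ge0.
rewrite /drr (pos_id s0) (pos_id (addr_ge0 s0 (ltW e0))) ler_pdivlMr// -subr_ge0.
by rewrite (_ : _ - _ = e ^+ 2) ?sqr_ge0//; ring.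
Qed.

Lemma drr_le s : drr e s <= 2 * pos (s + e).
Proof.
rewrite /drr ler_pdivrMr//.
have [s0|s0] := leP 0 s.
  rewrite (pos_id s0) (pos_id (addr_ge0 s0 (ltW e0))) -subr_ge0.
  by rewrite (_ : _ - _ = e ^+ 2) ?sqr_ge0//; ring.
rewrite !(@pos0E s (ltW s0)) !expr0n /= subr0 expr2.
rewrite mulrAC [X in _ <= X]mulrC ler_wpM2l ?pos_ge0//.
rewrite /pos ge_max; apply/andP; split; last by move: (e0) => ?; nneg.
by have := e0; lra.
Qed.

(** [ddrr e s] is twice a difference quotient of [pos], which is 1-Lipschitz. *)
Lemma ddrr_le s : ddrr e s <= 2.
Proof.
rewrite /ddrr ler_pdivrMr// ler_wpM2l// lerBlDl.
rewrite {1}/pos ge_max; apply/andP; split; first by rewrite lerD2r pos_ge.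
by rewrite addr_ge0 ?pos_ge0 ?(ltW e0).
Qed.

Section Sign.
Hypothesis e1 : e <= 1.
Let Q s := s ^+ 2 + e * (1 - s ^+ 2).

(** [Q s] is (1 - e) s^2 + e, a convex combination of s^2 and 1. *)
Lemma sgQ s : s ^+ 2 <= 1 -> [/\ 0 < Q s, s ^+ 2 <= Q s, e <= Q s & Q s <= 1].
Proof.
move=> s1; have s0 := sqr_ge0 s; move: (e0) (e1) => e0' e1'.
by rewrite /Q; move: (s ^+ 2) s0 s1 => t t0 t1; split; nra.
Qed.

Lemma is_derive_sg s : s ^+ 2 <= 1 -> is_derive s 1 (sg e) (dsg e s).
Proof.
move=> s1; have [Q0 _ _ _] := sgQ s1.
have dQ : is_derive s 1 Q (2 * s - e * (2 * s)).
  by rewrite /Q; apply: is_derive_eq; rewrite /GRing.scale /=; ring.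
have dS : is_derive s 1 (fun s => Num.sqrt (Q s))
    ((2 * Num.sqrt (Q s))^-1 * (2 * s - e * (2 * s))).
  by apply: is_derive1_compE; exact: is_derive1_sqrt.
have S0 : Num.sqrt (Q s) != 0 by rewrite gt_eqF// sqrtr_gt0.
rewrite /sg /dsg -/(Q s); apply: is_derive_eq; rewrite /GRing.scale /=.
have : Num.sqrt (Q s) ^+ 2 = Q s by rewrite sqr_sqrtr// ltW.
rewrite -/(Q s); set S := Num.sqrt (Q s) in S0 *; rewrite /Q => S2.
apply/eqP; rewrite -subr_eq0; apply/eqP.
transitivity ((S ^+ 2 - (s ^+ 2 + e * (1 - s ^+ 2))) / S ^+ 3); last by rewrite S2 subrr mul0r.
by field.
Qed.

Lemma sg_sqr_le1 s : s ^+ 2 <= 1 -> `|sg e s| <= 1.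
Proof.
move=> s1; have [Q0 sQ _ _] := sgQ s1.
rewrite /sg normrM normfV (ger0_norm (sqrtr_ge0 _)) ler_pdivrMr ?sqrtr_gt0// mul1r.
by rewrite -sqrtr_sqr ler_sqrt ?(ltW Q0).
Qed.

(** Because sqrt (Q s) <= 1. The more usual s / sqrt (s^2 + e^2) would violate this near |s| = 1,
    and with it the sign of the transition layer. *)
Lemma sg_ge s : s ^+ 2 <= 1 -> s ^+ 2 <= s * sg e s.
Proof.
move=> s1; have [Q0 sQ _ Q1] := sgQ s1.
rewrite /sg mulrA -expr2 ler_pdivlMr ?sqrtr_gt0// ler_piMr ?sqr_ge0//.
by rewrite -[leRHS]sqrtr1 ler_sqrt ?ltr01.
Qed.

Lemma sgE s : s ^+ 2 <= 1 -> sg e s = s / Num.sqrt (Q s) /\ 0 < Num.sqrt (Q s).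
Proof. by move=> s1; have [Q0 _ _ _] := sgQ s1; rewrite sqrtr_gt0. Qed.

Lemma dsg_ge0 s : 0 <= dsg e s.
Proof. by rewrite /dsg divr_ge0 ?(ltW e0)// exprn_ge0 ?sqrtr_ge0. Qed.

(** The bound is e^(-1/2), not uniform in [e]: it only serves to make each single regularised field
    bounded enough to be integrated by parts. *)
Lemma dsg_le s : s ^+ 2 <= 1 -> dsg e s <= e / Num.sqrt e ^+ 3.
Proof.
move=> s1; have [Q0 _ Qe _] := sgQ s1.
rewrite /dsg ler_wpM2l ?(ltW e0)// lef_pV2 ?posrE ?exprn_gt0 ?sqrtr_gt0//.
by rewrite ler_pXn2r ?nnegrE ?sqrtr_ge0// ler_sqrt ?(ltW Q0).
Qed.

End Sign.

End Regularisations.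

(** * Limits as the regularisation parameter tends to 0 *)

Section Limits.
Variable e_ : nat -> R.
Hypotheses (e_gt0 : forall n, 0 < e_ n) (e_cvg0 : e_ n @[n --> \oo] --> (0 : R)).

Lemma hh_cvg1 (s_ : nat -> R) s : 0 < s -> s_ n @[n --> \oo] --> s ->
  hh (e_ n) (s_ n) @[n --> \oo] --> (1 : R).
Proof.
move=> s0 ss; have ps := cvg_pos ss; rewrite pos_id ?(ltW s0)// in ps.
have h : pos (s_ n) ^+ 2 / (pos (s_ n) ^+ 2 + e_ n ^+ 2) @[n --> \oo] -->
    s ^+ 2 / (s ^+ 2 + 0 ^+ 2).
  apply: cvgM; first exact: cvg_exprn.
  apply: cvg_inv; first by rewrite expr0n addr0 expf_neq0// gt_eqF.
  by apply: cvgD; apply: cvg_exprn.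
by rewrite expr0n addr0 divff ?expf_neq0 ?gt_eqF// in h.
Qed.

Lemma mm_cvg (s_ : nat -> R) s : s_ n @[n --> \oo] --> s ->
  mm (e_ n) (s_ n) @[n --> \oo] --> pos s.
Proof.
move=> ss; have ps := cvg_pos ss.
have e2 : pos (s_ n) - 2 * e_ n @[n --> \oo] --> pos s.
  rewrite -[X in _ --> X]subr0; apply: cvgB => //.
  by rewrite -(mulr0 2); apply: cvgM => //; exact: cvg_cst.
apply: (squeeze_cvgr _ e2 ps); apply: nearW => n; apply/andP; split.
  by have := mm_close (e_gt0 n) (s_ n); lra.
exact: mm_le.
Qed.

Lemma rr_cvg s : rr (e_ n) s @[n --> \oo] --> pos s ^+ 2.
Proof.
have u : pos (s + e_ n) ^+ 2 @[n --> \oo] --> pos s ^+ 2.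
  apply: cvg_exprn; apply: cvg_pos; rewrite -[X in _ --> X]addr0.
  by apply: cvgD => //; exact: cvg_cst.
apply: (squeeze_cvgr _ (cvg_cst (pos s ^+ 2)) u); apply: nearW => n.
by rewrite rr_ge ?rr_le.
Qed.

Lemma drr_cvg s : drr (e_ n) s @[n --> \oo] --> 2 * pos s.
Proof.
have u : 2 * pos (s + e_ n) @[n --> \oo] --> 2 * pos s.
  apply: cvgM; first exact: cvg_cst.
  apply: cvg_pos; rewrite -[X in _ --> X]addr0.
  by apply: cvgD => //; exact: cvg_cst.
apply: (squeeze_cvgr _ (cvg_cst (2 * pos s)) u); apply: nearW => n.
by rewrite drr_ge ?drr_le.
Qed.

Lemma sg_cvg s : sg (e_ n) s @[n --> \oo] --> Num.sg s.
Proof.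
have [->|s0] := eqVneq s 0.
  by rewrite sgr0 /sg; under eq_fun do rewrite mul0r; exact: cvg_cst.
have -> : Num.sg s = s / Num.sqrt (s ^+ 2 + 0 * (1 - s ^+ 2)).
  by rewrite mul0r addr0 sqrtr_sqr {2}(numEsg s) mulfK ?normr_eq0.
apply: cvgM; first exact: cvg_cst.
apply: cvg_inv; first by rewrite mul0r addr0 sqrtr_sqr normr_eq0.
apply: cvg_sqrt; apply: cvgD; first exact: cvg_cst.
by apply: cvgM => //; exact: cvg_cst.
Qed.

End Limits.

(* A C^1 cutoff, equal to 1 on [0, 1] and to 0 on [2, +oo[. *)
Definition cutoff (t : R) : R := pos (1 - pos (t - 1) ^+ 2) ^+ 2.
Definition dcutoff (t : R) : R := - (4 * pos (1 - pos (t - 1) ^+ 2) * pos (t - 1)).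

Lemma is_derive_cutoff t : is_derive t 1 cutoff (dcutoff t).
Proof.
have d2 s : is_derive s 1 (fun s => pos s ^+ 2) (2 * pos s).
  apply: (is_derive_pos (f := fun t => t ^+ 2) (df := fun t => 2 * t)).
    by move=> x _; apply: is_derive_eq; rewrite /GRing.scale /=; ring.
  by rewrite mulr0.
have d3 : is_derive t 1 (fun t => pos (t - 1) ^+ 2) (2 * pos (t - 1) * 1).
  apply: (is_derive1_compE (f := fun s => pos s ^+ 2) (g := fun s => s - 1)).
  by apply: is_derive_eq; rewrite subr0.
have d4 : is_derive t 1 cutoff (2 * pos (1 - pos (t - 1) ^+ 2) * (0 - 2 * pos (t - 1) * 1)).
  exact: (is_derive1_compE (f := fun s => pos s ^+ 2) (g := fun t => 1 - pos (t - 1) ^+ 2)).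
by apply: is_derive_eq; rewrite /dcutoff; ring.
Qed.

Lemma continuous_dcutoff : continuous dcutoff.
Proof.
move=> t; rewrite /dcutoff; apply: cvgN; apply: cvgM; last first.
  by apply: cvg_pos; apply: cvgB; [exact: cvg_id|exact: cvg_cst].
apply: cvgM; first exact: cvg_cst.
apply: cvg_pos; apply: cvgB; first exact: cvg_cst.
by apply: cvg_exprn; apply: cvg_pos; apply: cvgB; [exact: cvg_id|exact: cvg_cst].
Qed.

Lemma cutoff_ge0 t : 0 <= cutoff t. Proof. exact: sqr_ge0. Qed.

Lemma cutoff_le1 t : cutoff t <= 1.
Proof.
rewrite /cutoff -[leRHS](expr1n _ 2) ler_pXn2r ?nnegrE ?pos_ge0//.
by rewrite /pos ge_max ler01 andbT gerBl sqr_ge0.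
Qed.

Lemma cutoff1 t : t <= 1 -> cutoff t = 1 /\ dcutoff t = 0.
Proof.
move=> t1; rewrite /cutoff /dcutoff (@pos0E (t - 1)) ?subr_le0// expr0n /= subr0 mulr0 oppr0.
by rewrite pos_id// expr1n.
Qed.

Lemma cutoff0 t : 2 <= t -> cutoff t = 0 /\ dcutoff t = 0.
Proof.
move=> t2; have h : pos (1 - pos (t - 1) ^+ 2) = 0.
  rewrite pos0E// subr_le0 expr_ge1// (le_trans _ (pos_ge _))//; lra.
by rewrite /cutoff /dcutoff h expr0n /= mulr0 mul0r oppr0.
Qed.

Lemma dcutoff_bnd t : - 4 <= dcutoff t <= 0.
Proof.
have p1 := pos_ge0 (t - 1); have p2 := pos_ge0 (1 - pos (t - 1) ^+ 2).
rewrite /dcutoff oppr_le0 mulr_ge0 ?mulr_ge0// andbT lerN2.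
have [t2|t2] := leP 2 t.
  by have [_] := cutoff0 t2; rewrite /dcutoff => /eqP; rewrite oppr_eq0 => /eqP ->.
have h1 : pos (t - 1) <= 1 by rewrite /pos ge_max ler01 andbT; lra.
have h2 : pos (1 - pos (t - 1) ^+ 2) <= 1 by rewrite /pos ge_max ler01 andbT gerBl sqr_ge0.
rewrite -mulrA ler_piMr// -[leRHS]mulr1 ler_pM//.
Qed.

End OneVariable.

(** * The profile in terms of the angle *)

Section Angle.
Context {R : realType}.
Variable lam : R.
Hypothesis lam1 : 1 < lam.
Implicit Types (a b t tau : R).

Definition ww : R := Num.sqrt (lam ^+ 2 - 1).
(** This is sqrt ((lam + 1) / (lam - 1)), the factor of tan (a / 2) in the classical primitive of 1
    / (lam - cos a). *)
Definition kap : R := ww / (lam - 1).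

Lemma ww_gt0 : 0 < ww.
Proof. by rewrite sqrtr_gt0 subr_gt0 expr_gt1// ltW// (lt_trans _ lam1). Qed.

Lemma ww2 : ww ^+ 2 = lam ^+ 2 - 1.
Proof. by rewrite sqr_sqrtr// subr_ge0 expr_ge1 ?(ltW lam1)// ltW// (lt_trans _ lam1). Qed.

Lemma lamB_gt0 a : 0 < lam - cos a.
Proof. by rewrite subr_gt0 (le_lt_trans (cos_le1 _)). Qed.

Definition inI a := - (pi / 2) <= a <= pi / 2 :> bool.

Lemma pih_gt0 : 0 < pi / 2 :> R.
Proof. by have := @pihalf_ge1 R; lra. Qed.

Lemma inI_cos a : inI a -> 0 <= cos a.
Proof. exact: cos_ge0_pihalf. Qed.

Lemma inIN a : inI (- a) = inI a.
Proof. by rewrite /inI lerN2 lerNl andbC. Qed.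

Lemma inIpih : inI (pi / 2).
Proof. by rewrite /inI lexx andbT; have := pih_gt0; lra. Qed.

Lemma inI0 : inI 0.
Proof. by rewrite /inI; have := pih_gt0; lra. Qed.

(* The profile function is explicit in terms of the angle a of the normal:
   ff lam (lam - cos a)^-1 is a constant minus YY a, and YY' = cos / (lam - cos)^2. *)
Definition YY a : R :=
  (2 * atan (kap * (sin a / (1 + cos a))) + lam * ww * (sin a / (lam - cos a))) / ww ^+ 3.

Lemma YY0 : YY 0 = 0.
Proof. by rewrite /YY sin0 !mul0r !mulr0 atan0 mulr0 addr0 mul0r. Qed.

Lemma YYN a : YY (- a) = - YY a.
Proof. by rewrite /YY sinN cosN !mulNr !mulrN atanN mulrN -opprD mulNr. Qed.

(** sin a / (1 + cos a) is tan (a / 2); the left-hand side is the denominator in the derivative of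
    the arctangent of [YY]. *)
Lemma kap_sqr a : 0 <= cos a ->
  1 + (kap * (sin a / (1 + cos a))) ^+ 2 =
  2 * (lam - cos a) / ((lam - 1) * (1 + cos a)).
Proof.
move=> c0; have := sin2cos2 a; move: (sin a) (cos a) c0 => s c c0 s2.
have c1 : 1 + c != 0 by rewrite gt_eqF// ltr_wpDr.
have l1 : lam - 1 != 0 by rewrite gt_eqF// subr_gt0.
rewrite /kap !exprMn s2 ww2 !exprVn.
by field; rewrite c1.
Qed.

(** Before division by ww^3 the two terms contribute ww / (lam - cos a) and lam ww (lam cos a - 1) /
    (lam - cos a)^2, whose sum is ww^3 cos a / (lam - cos a)^2. *)
Lemma is_derive_YY a : 0 <= cos a ->
  is_derive a 1 YY (cos a / (lam - cos a) ^+ 2).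
Proof.
move=> c0.
have c1 : 1 + cos a != 0 by rewrite gt_eqF// ltr_wpDr.
have l1 : lam - 1 != 0 by rewrite gt_eqF// subr_gt0.
have lc : lam - cos a != 0 by rewrite gt_eqF// lamB_gt0.
have w0 : ww != 0 by rewrite gt_eqF// ww_gt0.
have du : is_derive a 1 (fun a => kap * (sin a / (1 + cos a))) (kap / (1 + cos a)).
  apply: is_derive_eq; rewrite /GRing.scale /=.
  have := sin2cos2 a; move: (sin a) (cos a) c1 => s c c1 s2.
  apply/eqP; rewrite -subr_eq0; apply/eqP.
  (* [field] is unaware of s^2 = 1 - c^2, so the difference of the two sides is exhibited as a
     multiple of s^2 - (1 - c^2). *)
  transitivity (kap * (s ^+ 2 - (1 - c ^+ 2)) / (1 + c) ^+ 2); last by rewrite s2 subrr mulr0 mul0r.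
  by field.
have da : is_derive a 1 (fun a => atan (kap * (sin a / (1 + cos a))))
   ((lam - 1) * kap / (2 * (lam - cos a))).
  have h : is_derive a 1 (fun a => atan (kap * (sin a / (1 + cos a))))
     ((1 + (kap * (sin a / (1 + cos a))) ^+ 2)^-1 * (kap / (1 + cos a))).
    exact: is_derive1_compE.
  apply: is_derive_eq; rewrite kap_sqr//; field.
  by rewrite c1 l1 lc.
have dv : is_derive a 1 (fun a => sin a / (lam - cos a))
    ((lam * cos a - 1) / (lam - cos a) ^+ 2).
  apply: is_derive_eq; rewrite /GRing.scale /=.
  have := sin2cos2 a; move: (sin a) (cos a) lc => s c lc s2.
  apply/eqP; rewrite -subr_eq0; apply/eqP.
  transitivity (- (s ^+ 2 - (1 - c ^+ 2)) / (lam - c) ^+ 2); last by rewrite s2 subrr oppr0 mul0r.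
  by field.
rewrite /YY; apply: is_derive_eq; rewrite /GRing.scale /=.
rewrite /kap; move: (cos a) lc => c lc.
apply/eqP; rewrite -subr_eq0; apply/eqP.
transitivity (c * (lam ^+ 2 - 1 - ww ^+ 2) / (ww ^+ 2 * (lam - c) ^+ 2)).
  by field; rewrite w0 l1 lc.
by rewrite ww2 subrr mulr0 mul0r.
Qed.

(** The derivative vanishes at the ends - pi / 2 and pi / 2; strictness survives because the mean
    value is attained at an interior point. *)
Lemma ltr_YY a b : inI a -> inI b -> a < b -> YY a < YY b.
Proof.
move=> /andP[a1 a2] /andP[b1 b2] ab.
have d (x : R) : a <= x <= b -> is_derive x 1 YY (cos x / (lam - cos x) ^+ 2).
  move=> /andP[ax xb]; apply: is_derive_YY; apply: inI_cos.
  by rewrite /inI (le_trans a1 ax) (le_trans xb b2).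
have [||c + e] := @MVT R YY (fun x => cos x / (lam - cos x) ^+ 2) a b ab.
- by move=> x; rewrite in_itv /= => /andP[/ltW ax /ltW xb]; apply: d; rewrite ax.
- by apply: derivable_within_continuous => x; rewrite in_itv /= => h; have := d x h => ?; exact: ex_derive.
rewrite in_itv /= => /andP[ac cb].
rewrite -subr_gt0 e mulr_gt0 ?subr_gt0// divr_gt0 ?exprn_gt0 ?lamB_gt0//.
by rewrite cos_gt0_pihalf// (le_lt_trans a1 ac) (lt_le_trans cb b2).
Qed.

Lemma ler_YY a b : inI a -> inI b -> a <= b -> YY a <= YY b.
Proof.
by move=> ia ib; rewrite le_eqVlt => /predU1P[->//|ab]; rewrite ltW// ltr_YY.
Qed.

Lemma YY_ge0 a : inI a -> 0 <= a -> 0 <= YY a.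
Proof. by move=> ia a0; rewrite -[leLHS]YY0; exact: ler_YY inI0 ia a0. Qed.

Definition Ym : R := YY (pi / 2).

Lemma Ym_gt0 : 0 < Ym.
Proof. by rewrite -[ltLHS]YY0; apply: ltr_YY; [exact: inI0|exact: inIpih|exact: pih_gt0]. Qed.

(** Equal to - [KK lam], by [KKE]. *)
Definition kk : R := Ym^-1.

Lemma kk_gt0 : 0 < kk. Proof. by rewrite invr_gt0 Ym_gt0. Qed.

(* TT a is the value of y / - z on the ray along which the level lines of L have normal
   (- sin a, cos a); DD is its derivative. *)
Definition TT a : R := YY a * (lam - cos a).
Definition DD a : R := cos a / (lam - cos a) + YY a * sin a.

Lemma TTN a : TT (- a) = - TT a. Proof. by rewrite /TT YYN cosN mulNr. Qed.
Lemma DDN a : DD (- a) = DD a. Proof. by rewrite /DD YYN cosN sinN mulrNN. Qed.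

Lemma is_derive_TT a : 0 <= cos a -> is_derive a 1 TT (DD a).
Proof.
move=> c0; have dY := is_derive_YY c0.
have lc : lam - cos a != 0 by rewrite gt_eqF// lamB_gt0.
rewrite /TT; apply: is_derive_eq; rewrite /GRing.scale /= /DD; field.
by rewrite lc.
Qed.

Definition ddD a : R := YY a * cos a - sin a / (lam - cos a).

Lemma is_derive_DD a : 0 <= cos a -> is_derive a 1 DD (ddD a).
Proof.
move=> c0; have dY := is_derive_YY c0.
have lc : lam - cos a != 0 by rewrite gt_eqF// lamB_gt0.
rewrite /DD; apply: is_derive_eq; rewrite /GRing.scale /= /ddD; field.
by rewrite lc.
Qed.

Lemma YYsin_ge0 a : inI a -> 0 <= YY a * sin a.
Proof.
wlog a0 : a / 0 <= a.
  move=> W ia; have [/W/(_ ia)//|a0] := leP 0 a.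
  by have := W (- a); rewrite YYN sinN mulrNN inIN; apply => //; rewrite oppr_ge0 ltW.
move=> ia; rewrite mulr_ge0 ?YY_ge0// sin_ge0_pi// a0 /=.
by move/andP: ia => [_ ia]; rewrite (le_trans ia)//; have := pih_gt0; lra.
Qed.

(** Drop the nonnegative term YY a sin a and use lam / (lam - cos a) >= 1. *)
Lemma DD_ge_cos a : inI a -> cos a <= lam * DD a.
Proof.
move=> ia; have c0 := inI_cos ia; have lc := lamB_gt0 a.
have l0 : 0 < lam by rewrite (lt_trans _ lam1).
rewrite /DD mulrDr -[leLHS]addr0 lerD//; last by rewrite mulr_ge0 ?YYsin_ge0// ltW.
by rewrite mulrCA ler_peMr// ler_pdivlMr// mul1r gerBl.
Qed.

(* The convexity of the profile: its tangent lines stay below its endpoint. *)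
Lemma DD_ge_sin a : inI a -> `|sin a| <= kk * DD a.
Proof.
wlog a0 : a / 0 <= a.
  move=> W ia; have [/W/(_ ia)//|a0] := leP 0 a.
  by have := W (- a); rewrite DDN sinN normrN inIN; apply => //; rewrite oppr_ge0 ltW.
move=> ia; have /andP[_ a1] := ia.
have sin0p (x : R) : 0 <= x <= pi / 2 -> 0 <= sin x.
  by move=> /andP[x0 x1]; rewrite sin_ge0_pi// x0 (le_trans x1)//; have := pih_gt0; lra.
rewrite ger0_norm; last by rewrite sin0p// a0.
rewrite mulrC ler_pdivlMr ?Ym_gt0// -subr_ge0.
(* [rho] is [DD] minus [Ym] sin. It vanishes at pi / 2 and is nonincreasing up to there, since [YY]
   stays below its endpoint value [Ym]; hence it is nonnegative at [a]. *)
pose rho x := cos x / (lam - cos x) + YY x * sin x - sin x * Ym.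
have dI (x : R) : a <= x <= pi / 2 -> inI x.
  by move=> /andP[ax xp]; rewrite /inI xp andbT (le_trans _ ax)//; have := pih_gt0; lra.
have h : - rho a <= - rho (pi / 2).
  apply: (le_is_derive (f := fun x => - rho x)
    (df := fun x => sin x / (lam - cos x) + cos x * (Ym - YY x))) => // x xa.
    have c0 := inI_cos (dI x xa); have dY := is_derive_YY c0.
    have lc : lam - cos x != 0 by rewrite gt_eqF// lamB_gt0.
    by rewrite /rho; apply: is_derive_eq; rewrite /GRing.scale /=; field; rewrite lc.
  have /andP[ax xp] := xa.
  rewrite addr_ge0// ?divr_ge0 ?sin0p ?xp ?(le_trans a0 ax)// ?(ltW (lamB_gt0 x))//.
  rewrite mulr_ge0 ?inI_cos ?dI// subr_ge0; apply: ler_YY => //; first exact: dI.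
  exact: inIpih.
move: h; rewrite lerN2 {1}/rho cos_pihalf sin_pihalf mul0r mulr1 mul1r add0r subrr.
by rewrite /DD.
Qed.

(** The squares of the bounds by |sin a| and by cos a add up to 1. Since |grad L| = 1 / (k D), this
    reads |grad L|^2 <= 1 + (lam / k)^2, the expression in the denominator of theta. *)
Lemma DD_bound a : inI a -> 1 <= DD a ^+ 2 * (kk ^+ 2 + lam ^+ 2).
Proof.
move=> ia; rewrite -(cos2Dsin2 a) addrC mulrDr -!exprMn; apply: lerD.
  rewrite -real_normK ?num_real// mulrC ler_pXn2r ?nnegrE ?DD_ge_sin//.
  by apply: le_trans (DD_ge_sin ia).
rewrite mulrC ler_pXn2r ?nnegrE ?inI_cos ?DD_ge_cos//.
by apply: le_trans (DD_ge_cos ia); exact: inI_cos.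
Qed.

Definition dmin : R := (Num.sqrt (kk ^+ 2 + lam ^+ 2))^-1.

Lemma dmin_gt0 : 0 < dmin.
Proof. by rewrite invr_gt0 sqrtr_gt0 ltr_pwDl ?exprn_gt0 ?kk_gt0 ?sqr_ge0. Qed.

Lemma DD_ge a : inI a -> dmin <= DD a.
Proof.
move=> ia; have D0 : 0 <= DD a.
  have := DD_ge_cos ia; have := inI_cos ia => c0 /(le_trans c0).
  by rewrite pmulr_rge0// (lt_trans _ lam1).
have s0 : 0 < kk ^+ 2 + lam ^+ 2 by rewrite ltr_pwDl ?exprn_gt0 ?kk_gt0 ?sqr_ge0.
rewrite /dmin -[leLHS]mul1r ler_pdivrMr ?sqrtr_gt0//.
rewrite -(@ler_pXn2r _ 2)// ?nnegrE ?mulr_ge0 ?sqrtr_ge0//.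
by rewrite expr1n exprMn sqr_sqrtr ?(ltW s0)// DD_bound.
Qed.

Lemma DD_gt0 a : inI a -> 0 < DD a.
Proof. by move=> ia; exact: lt_le_trans dmin_gt0 (DD_ge ia). Qed.

(** The slope of [TT] is at least [dmin] up to the ends of the interval, although cos vanishes
    there; this makes the inverse of [TT] Lipschitz. *)
Lemma TT_incr a b : inI a -> inI b -> a <= b -> dmin * (b - a) <= TT b - TT a.
Proof.
move=> /andP[a1 a2] /andP[b1 b2] ab.
have xI (x : R) : a <= x <= b -> inI x.
  by move=> /andP[ax xb]; rewrite /inI (le_trans a1 ax) (le_trans xb b2).
have [c cab ->] := MVT_is_derive ab (fun x h => is_derive_TT (inI_cos (xI x h))).
by rewrite ler_wpM2r ?subr_ge0// DD_ge// xI.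
Qed.

Lemma TT_inj a b : inI a -> inI b -> TT a = TT b -> a = b.
Proof.
wlog ab : a b / a <= b.
  move=> W ia ib e; have [ab|/ltW ab] := leP a b; first exact: W.
  by apply/esym; exact: W.
move=> ia ib e; apply/eqP; rewrite eq_le ab /= -subr_le0 -(pmulr_rle0 _ dmin_gt0).
by have := TT_incr ia ib ab; rewrite e subrr.
Qed.

(** The slope of the cone, which is the set where |y| < - z [T1]. *)
Definition T1 : R := lam / kk.

Lemma TTpih : TT (pi / 2) = T1.
Proof. by rewrite /TT cos_pihalf subr0 /T1 /kk invrK mulrC. Qed.

Lemma T1_gt0 : 0 < T1.
Proof. by rewrite divr_gt0 ?kk_gt0// (lt_trans _ lam1). Qed.

Definition clip tau : R := Num.max (- T1) (Num.min T1 tau).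

Lemma clip_bnd tau : - T1 <= clip tau <= T1.
Proof.
rewrite /clip le_max lexx /= ge_max ge_min lexx /= andbT.
by have := T1_gt0; lra.
Qed.

Lemma clip_id tau : `|tau| <= T1 -> clip tau = tau.
Proof.
rewrite ler_norml => /andP[h1 h2].
by rewrite /clip (min_idPr h2) (max_idPr h1).
Qed.

Lemma clip_ge tau : T1 <= tau -> clip tau = T1.
Proof.
by move=> h; rewrite /clip (min_idPl h); apply/max_idPr; have := T1_gt0; lra.
Qed.

Lemma clip_le tau : tau <= - T1 -> clip tau = - T1.
Proof.
move=> h; rewrite /clip; apply/max_idPl; rewrite ge_min h orbT //.
Qed.

Lemma clip_lip tau t : `|clip tau - clip t| <= `|tau - t|.
Proof.
wlog h : tau t / t <= tau.
  move=> W; have [/W//|/ltW/W] := leP t tau.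
  by rewrite distrC [leRHS]distrC.
rewrite [leRHS]ger0_norm ?subr_ge0//.
have T0 := T1_gt0; rewrite ler_norml.
have clipE s : [\/ T1 <= s /\ clip s = T1, s <= - T1 /\ clip s = - T1 |
    - T1 <= s <= T1 /\ clip s = s].
  have [h1|/ltW h1] := leP T1 s; first by constructor 1; rewrite clip_ge.
  have [h2|/ltW h2] := leP s (- T1); first by constructor 2; rewrite clip_le.
  by constructor 3; rewrite h1 h2 clip_id// ler_norml h1 h2.
by move: (clipE tau) (clipE t) => [] [? ->] [] [? ->]; apply/andP; split; lra.
Qed.

(** The inverse of [TT] on [- T1, T1], continued by - pi / 2 and pi / 2: the angle becomes a
    Lipschitz function on the whole half-plane z < 0, not on the cone alone. *)
Definition AA tau : R := get [set a | inI a /\ TT a = clip tau].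

Lemma AA_spec tau : inI (AA tau) /\ TT (AA tau) = clip tau.
Proof.
apply: (@getPex _ [set a | inI a /\ TT a = clip tau]).
have p0 := pih_gt0.
have ab : - (pi / 2) <= pi / 2 :> R by lra.
have cT : {within `[- (pi / 2), pi / 2], continuous TT}.
  apply: derivable_within_continuous => x; rewrite in_itv /= => h.
  by have := is_derive_TT (inI_cos h) => ?; exact: ex_derive.
have bT : Num.min (TT (- (pi / 2))) (TT (pi / 2)) <= clip tau <= Num.max (TT (- (pi / 2))) (TT (pi / 2)).
  have t0 := T1_gt0; have le : - T1 <= T1 by lra.
  by rewrite TTN TTpih (min_idPl le) (max_idPr le) clip_bnd.
have [c] := IVT ab cT bT.
by rewrite in_itv /= => h1 h2; exists c.
Qed.

Lemma AA_inI tau : inI (AA tau). Proof. by have [] := AA_spec tau. Qed.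
Lemma TT_AA tau : TT (AA tau) = clip tau. Proof. by have [] := AA_spec tau. Qed.

Lemma AA_unique tau a : inI a -> TT a = clip tau -> AA tau = a.
Proof. by move=> ia e; apply: TT_inj => //; [exact: AA_inI|rewrite TT_AA]. Qed.

Lemma AA_TT a : inI a -> AA (TT a) = a.
Proof.
move=> ia; apply: AA_unique => //; rewrite clip_id// ler_norml.
have /andP[a1 a2] := ia.
have := TT_incr _ ia a1; have := TT_incr ia inIpih a2; rewrite TTN TTpih inIN => h1 /(_ inIpih) h2.
have d0 := dmin_gt0.
have k1 : 0 <= dmin * (pi / 2 - a) by rewrite mulr_ge0 ?subr_ge0// ltW.
have k2 : 0 <= dmin * (a - - (pi / 2)) by rewrite mulr_ge0 ?subr_ge0// ltW.
by apply/andP; split; lra.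
Qed.

Lemma AA_lip tau t : `|AA tau - AA t| <= `|tau - t| / dmin.
Proof.
rewrite ler_pdivlMr ?dmin_gt0//; apply: le_trans (clip_lip tau t).
rewrite -!TT_AA.
wlog h : tau t / AA t <= AA tau.
  move=> W; have [/W//|/ltW/W] := leP (AA t) (AA tau).
  by rewrite distrC [leRHS]distrC.
rewrite ger0_norm ?subr_ge0// mulrC (le_trans (TT_incr (AA_inI _) (AA_inI _) h))//.
exact: ler_norm.
Qed.

Lemma continuous_AA : continuous AA.
Proof.
move=> t; apply/cvgrPdist_le => e e0.
have d0 : 0 < e * dmin by rewrite mulr_gt0 ?dmin_gt0.
by near=> s; rewrite (le_trans (AA_lip _ _))// ler_pdivrMr ?dmin_gt0.
Unshelve. all: by end_near. Qed.

Lemma AA_ge tau : T1 <= tau -> AA tau = pi / 2.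
Proof. by move=> h; apply: AA_unique; [exact: inIpih|rewrite TTpih clip_ge]. Qed.

Lemma AA_le tau : tau <= - T1 -> AA tau = - (pi / 2).
Proof.
by move=> h; apply: AA_unique; [rewrite inIN; exact: inIpih|rewrite TTN TTpih clip_le].
Qed.

Lemma AA_oo tau : `|tau| < T1 -> - (pi / 2) < AA tau < pi / 2.
Proof.
move=> h; have /andP[h1 h2] := AA_inI tau; have e := TT_AA tau.
rewrite (clip_id (ltW h)) in e.
rewrite !lt_neqAle h1 h2 !andbT.
have T0 : `|T1| = T1 by rewrite ger0_norm// ltW// T1_gt0.
apply/andP; split; apply/eqP => ee; move: h; rewrite -e.
  by rewrite -ee TTN TTpih normrN T0 ltxx.
by rewrite ee TTpih T0 ltxx.
Qed.

Lemma cosAA_oo tau : `|tau| < T1 -> 0 < cos (AA tau).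
Proof. by move=> h; apply: cos_gt0_pihalf; exact: AA_oo. Qed.

Lemma cosAA0 tau : T1 <= `|tau| -> cos (AA tau) = 0.
Proof.
rewrite ler_normr => /orP[h|]; first by rewrite AA_ge// cos_pihalf.
by rewrite lerNr => h; rewrite AA_le// cosN cos_pihalf.
Qed.

Lemma is_derive_AA tau : `|tau| < T1 -> is_derive tau 1 AA (DD (AA tau))^-1.
Proof.
move=> h; have e : TT (AA tau) = tau by rewrite TT_AA clip_id// ltW.
have /andP[h1 h2] := AA_oo h.
have dT := is_derive_TT (inI_cos (AA_inI tau)).
have nI : \forall a \near AA tau, inI a.
  by near=> a; apply/andP; split; apply: ltW; near: a; [exact: lt_nbhsr|exact: lt_nbhsl].
have nT : \forall a \near AA tau, {for a, continuous TT}.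
  by apply: filterS nI => a ia; exact: (is_derive_continuous (is_derive_TT (inI_cos ia))).
have nA : \forall a \near AA tau, AA (TT a) = a by apply: filterS nI; exact: AA_TT.
have D0 : DD (AA tau) != 0 by rewrite gt_eqF// DD_gt0// AA_inI.
by have := is_derive_inverse nA nT dT D0; rewrite e.
Unshelve. all: by end_near. Qed.

Lemma AAN tau : AA (- tau) = - AA tau.
Proof.
apply: AA_unique; first by rewrite inIN; exact: AA_inI.
rewrite TTN TT_AA; have [h|h] := leP `|tau| T1; first by rewrite !clip_id ?normrN.
move: h; rewrite ltr_normr => /orP[/ltW h|/ltW h].
  by rewrite (clip_ge h) clip_le// lerN2.
by rewrite (clip_ge h) clip_le ?opprK// -lerN2 opprK.
Qed.

Lemma TT0 : TT 0 = 0. Proof. by rewrite /TT YY0 mul0r. Qed.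

Lemma AA_gt0 tau : 0 < tau -> 0 < AA tau.
Proof.
move=> t0; rewrite ltNge; apply/negP => a0.
have := TT_incr (AA_inI tau) inI0 a0; rewrite TT0 TT_AA sub0r => h.
have c0 : 0 < clip tau.
  have [h1|h1] := leP T1 tau; first by rewrite clip_ge// T1_gt0.
  by rewrite clip_id// gtr0_norm// ltW.
have : 0 <= dmin * (0 - AA tau) by rewrite mulr_ge0 ?(ltW dmin_gt0)// subr_ge0.
by lra.
Qed.

Lemma sinAA_gt0 tau : 0 < tau -> 0 < sin (AA tau).
Proof.
move=> t0; rewrite sin_gt0_pi// AA_gt0//=; have /andP[_ h] := AA_inI tau.
by have := pih_gt0; lra.
Qed.

Lemma sgr_sinAA tau : Num.sg (sin (AA tau)) = Num.sg tau.
Proof.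
have [t0|t0|<-] := ltgtP 0 tau.
- by rewrite !gtr0_sg// sinAA_gt0.
- have n0 : 0 < - tau by rewrite oppr_gt0.
  have := sinAA_gt0 n0; rewrite AAN sinN oppr_gt0 => h.
  by rewrite !ltr0_sg.
- by rewrite (AA_unique (a := 0)) ?inI0 ?sin0// TT0 clip_id// normr0 ltW// T1_gt0.
Qed.

(** The difference quotient is at most C |t - x|. Meant for the edge of the cone, where [AA] has a
    corner. *)
Lemma is_derive_quadratic (f : R -> R) x C :
  (forall t, `|f t - f x| <= C * (t - x) ^+ 2) -> is_derive x 1 f 0.
Proof.
move=> fC.
have C0 : 0 <= C.
  have := fC (x + 1); rewrite [x + 1]addrC addrK expr1n mulr1; exact: le_trans.
apply/is_derive1_caratheodory.
pose g t := (f t - f x) / (t - x).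
have g0 : g x = 0 by rewrite /g subrr mul0r.
have gC t : `|g t| <= C * `|t - x|.
  have [->|tx] := eqVneq t x; first by rewrite g0 subrr !normr0 mulr0.
  have tx0 : 0 < `|t - x| by rewrite normr_gt0 subr_eq0.
  rewrite /g normrM normfV ler_pdivrMr// -mulrA -expr2 real_normK ?num_real//.
exists g; split => //.
- move=> t; have [->|tx] := eqVneq t x; first by rewrite !subrr mulr0.
  by rewrite /g divfK// subr_eq0.
- rewrite /prop_for /continuous_at g0; apply/cvgr0Pnorm_le => e e0.
  have e1 : 0 < e / (C + 1) by rewrite divr_gt0// ltr_wpDl.
  near=> t; apply: le_trans (gC t) _.
  have : `|x - t| <= e / (C + 1) by [].
  rewrite distrC ler_pdivlMr ?ltr_wpDl// => h; apply: le_trans h.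
  by rewrite mulrC ler_wpM2l// lerDl.
Unshelve. all: by end_near. Qed.

Lemma cos_lip a b : `|cos a - cos b| <= `|a - b|.
Proof.
wlog ab : a b / b <= a.
  move=> W; have [/W//|/ltW/W] := leP b a.
  by rewrite distrC [leRHS]distrC.
have [c _ ->] := MVT_is_derive ab (fun x _ => is_derive_cos x).
by rewrite normrM normrN ler_piMl// ler_norml sin_geN1 sin_le1.
Qed.

(** Mean value theorem with |cos c| <= |cos b| + |a - b|; the bound is quadratic where cos b = 0. *)
Lemma sin_quad a b : `|sin a - sin b| <= (`|cos b| + `|a - b|) * `|a - b|.
Proof.
have key (u v w : R) : u <= v -> (w == u) || (w == v) ->
    `|sin v - sin u| <= (`|cos w| + `|v - u|) * `|v - u|.
  move=> uv hw; have [c /andP[c1 c2] ->] := MVT_is_derive uv (fun x _ => is_derive_sin x).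
  rewrite normrM ler_wpM2r// -(subrK (cos w) (cos c)) (le_trans (ler_normD _ _))//.
  rewrite addrC lerD2l (le_trans (cos_lip _ _))// [leRHS]ger0_norm ?subr_ge0//.
  by case/orP: hw => /eqP ->; rewrite ler_norml; apply/andP; split; lra.
have [ab|/ltW ab] := leP a b.
  by rewrite distrC (distrC a b); apply: key => //; rewrite eqxx orbT.
by apply: key => //; rewrite eqxx.
Qed.

(** At the corners of [AA] the angle is - pi / 2 or pi / 2, where the sine is flat: the composite is
    differentiable on the whole line. Hence the regularised sign needs no separate treatment at the
    edge of the cone. *)
Lemma is_derive_sinAA tau :
  is_derive tau 1 (fun t => sin (AA t)) (cos (AA tau) / DD (AA tau)).
Proof.
have [h|h] := ltP `|tau| T1.
  by have := is_derive_AA h => ?; exact: is_derive1_compE.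
rewrite cosAA0// mul0r; apply: (@is_derive_quadratic _ _ (dmin^-1 ^+ 2)) => t.
apply: le_trans (sin_quad _ _) _; rewrite cosAA0// normr0 add0r -expr2.
rewrite -[X in _ <= _ * X]real_normK ?num_real// -exprMn mulrC.
by rewrite ler_pXn2r ?nnegrE ?mulr_ge0 ?invr_ge0 ?(ltW dmin_gt0)// AA_lip.
Qed.

(* L (y, z) = - z * ell (y / - z) in the cone; outside, where LL is junk, this continues L
   by |y|. *)
Definition ell tau : R := (lam - cos (AA tau)) / kk + pos (`|tau| - T1).

Lemma kk_neq0 : kk != 0. Proof. by rewrite gt_eqF// kk_gt0. Qed.

Lemma ell_out tau : T1 <= `|tau| -> ell tau = `|tau|.
Proof.
move=> h; rewrite /ell cosAA0// subr0 -/T1 pos_id ?subr_ge0//.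
by rewrite addrC subrK.
Qed.

Lemma ell_in tau : `|tau| <= T1 -> ell tau = (lam - cos (AA tau)) / kk.
Proof. by move=> h; rewrite /ell pos0E ?addr0// subr_le0. Qed.

Lemma ell_gt0 tau : 0 < ell tau.
Proof. by rewrite /ell ltr_wpDr ?pos_ge0// divr_gt0 ?kk_gt0// lamB_gt0. Qed.

Lemma ell_le_T1 tau : `|tau| <= T1 -> ell tau <= T1.
Proof.
move=> h; rewrite ell_in//; apply: ler_wpM2r; first by rewrite invr_ge0 ltW// kk_gt0.
rewrite lerBlDr lerDl.
exact: inI_cos (AA_inI _).
Qed.

Lemma ell_ge tau : (lam - 1) / kk <= ell tau.
Proof.
rewrite /ell -[leLHS]addr0; apply: lerD; last exact: pos_ge0.
apply: ler_wpM2r; first by rewrite invr_ge0 ltW// kk_gt0.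
by apply: lerB => //; exact: cos_le1.
Qed.

Lemma continuous_ell : continuous ell.
Proof.
move=> t; rewrite /ell; apply: cvgD.
  apply: cvgM; last exact: cvg_cst.
  by apply: cvgB; [exact: cvg_cst|apply: cvg_cos; exact: continuous_AA].
by apply: cvg_pos; apply: cvgB; [apply: cvg_norm; exact: cvg_id|exact: cvg_cst].
Qed.

Lemma is_derive_ell tau : `|tau| < T1 ->
  is_derive tau 1 ell (sin (AA tau) / (kk * DD (AA tau))).
Proof.
move=> h; have dA := is_derive_AA h.
have D0 : DD (AA tau) != 0 by rewrite gt_eqF// DD_gt0// AA_inI.
have dc : is_derive tau 1 (fun t => cos (AA t)) (- sin (AA tau) * (DD (AA tau))^-1).
  exact: is_derive1_compE.
apply: (@near_eq_is_derive _ _ _ (fun t => (lam - cos (AA t)) / kk)).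
  near=> t; rewrite ell_in//; apply: ltW; near: t.
  have := @norm_continuous _ _ tau; move/cvgr_lt; exact.
apply: is_derive_eq; rewrite /GRing.scale /=; field.
by rewrite D0 kk_neq0.
Unshelve. all: by end_near. Qed.

End Angle.

(** * The level function and the cone field *)

Section ProfileAngle.
Context {R : realType}.
Variable lam : R.
Hypothesis lam1 : 1 < lam.
Implicit Types (a b t y : R).
Local Notation YY := (YY lam).
Local Notation Ym := (Ym lam).
Local Notation kk := (kk lam).
Local Notation ww := (ww lam).
Local Notation kap := (kap lam).
Local Notation TT := (TT lam).
Local Notation AA := (AA lam).
Local Notation T1 := (T1 lam).
Local Notation ell := (ell lam).
Let w0 := ww_gt0 lam1.
Let k0 := kk_gt0 lam1.
Let m0 := Ym_gt0 lam1.
Let lc a := lamB_gt0 lam1 a.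

Lemma powR_32 : (lam ^+ 2 - 1) `^ (3 / 2) = ww ^+ 3.
Proof.
have l0 : 0 <= lam ^+ 2 - 1 by rewrite -(ww2 lam1) sqr_ge0.
by rewrite mulrC powRrM powR12_sqrt// powR_mulrn ?sqrtr_ge0.
Qed.

(** For Z = 1 / (lam - cos a) the argument of the arcsine is (lam cos a - 1) / (lam - cos a) = cos
    (2 atan v), with v = kap tan (a / 2), so the arcsine is pi / 2 - 2 atan v; the square root is ww
    sin a / (lam - cos a). *)
Lemma ffE a : 0 <= a <= pi / 2 -> ff lam (lam - cos a)^-1 = pi / 2 / ww ^+ 3 - YY a.
Proof.
move=> /andP[a0 a1].
have c0 : 0 <= cos a.
  by apply: inI_cos; rewrite /inI a1 andbT (le_trans _ a0)//; have := @pih_gt0 R; lra.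
have s0 : 0 <= sin a.
  by rewrite sin_ge0_pi// a0 (le_trans a1)//; have := @pih_gt0 R; lra.
have c1 : 1 + cos a != 0 by rewrite gt_eqF// ltr_wpDr.
have l1 : lam - 1 != 0 by rewrite gt_eqF// subr_gt0.
have lca : lam - cos a != 0 by rewrite gt_eqF.
set v := kap * (sin a / (1 + cos a)).
have kap0 : 0 <= kap by rewrite divr_ge0 ?(ltW w0)// subr_ge0 ltW.
have v0 : 0 <= v by rewrite mulr_ge0// divr_ge0// addr_ge0.
have v1 : 1 + v ^+ 2 = 2 * (lam - cos a) / ((lam - 1) * (1 + cos a)) by exact: kap_sqr.
have sE : (lam ^+ 2 - 1) * (lam - cos a)^-1 - lam = (lam * cos a - 1) / (lam - cos a).
  by field.
have asE : asin ((lam * cos a - 1) / (lam - cos a)) = pi / 2 - 2 * atan v.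
  have -> : (lam * cos a - 1) / (lam - cos a) = sin (pi / 2 - 2 * atan v).
    rewrite -[pi / 2 - _]opprB sinN sinBpihalf opprK.
    rewrite (_ : 2 * atan v = atan v *+ 2); last by rewrite mulr_natl.
    rewrite cos_mulr2n cos_atan exprVn sqr_sqrtr; last by rewrite addr_ge0// sqr_ge0.
    by rewrite v1; field; rewrite c1 l1 lca.
  apply: sinK; rewrite in_itv /=.
  by have := atan_ltpi2 v; have := atan_ge0 v0; lra.
have sqE : Num.sqrt (1 - ((lam * cos a - 1) / (lam - cos a)) ^+ 2) =
    ww * (sin a / (lam - cos a)).
  rewrite (_ : 1 - _ = (ww * (sin a / (lam - cos a))) ^+ 2).
    by rewrite sqrtr_sqr ger0_norm// mulr_ge0 ?(ltW w0)// divr_ge0// ltW.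
  by rewrite !exprMn ww2// sin2cos2; field.
rewrite /ff powR_32 sE asE sqE /YY -/v; field.
by rewrite lca gt_eqF.
Qed.

Lemma ff_top : ff lam (lam - 1)^-1 = pi / 2 / ww ^+ 3.
Proof.
have := @ffE 0; rewrite cos0 YY0 subr0; apply.
by rewrite lexx ltW// pih_gt0.
Qed.

(** Z = 1 / lam is the angle pi / 2 and Z = 1 / (lam - 1) the angle 0, so the two values of [ff]
    differ by - [Ym]. *)
Lemma KKE : KK lam = - kk.
Proof.
have h := @ffE (pi / 2); rewrite cos_pihalf subr0 in h.
rewrite /KK h ?ff_top; last by rewrite lexx andbT ltW// pih_gt0.
by rewrite addrAC subrr add0r invrN.
Qed.

Lemma BB_ex t : `|t| <= 1 -> exists a, inI a /\ YY a = t * Ym.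
Proof.
rewrite ler_norml => /andP[t1 t2].
have p0 := @pih_gt0 R.
have ab : - (pi / 2) <= pi / 2 :> R by lra.
have cY : {within `[- (pi / 2), pi / 2], continuous YY}.
  apply: derivable_within_continuous => x; rewrite in_itv /= => h.
  by have := is_derive_YY lam1 (inI_cos h) => ?; exact: ex_derive.
have bY : Num.min (YY (- (pi / 2))) (YY (pi / 2)) <= t * Ym <=
    Num.max (YY (- (pi / 2))) (YY (pi / 2)).
  have le : - Ym <= Ym by have := m0; lra.
  rewrite YYN -/Ym (min_idPl le) (max_idPr le).
  by have := m0 => m; apply/andP; split; nra.
have [c] := IVT ab cY bY.
by rewrite in_itv /= => h1 h2; exists c.
Qed.

(** The angle of the normal to the graph of phi at abscissa [t], whereas [AA] takes the slope y / -
    z of a ray. *)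
Definition BB t : R := get [set a | inI a /\ YY a = t * Ym].

Lemma BB_spec t : `|t| <= 1 -> inI (BB t) /\ YY (BB t) = t * Ym.
Proof. by move=> /BB_ex h; exact: (@getPex _ [set a | inI a /\ YY a = t * Ym]). Qed.

Lemma YY_inj a b : inI a -> inI b -> YY a = YY b -> a = b.
Proof.
move=> ia ib e; have [ab|ba|//] := ltgtP a b.
  by have := ltr_YY lam1 ia ib ab; rewrite e ltxx.
by have := ltr_YY lam1 ib ia ba; rewrite e ltxx.
Qed.

Lemma BB_unique t a : inI a -> YY a = t * Ym -> BB t = a.
Proof.
move=> ia e; have : [set a | inI a /\ YY a = t * Ym] (BB t).
  by apply: getPex; exists a.
by move=> [ib eb]; apply: YY_inj => //; rewrite eb.
Qed.

Lemma BBN t : `|t| <= 1 -> BB (- t) = - BB t.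
Proof.
move=> t1; have [ib eb] := BB_spec t1.
by apply: BB_unique; rewrite ?inIN// YYN eb mulNr.
Qed.

Lemma cos_BB_norm t : `|t| <= 1 -> cos (BB `|t|) = cos (BB t).
Proof.
move=> t1; have [h|h] := leP 0 t; first by rewrite ger0_norm.
by rewrite ltr0_norm// BBN// cosN.
Qed.

Lemma BB_ge0 t : 0 <= t <= 1 -> 0 <= BB t <= pi / 2.
Proof.
move=> /andP[h0 h1]; have t1 : `|t| <= 1 by rewrite ger0_norm.
have [ib eb] := BB_spec t1; have /andP[_ ->] := ib; rewrite andbT leNgt; apply/negP => b0.
have := ltr_YY lam1 ib (@inI0 R) b0; rewrite eb YY0.
by rewrite pmulr_llt0// ltNge h0.
Qed.

(** Every Z in the domain of [ff] is 1 / (lam - cos a) for the angle a = acos (lam - 1 / Z) in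
    [0, pi / 2]. As [YY] is injective there, the choice made by [get] is forced. *)
Lemma ffinvE t : 0 <= t <= 1 ->
  ffinv lam (pi / 2 / ww ^+ 3 - t * Ym) = (lam - cos (BB t))^-1.
Proof.
move=> t01; have t1 : `|t| <= 1 by case/andP: t01 => ? ?; rewrite ger0_norm.
have [ib eb] := BB_spec t1; have b01 := BB_ge0 t01.
set tt := _ - _.
have : [set Z | lam^-1 <= Z <= (lam - 1)^-1 /\ ff lam Z = tt] (ffinv lam tt).
  apply: getPex; exists (lam - cos (BB t))^-1; split; last by rewrite ffE// eb.
  have := inI_cos ib; have := cos_le1 (BB t); have := lc (BB t) => h0 h1 h2.
  have ? : 0 < lam - 1 by rewrite subr_gt0.
  have ? : 0 < lam by rewrite (lt_trans _ lam1).
  by apply/andP; split; rewrite lef_pV2 ?posrE//; lra.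
move: (ffinv lam tt) => Z [/andP[Z1 Z2] eZ].
have l0 : 0 < lam by rewrite (lt_trans _ lam1).
have Z0 : 0 < Z by apply: lt_le_trans Z1; rewrite invr_gt0.
have c01 : 0 <= lam - Z^-1 <= 1.
  apply/andP; split.
    by rewrite subr_ge0 -(invrK lam) lef_pV2 ?posrE ?invr_gt0.
  have : lam - 1 <= Z^-1 by rewrite -(invrK (lam - 1)) lef_pV2 ?posrE ?invr_gt0 ?subr_gt0.
  by lra.
pose a := acos (lam - Z^-1).
have ca : cos a = lam - Z^-1 by apply: acosK; rewrite in_itv /=; lra.
have a0 : 0 <= a by apply: acos_ge0; lra.
have ap : a <= pi / 2.
  rewrite leNgt; apply/negP => h.
  have p0 := @pih_gt0 R.
  have api : a <= pi by apply: acos_lepi; lra.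
  have := @ltr_cos R (pi / 2) a; rewrite !in_itv /= a0 api h cos_pihalf ca.
  move=> e; have : lam - Z^-1 < 0 by rewrite e//; lra.
  by lra.
have ZE : Z = (lam - cos a)^-1 by rewrite ca opprB addrC subrK invrK.
rewrite ZE; congr (lam - cos _)^-1.
apply/esym; apply: BB_unique; first by rewrite /inI ap andbT (le_trans _ a0)// oppr_le0 ltW// pih_gt0.
move: eZ; rewrite ZE ffE ?a0// /tt => /eqP.
by rewrite (inj_eq (addrI _)) (inj_eq oppr_inj) => /eqP.
Qed.

Lemma phiKE y : `|y| <= 1 -> phiK lam y = - kk / (lam - cos (BB y)).
Proof.
move=> y1; rewrite /phiK KKE ff_top invrN /kk invrK mulrN.
by rewrite ffinvE ?normr_ge0 ?normr_id// cos_BB_norm.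
Qed.

Lemma coneE y z : (y, z) \in cone lam -> z < 0 /\ `|y / - z| < T1.
Proof.
rewrite inE /cone /= KKE invrN mulrN -mulNr -mulNr => h.
have l0 : 0 < lam by rewrite (lt_trans _ lam1).
have z0 : z < 0.
  rewrite -oppr_gt0 -(pmulr_lgt0 _ l0) -(pmulr_lgt0 _ (_ : 0 < kk^-1)) ?invr_gt0//.
  exact: le_lt_trans h.
split => //; rewrite normrM normfV (gtr0_norm (_ : 0 < - z)) ?oppr_gt0//.
by rewrite ltr_pdivrMr ?oppr_gt0// mulrC mulrA.
Qed.

Lemma coneP y z : z < 0 -> `|y / - z| < T1 -> (y, z) \in cone lam.
Proof.
move=> z0 h; rewrite inE /cone /= KKE invrN mulrN -mulNr -mulNr; move: h.
rewrite normrM normfV (gtr0_norm (_ : 0 < - z)) ?oppr_gt0//.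
by rewrite ltr_pdivrMr ?oppr_gt0// mulrC mulrA.
Qed.

Definition LLx (p : R * R) : R := - p.2 * ell (p.1 / - p.2).

(** A point of level L with angle a has - z = L k / (lam - cos a) and y = L YY a / Ym, hence y / - z
    = TT a: the ray determines the angle, and the angle determines L. This is both existence and
    uniqueness of the number picked by [LL]. *)
Lemma LLE y z : (y, z) \in cone lam ->
  [/\ LL lam (y, z) = LLx (y, z), 0 < LLx (y, z), `|y / LLx (y, z)| < 1 &
      BB (y / LLx (y, z)) = AA (y / - z)].
Proof.
move=> /coneE[z0]; set x := - z; have x0 : 0 < x by rewrite oppr_gt0.
move=> tau1; set b := AA (y / x).
have LE : LLx (y, z) = x * ((lam - cos b) / kk) by rewrite /LLx /= ell_in// ltW.
have lcb := lc b.
have L0 : 0 < LLx (y, z) by rewrite LE mulr_gt0// divr_gt0.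
have ib : inI b := AA_inI lam1 _.
have eb : TT b = y / x by rewrite /b TT_AA// clip_id// ltW.
have Yb : YY b = y / LLx (y, z) * Ym.
  have -> : YY b = TT b / (lam - cos b) by rewrite /TT mulfK// gt_eqF.
  rewrite eb LE /kk; field.
  by rewrite !gt_eqF.
have p0 := @pih_gt0 R.
have [b1 b2] : - (pi / 2) < b /\ b < pi / 2 by have /andP[] := AA_oo lam1 tau1.
have t1 : `|y / LLx (y, z)| < 1.
  have Y1 : `|YY b| < Ym.
    rewrite ltr_norml -YYN; apply/andP; split; apply: ltr_YY => //.
      by rewrite inIN; exact: inIpih.
    exact: inIpih.
  by move: Y1; rewrite Yb normrM (gtr0_norm m0) -{2}[Ym]mul1r ltr_pM2r.
have BE : BB (y / LLx (y, z)) = b by exact: BB_unique.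
split => //.
have : [set L | [/\ 0 < L, `|y| <= L & z = L * phiK lam (y / L)]] (LL lam (y, z)).
  apply: (@getPex _ [set L | [/\ 0 < L, `|y| <= L & z = L * phiK lam (y / L)]]).
  exists (LLx (y, z)); split => //.
    move: t1; rewrite normrM normfV (gtr0_norm L0) ltr_pdivrMr// mul1r; exact: ltW.
  rewrite phiKE ?(ltW t1)// BE LE /x; field.
  by rewrite !gt_eqF.
move: (LL lam (y, z)) => L [Lp yL zE].
have tL : `|y / L| <= 1 by rewrite normrM normfV (gtr0_norm Lp) ler_pdivrMr// mul1r.
have [ia ea] := BB_spec tL; move: zE; rewrite phiKE//.
move: (BB _) ia ea => a ia ea zE.
have lca := lc a.
have xE : x = L * (kk / (lam - cos a)) by rewrite /x zE mulNr mulrN opprK.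
have ta : TT a = y / x.
  rewrite /TT ea xE /kk; field.
  by rewrite !gt_eqF.
have ab : b = a by rewrite /b -ta AA_TT.
rewrite LE ab xE; field.
by rewrite !gt_eqF.
Qed.

(** For |t| < 1 the angle stays away from - pi / 2 and pi / 2, where the graph becomes vertical; in
    between [BB] is differentiable as the inverse of YY / Ym. *)
Lemma is_derive_phiK t : `|t| < 1 ->
  is_derive t 1 (phiK lam) (sin (BB t) / cos (BB t)).
Proof.
move=> t1; have [ib eb] := BB_spec (ltW t1).
have b12 : - (pi / 2) < BB t < pi / 2.
  have /andP[h1 h2] := ib; rewrite !lt_neqAle h1 h2 !andbT.
  apply/andP; split; apply/eqP => ee; move: eb; [rewrite -ee YYN -/Ym|rewrite ee -/Ym] => e.
    have tE : t = - 1 by apply: (mulIf (lt0r_neq0 m0)); rewrite -e mulN1r.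
    by move: t1; rewrite tE normrN1 ltxx.
  have tE : t = 1 by apply: (mulIf (lt0r_neq0 m0)); rewrite -e mul1r.
  by move: t1; rewrite tE normr1 ltxx.
have /andP[b1 b2] := b12.
have c0 := cos_gt0_pihalf b12.
have lcb : lam - cos (BB t) != 0 by rewrite gt_eqF// lc.
have dB : is_derive t 1 BB (Ym * (lam - cos (BB t)) ^+ 2 / cos (BB t)).
  have f1 : is_derive (BB t) 1 (fun a => YY a / Ym) (cos (BB t) / (lam - cos (BB t)) ^+ 2 / Ym).
    have dY := is_derive_YY lam1 (inI_cos ib).
    by apply: is_derive_eq; rewrite /GRing.scale /=; field; rewrite lcb gt_eqF.
  have tE : t = YY (BB t) / Ym by rewrite eb mulfK// gt_eqF.
  have nI : \forall a \near BB t, inI a.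
    near=> a; apply/andP; split; apply: ltW; near: a; [exact: lt_nbhsr|exact: lt_nbhsl].
  have n1 : {near BB t, cancel (fun a => YY a / Ym) BB}.
    by apply: filterS nI => a ia; apply: BB_unique => //; rewrite divfK// gt_eqF.
  have n2 : {near BB t, continuous (fun a => YY a / Ym)}.
    apply: filterS nI => a ia; apply: cvgM; last exact: cvg_cst.
    exact: (is_derive_continuous (is_derive_YY lam1 (inI_cos ia))).
  have n3 : cos (BB t) / (lam - cos (BB t)) ^+ 2 / Ym != 0.
    by rewrite !mulf_neq0 ?invr_eq0 ?expf_neq0// gt_eqF.
  have := is_derive_inverse n1 n2 f1 n3; rewrite -tE => h.
  apply: is_derive_eq; field.
  by rewrite lcb !gt_eqF.
have dc : is_derive t 1 (fun t => cos (BB t))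
    (- sin (BB t) * (Ym * (lam - cos (BB t)) ^+ 2 / cos (BB t))).
  exact: is_derive1_compE.
apply: (@near_eq_is_derive _ _ _ (fun t => - kk / (lam - cos (BB t)))).
  near=> s; rewrite phiKE//; apply: ltW; near: s.
  by have := @norm_continuous _ _ t; move/cvgr_lt; exact.
apply: is_derive_eq; rewrite /GRing.scale /= /kk; field.
by rewrite lcb !gt_eqF.
Unshelve. all: by end_near. Qed.

Lemma qconeE y z : (y, z) \in cone lam ->
  qcone lam (y, z) = (- sin (AA (y / - z)), cos (AA (y / - z))).
Proof.
move=> yz; have [LE L0 t1 bE] := LLE yz; have [z0 tau1] := coneE yz.
rewrite /qcone LE /= derive1E (derive_val (is_derive := is_derive_phiK t1)) bE.
have c0 := cosAA_oo lam1 tau1; move: (AA _) c0 => a c0.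
have e : 1 + (sin a / cos a) ^+ 2 = (cos a)^-1 ^+ 2.
  by rewrite exprMn sin2cos2; field; rewrite gt_eqF.
rewrite e sqrtr_sqr gtr0_norm ?invr_gt0// invrK; congr pair.
by field; rewrite gt_eqF.
Qed.

Lemma LLxN y z : LLx (- y, z) = LLx (y, z).
Proof. by rewrite /LLx /=; congr (_ * _); rewrite mulNr /ell AAN// cosN normrN. Qed.

Lemma AA_ge0 t : 0 <= t -> 0 <= AA t <= pi / 2.
Proof.
move=> t0; have /andP[_ ->] := AA_inI lam1 t; rewrite andbT.
move: t0; rewrite le_eqVlt => /predU1P[<-|t0]; last by rewrite ltW// AA_gt0.
by rewrite (AA_unique lam1 (a := 0)) ?inI0// TT0 clip_id// normr0 ltW// T1_gt0.
Qed.

Lemma le_cos_pih a b : 0 <= a <= pi / 2 -> 0 <= b <= pi / 2 -> a <= b -> cos b <= cos a.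
Proof.
move=> /andP[a0 a1] /andP[b0 b1] ab; have p0 := @pih_gt0 R.
rewrite leNgt ltr_cos -?leNgt ?in_itv //=; apply/andP; split => //; lra.
Qed.

Lemma le_YY_le a b : inI a -> inI b -> YY a <= YY b -> a <= b.
Proof.
by move=> ia ib; apply: contraTT; rewrite -!ltNge => ba; exact: ltr_YY.
Qed.

(** By symmetry y >= 0. Outside the cone L = y < 1 and the graph of phi lies below the point.
    Inside, let b be the angle of the unit profile at abscissa y and a that of the ray: YY b = L YY
    a, so b <= a when L < 1 and a <= b when L >= 1, and the monotonicity of cos compares x (lam -
    cos b) with x (lam - cos a) = L k. *)
Lemma phiK_lt y z : Omega (y, z) -> (phiK lam y < z) = (LLx (y, z) < 1).
Proof.
move=> [/= y1 z0]; pose t := `|y|.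
have t0 : 0 <= t by exact: normr_ge0.
have t1 : t < 1 by rewrite ltr_norml.
have t01 : 0 <= t <= 1 by rewrite t0 ltW.
have -> : LLx (y, z) = LLx (t, z).
  by rewrite /t; case: (ger0P y) => // _; rewrite LLxN.
rewrite phiKE ?(ltW t1)// -cos_BB_norm ?(ltW t1)// -/t.
have nt : `|t| <= 1 by rewrite ger0_norm// ltW.
have [ib eb] := BB_spec nt.
have b01 := BB_ge0 t01; move: (BB t) ib eb b01 => b ib eb b01.
have := lc b; set x := - z => lcb; have x0 : 0 < x by rewrite oppr_gt0.
have -> : (- kk / (lam - cos b) < z) = (x * (lam - cos b) < kk).
  by rewrite ltr_pdivrMr// ltrNl /x mulNr.
have a01 : 0 <= AA (t / x) <= pi / 2 by apply: AA_ge0; rewrite divr_ge0// ltW.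
have tx0 : 0 <= t / x by rewrite divr_ge0// ltW.
have l0 : 0 < lam by rewrite (lt_trans _ lam1).
rewrite /LLx /= -/x; have [h|h] := ltP (t / x) T1; last first.
  have -> : ell (t / x) = t / x by rewrite ell_out ?ger0_norm.
  rewrite [x * (t / x)]mulrC divfK ?gt_eqF// t1.
  have : x * lam <= t * kk.
    have -> : x * lam = T1 * (kk * x) by rewrite /T1; field; rewrite gt_eqF.
    have -> : t * kk = t / x * (kk * x) by field; rewrite gt_eqF.
    by rewrite ler_wpM2r// mulr_ge0// ltW.
  have : t * kk < kk by rewrite -[ltRHS]mul1r ltr_pM2r.
  have : x * (lam - cos b) <= x * lam.
    by rewrite ler_pM2l// gerBl inI_cos.
  by move=> h1 h2 h3; apply: le_lt_trans h1 (le_lt_trans h3 h2).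
have ia := AA_inI lam1 (t / x); have := TT_AA lam1 (t / x).
have htx : `|t / x| <= T1 by rewrite ger0_norm// ltW.
rewrite clip_id// ell_in//.
move: (AA (t / x)) a01 ia => a a01 ia ea.
have lca := lc a; set L := x * ((lam - cos a) / kk).
have L0 : 0 < L by rewrite mulr_gt0// divr_gt0.
have LE : x * (lam - cos a) = L * kk by rewrite /L mulrA divfK// gt_eqF.
have YE : YY b = YY a * L.
  rewrite eb; have -> : t = TT a * x by rewrite ea divfK// gt_eqF.
  by rewrite /TT /L /kk; field; rewrite gt_eqF.
have Ya : 0 <= YY a by apply: YY_ge0 => //; case/andP: a01.
have [L1|L1] := ltP L 1; [|apply/negbTE; rewrite -leNgt].
  have ba : b <= a by apply: le_YY_le => //; rewrite YE ler_piMr// ltW.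
  apply: (@le_lt_trans _ _ (L * kk)); last by rewrite -[ltRHS]mul1r ltr_pM2r.
  by rewrite -LE ler_pM2l// lerB// le_cos_pih.
have ab : a <= b by apply: le_YY_le => //; rewrite YE ler_peMr.
apply: (@le_trans _ _ (L * kk)); first by rewrite -[leLHS]mul1r ler_pM2r.
by rewrite -LE ler_pM2l// lerB// le_cos_pih.
Qed.

End ProfileAngle.

(** * Directional derivatives in the plane *)

Section Directional.
Context {R : realType}.
Implicit Types (f : R * R -> R) (p v : R * R).

Lemma is_derive_line f p v (d : R) :
  is_derive p v f d <-> is_derive (0 : R) 1 (fun t : R => f (t *: v + p)) d.
Proof. by apply: is_derive_slice => h; rewrite addr0. Qed.

Lemma is_derive_dir_comp (g : R -> R) f p v (a b : R) :
  is_derive (f p) 1 g a -> is_derive p v f b ->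
  is_derive p v (fun p => g (f p)) (a * b).
Proof.
move=> dg /is_derive_line df; apply/is_derive_line.
apply: (is_derive1_compE (f := g) (g := fun t => f (t *: v + p))) => //.
by rewrite scale0r add0r.
Qed.

Lemma is_derive_invf f p v (d : R) : f p != 0 -> is_derive p v f d ->
  is_derive p v (fun q => (f q)^-1) (- (f p) ^- 2 *: d).
Proof.
move=> f0 df; apply: is_derive_dir_comp df.
have := @is_deriveV R id (f p) 1 1 f0 (is_derive_id _ _).
by rewrite /GRing.scale /= mulr1.
Qed.

Lemma is_derive_fst p v : is_derive p v fst v.1.
Proof.
apply/is_derive_line; rewrite /=.
by apply: is_derive_eq; rewrite /GRing.scale /=; ring.
Qed.

Lemma is_derive_snd p v : is_derive p v snd v.2.
Proof.
apply/is_derive_line; rewrite /=.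
by apply: is_derive_eq; rewrite /GRing.scale /=; ring.
Qed.

(** Here [a] is the contribution of the regularised sign and [ha] its part of weight [HH], [he] the
    loss where the second barrier acts, and [j] the transition layer. *)
Lemma divergence_arith (l m a ha he j : R) : j <= 0 -> ha <= a -> he <= l - m ->
  - l - a + (ha + he) + j <= - m.
Proof. by move=> *; lra. Qed.

End Directional.

(** * The divergence inequality in the limit *)

Section Truncation.
Context {R : realType}.
Implicit Types (p : R * R) (F : R * R -> R).

(** What a regularised field satisfies before truncation in z. It is continuous for z < 0 only; the
    second component vanishes down to depth [d], so that z = 0 contributes no boundary term; the
    growth is linear in z, matched by the weight on the gradients of X. *)
Record div_field (C d K : R) (F1 F2 dF1 dF2 : R * R -> R) : Prop := {
  df_C : 0 <= C;
  df_d : 0 < d;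
  df_cvg : forall p, p.2 < 0 ->
    [/\ {for p, continuous F1}, {for p, continuous F2},
        {for p, continuous dF1} & {for p, continuous dF2}];
  df_ey : forall p, p.2 < 0 -> `|p.1| <= 1 -> is_derive p (ey : R * R) F1 (dF1 p);
  df_ez : forall p, `|p.1| <= 1 -> is_derive p (ez : R * R) F2 (dF2 p);
  df_top : forall p, `|p.1| <= 1 -> - d <= p.2 -> F2 p = 0 /\ dF2 p = 0;
  df_topy : forall p, `|p.1| <= 1 -> - d <= p.2 < 0 -> `|dF1 p| <= K;
  df_growth : forall p, `|p.1| <= 1 -> p.2 < 0 ->
    `|F1 p| <= C * (1 - p.2) /\ `|F2 p| <= C * (1 - p.2) }.

Definition chi (N : R) p : R := cutoff (- p.2 / N).
Definition dchi (N : R) p : R := - dcutoff (- p.2 / N) / N.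

Section Cutoff.
Variable N : R.
Hypothesis N0 : 0 < N.

Lemma chi_ge0 p : 0 <= chi N p. Proof. exact: cutoff_ge0. Qed.
Lemma chi_le1 p : chi N p <= 1. Proof. exact: cutoff_le1. Qed.
Lemma norm_chi p : `|chi N p| <= 1.
Proof. by rewrite ger0_norm ?chi_ge0 ?chi_le1. Qed.

Lemma chi1 p : - N <= p.2 -> chi N p = 1 /\ dchi N p = 0.
Proof.
move=> pN; have h : - p.2 / N <= 1 by rewrite ler_pdivrMr//; lra.
by have [c d] := cutoff1 h; rewrite /chi /dchi c d oppr0 mul0r.
Qed.

Lemma chi0 p : p.2 <= - (2 * N) -> chi N p = 0 /\ dchi N p = 0.
Proof.
move=> pN; have h : 2 <= - p.2 / N by rewrite ler_pdivlMr//; lra.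
by have [c d] := cutoff0 h; rewrite /chi /dchi c d oppr0 mul0r.
Qed.

Lemma norm_dchi p : `|dchi N p| <= 4 / N.
Proof.
have /andP[h1 h2] := dcutoff_bnd (- p.2 / N).
rewrite /dchi normrM normrN (ger0_norm (_ : 0 <= N^-1)); last by rewrite invr_ge0 ltW.
by rewrite ler_pM2r ?invr_gt0// ler_norml; apply/andP; split; lra.
Qed.

Let cvg_scale p : (- q.2 / N) @[q --> p] --> - p.2 / N.
Proof. by apply: cvgMl; apply: cvgN; exact: cvg_snd. Qed.

Lemma continuous_chi : continuous (chi N).
Proof.
move=> p;
have h : cutoff t @[t --> - p.2 / N] --> cutoff (- p.2 / N).
  exact: is_derive_continuous (is_derive_cutoff _).
exact: (cvg_comp _ _ (@cvg_scale p) h).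
Qed.

Lemma continuous_dchi : continuous (dchi N).
Proof.
move=> p; apply: cvgMl; apply: cvgN.
exact: (cvg_comp _ _ (@cvg_scale p) (@continuous_dcutoff _ (- p.2 / N))).
Qed.

Lemma is_derive_chi (y z : R) : is_derive z 1 (fun t => chi N (y, t)) (dchi N (y, z)).
Proof.
have h : is_derive z 1 (fun t : R => - t / N) (- N^-1).
  by apply: is_derive_eq; rewrite /GRing.scale /= ; ring.
have := @is_derive1_compE _ cutoff _ z _ _ (is_derive_cutoff (- z / N)) h.
by rewrite mulrN -mulNr.
Qed.

End Cutoff.

(** Derivatives are bounded by compactness for - 2 N <= z <= - d. Above - d, where the first one has
    no continuous extension to z = 0, the bound is [K], and the second component is 0. *)
Lemma flux_trunc C d K F1 F2 dF1 dF2 N : div_field C d K F1 F2 dF1 dF2 -> 0 < N ->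
  exists C', flux (2 * N) C' (fun p => chi N p * F1 p) (fun p => chi N p * F2 p)
    (fun p => chi N p * dF1 p) (fun p => chi N p * dF2 p + dchi N p * F2 p).
Proof.
move=> hF N0.
have [C0 d0 cF dFy dFz Ftop Fy gr] := hF.
have mlow (f : R * R -> R) : (forall p, p.2 < 0 -> {for p, continuous f}) ->
    measurable_fun (lower : set (plane R)) f.
  by move=> cf; apply: open_continuous_measurable_plane => //; exact: open_lower.
have cc := @continuous_chi N; have cdc := @continuous_dchi N.
have c1 (p : R * R) : p.2 < 0 -> {for p, continuous (fun p => chi N p * F1 p)}.
  by move=> /cF[h _ _ _]; apply: cvgM; [exact: cc|exact: h].
have c2 (p : R * R) : p.2 < 0 -> {for p, continuous (fun p => chi N p * F2 p)}.
  by move=> /cF[_ h _ _]; apply: cvgM; [exact: cc|exact: h].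
have c3 (p : R * R) : p.2 < 0 -> {for p, continuous (fun p => chi N p * dF1 p)}.
  by move=> /cF[_ _ h _]; apply: cvgM; [exact: cc|exact: h].
have c4 (p : R * R) : p.2 < 0 -> {for p, continuous (fun p => chi N p * dF2 p + dchi N p * F2 p)}.
  move=> /cF[_ h2 _ h]; apply: cvgD; apply: cvgM; [exact: cc|exact: h| |exact: h2].
  exact: cdc.
have n1 (y : R) : -1 <= y <= 1 -> `|y| <= 1 by rewrite ler_norml.
have nd : - d < 0 by lra.
have [B1 B10 hB1] : exists2 B, 0 <= B & forall p, -1 <= p.1 <= 1 -> - (2 * N) <= p.2 <= - d ->
    `|dF1 p| <= B.
  by apply: continuous_bounded_box => p _ /andP[_ pd]; have [] := cF p (le_lt_trans pd nd).
have [B2 B20 hB2] : exists2 B, 0 <= B & forall p, -1 <= p.1 <= 1 -> - (2 * N) <= p.2 <= - d ->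
    `|dF2 p| <= B.
  by apply: continuous_bounded_box => p _ /andP[_ pd]; have [] := cF p (le_lt_trans pd nd).
pose G := C * (1 + 2 * N); have G0 : 0 <= G by rewrite /G mulr_ge0//; lra.
have N40 : 0 <= 4 / N by rewrite divr_ge0// ltW.
pose C' := G + `|K| + B1 + B2 + 4 / N * G.
have NG : 0 <= 4 / N * G by rewrite mulr_ge0.
have K0 : 0 <= `|K| by [].
have bl M a c : M <= 1 -> 0 <= M -> 0 <= a -> a <= c -> M * a <= c.
  by move=> M1 M0 a0 ac; rewrite (le_trans _ ac)// -[leRHS]mul1r ler_wpM2r.
exists C'; split.
- by lra.
- exact: mlow.
- exact: mlow.
- exact: mlow.
- exact: mlow.
- move=> p p1 p2.
  have p1' := n1 _ p1.
  have C'0 : 0 <= C' by rewrite /C' !addr_ge0.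
  have [pN|Np] := leP p.2 (- (2 * N)).
    by have [-> ->] := chi0 N0 pN; rewrite !mul0r addr0 normr0 C'0.
  have [g1 g2] := gr p p1' p2.
  have gG : C * (1 - p.2) <= G by rewrite /G ler_wpM2l//; lra.
  have nc := norm_chi N p.
  have [dd1 dd2] : `|dF1 p| <= `|K| + B1 /\ `|dF2 p| <= B2.
    have [pd|pd] := leP p.2 (- d).
      have hb : - (2 * N) <= p.2 <= - d by rewrite pd ltW.
      by split; [rewrite (le_trans (hB1 p p1 hb)) ?lerDr|exact: hB2].
    have [_ ->] := Ftop p p1' (ltW pd); rewrite normr0; split => //.
    have h : - d <= p.2 < 0 by rewrite p2 ltW.
    by rewrite (le_trans (Fy p p1' h))// (le_trans (ler_norm _))// lerDl.
  have f1 : `|F1 p| <= C' by rewrite (le_trans g1)// (le_trans gG)// /C'; lra.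
  have f2 : `|F2 p| <= G by rewrite (le_trans g2)// (le_trans gG)//.
  split; rewrite ?(normrM (chi N p) (_ p)).
  + by apply: bl.
  + by apply: bl => //; rewrite (le_trans f2)// /C'; lra.
  + by apply: bl => //; rewrite (le_trans dd1)// /C'; lra.
  + rewrite (le_trans (ler_normD _ _))// (normrM (chi N p)) (normrM (dchi N p)).
    have h1 : `|chi N p| * `|dF2 p| <= B2 by exact: bl.
    have h2 : `|dchi N p| * `|F2 p| <= 4 / N * G.
      by rewrite ler_pM// norm_dchi.
    by rewrite (le_trans (lerD h1 h2))// /C'; lra.
- by move=> p /ltW pN; have [-> ->] := chi0 N0 pN; rewrite !mul0r addr0.
- move=> y y1; have y1' : -1 <= y <= 1 by case/andP: y1 => /ltW -> /ltW ->.
  have dl : - d <= (y, 0 : R).2 by rewrite /= oppr_le0 ltW.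
  by have [-> _] := Ftop (y, 0) (n1 _ y1') dl; rewrite mulr0.
- move=> y z z0 y1.
  have /is_derive_ey h := dFy (y, z) z0 (n1 _ y1).
  rewrite /chi /=.
  by apply: is_derive_eq; rewrite /GRing.scale /=; ring.
- by move=> y z z0 y1; apply: (@continuous_slice_y _ _ y z (c3 (y, z) z0)).
- move=> y z y1 z0.
  have y1' : -1 <= y <= 1 by case/andP: y1 => /ltW -> /ltW ->.
  have /is_derive_ez h := dFz (y, z) (n1 _ y1').
  have h' := is_derive_chi N y z.
  by apply: is_derive_eq; rewrite /GRing.scale /=; ring.
(* At z = 0 the slice derivative is continuous because it vanishes nearby, by [df_top]. *)
- move=> y z y1; rewrite le_eqVlt => /orP[/eqP -> |z0]; last first.
    exact: (@continuous_slice_z _ _ y z (c4 (y, z) z0)).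
  have y1' : -1 <= y <= 1 by case/andP: y1 => /ltW -> /ltW ->.
  have near0 : \forall t \near (0 : R),
      chi N (y, t) * dF2 (y, t) + dchi N (y, t) * F2 (y, t) = 0.
    have idc : id t @[t --> (0 : R)] --> (0 : R) by exact: cvg_id.
    near=> t; have tl : - d <= (y, t).2.
      by rewrite /= ltW//; near: t; exact: (cvgr_gt _ idc _ nd).
    by have [-> ->] := Ftop (y, t) (n1 _ y1') tl; rewrite !mulr0 addr0.
  have e0 := nbhs_singleton near0.
  rewrite /prop_for /continuous_at e0.
  apply: cvg_near_cst; exact: near0.
Unshelve. all: by end_near. Qed.

End Truncation.

(** * Integrability in X and the limit inequality *)

Section DivergenceInequality.
Context {R : realType}.
Implicit Types (p : R * R) (f g phi : R * R -> R) (gphi : R * R -> R * R).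

Lemma ae_leb2S (P Q : R * R -> Prop) : (forall p, P p -> Q p) ->
  {ae leb2, forall p, P p} -> {ae leb2, forall p, Q p}.
Proof.
by move=> PQ; apply: (@negligibleS _ (plane R) R leb2) => p nQ /PQ.
Qed.

Lemma Omega_bounds p : Omega p -> `|p.1| <= 1 /\ p.2 < 0.
Proof. by move=> [/andP[h1 h2] h]; rewrite ler_norml ltW// ltW. Qed.

(** For z < -1 one has |g| <= |z g|; for z >= -1 one has |g| <= 1 + g^2 on a set of finite
    measure. *)
Lemma integrable_weighted g : inL2 g -> intOmega (fun p => p.2 * g p) ->
  intOmega (fun p => (1 - p.2) * `|g p|).
Proof.
move=> [mg ig] iw; have mO := @measurable_Omega R.
have mI : measurable (Omegab 1 : set (plane R)) by exact: measurable_Omegab.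
have m2 : measOmega (fun p : R * R => p.2).
  exact: measurable_funTS measurable_snd.
apply: (@le_integrableR _ _ _ leb2 _ mO _
  (fun p => \1_(Omegab 1 : set (plane R)) p + g p ^+ 2 + 2 * `|p.2 * g p|)).
- apply: measurable_funM; first exact: measurable_funB.
  exact: measurableT_comp.
- move=> p Op; have [_ p2] := Omega_bounds Op.
  have x0 : 0 <= 1 - p.2 by lra.
  rewrite normrM normr_id (ger0_norm x0) normrM (ltr0_norm p2) indicE OmegabE.
  have -> : -1 < p.1 < 1 by case: Op.
  rewrite p2 andbT /= -(real_normK (num_real (g p))); move: (normr_ge0 (g p)); move: `|g p| => t t0.
  have [h|h] := leP (-1) p.2; rewrite /=.
    suff : t <= 1 + t ^+ 2 + - p.2 * t by lra.
    have : 0 <= - p.2 * t by rewrite mulr_ge0// oppr_ge0 ltW.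
    nra.
  have : t <= - p.2 * t by rewrite ler_peMl//; lra.
  by have := sqr_ge0 t; lra.
- apply: integrableDR => //; last first.
    by apply: integrableZR => //; exact: integrable_normR.
  apply: integrableDR => //.
  apply/integrableP; split.
    by apply/measurable_EFinP; exact: measurable_indic.
  under eq_integral do rewrite /= ger0_norm//.
  rewrite integral_indic// (le_lt_trans _ (leb2_Omegab 1))//.
  by apply: le_measure; rewrite ?inE//; exact: measurableI.
Qed.

(** A test function is nonnegative only almost everywhere; with |phi| in its place estimates can be
    made at every point. *)
Lemma ae_eq_RintegralM f phi :
  measOmega f -> measOmega phi ->
  {ae leb2, forall p, Omega p -> 0 <= phi p} ->
  \int[leb2]_(p in Omega) (f p * phi p) = \int[leb2]_(p in Omega) (f p * `|phi p|).
Proof.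
move=> mf mphi phi0; rewrite /Rintegral; congr fine.
apply: ae_eq_integral; first exact: measurable_Omega.
- by apply/measurable_EFinP; exact: measurable_funM.
- by apply/measurable_EFinP; apply: measurable_funM => //; exact: measurableT_comp.
- by apply: ae_leb2S phi0 => p h Op /=; rewrite ger0_norm// h.
Qed.

(** Monotone convergence along the truncations of [Omega], on each of which the corresponding [chi]
    is 1. *)
Lemma integrable_exhaust f (K : R) :
  measOmega f ->
  (forall n : nat, intOmega (fun p => chi n.+1%:R p * `|f p|) /\
     \int[leb2]_(p in Omega) (chi n.+1%:R p * `|f p|) <= K) ->
  intOmega f.
Proof.
move=> mf fK; have mO := @measurable_Omega R.
have OU : (Omega : set (R * R)) = \bigcup_n Omegab n.+1%:R.
  apply/seteqP; split=> [p [h1 h2]|p [n _]]; last first.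
    by rewrite /Omegab /= !in_itv /= => -[h1 /andP[_ h2]].
  exists (Num.truncn (- p.2)) => //; rewrite /Omegab /= !in_itv /= h2 andbT; split => //.
  by rewrite lerNl ltW// truncnS_gt.
have mb n : measurable (Omegab n.+1%:R : set (plane R)) by exact: measurable_Omegab.
have sub n : (Omegab n.+1%:R : set (R * R)) `<=` Omega by rewrite OU => p; exists n.
have mn : measOmega (fun p => `|f p|%:E).
  by apply/measurable_EFinP; exact: measurableT_comp.
apply/integrableP; split; first exact/measurable_EFinP.
apply: (@le_lt_trans _ _ K%:E); last exact: ltry.
have cv := @ge0_nondecreasing_set_cvg_integral _ (plane R) R
  (fun n => Omegab n.+1%:R) (fun p => `|f p|%:E) leb2.
have : (\int[leb2]_(p in Omegab n.+1%:R) (`|f p|)%:E @[n --> \oo] -->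
   \int[leb2]_(p in Omega) (`|f p|)%:E)%E.
  rewrite [X in (\int[_]_(_ in X) _)%E]OU; apply: cv => [n m nm|n|n|n p _].
  - apply/subsetPset => p; rewrite /Omegab /= !in_itv /= => -[h1 /andP[h2 ->]].
    split => //; rewrite andbT (le_trans _ h2)// lerN2 ler_nat; exact: nm.
  - exact: mb.
  - by apply: measurable_funS mn => //; exact: sub.
  - by rewrite lee_fin.
move=> c; rewrite -(cvg_lim _ c)//; apply: lime_le; first by apply/cvg_ex; eexists; exact: c.
apply: nearW => n; have [fi fK'] := fK n.
apply: (@le_trans _ _ (\int[leb2]_(p in Omega) (chi n.+1%:R p * `|f p|)%:E)%E); last first.
  by rewrite (EFin_Rintegral mO fi) lee_fin.
rewrite [leLHS](_ : _ = \int[leb2]_(p in Omegab n.+1%:R) (chi n.+1%:R p * `|f p|)%:E)%E; last first.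
  apply: eq_integral => p; rewrite inE /Omegab /= !in_itv /= => -[_ /andP[h _]].
  by have [-> _] := chi1 (ltr0Sn _ n) h; rewrite mul1r.
apply: ge0_subset_integral => //.
- by case/integrableP: fi.
- by move=> p _; rewrite lee_fin mulr_ge0 ?chi_ge0.
Qed.

Lemma calX_integrable phi gphi : calX phi gphi ->
  {ae leb2, forall p, Omega p -> 0 <= phi p} ->
  [/\ intOmega phi, intOmega (fun p => (1 - p.2) * `|(gphi p).1|) &
      intOmega (fun p => (1 - p.2) * `|(gphi p).2|)].
Proof.
move=> hX phi0; have [[Lphi L1 L2 _] _ w1 w2] := hX.
have i1 := integrable_weighted L1 w1; have i2 := integrable_weighted L2 w2.
split => //; have [mphi _] := Lphi; have [m1 _] := L1.
(* Divergence -1 and no vertical component: the cutoff causes no error, and since |y| <= 1 the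
   integrals of [chi] phi are bounded by that of the weighted y-derivative, uniformly in n. *)
have df : div_field 1 1 1 (fun p : R * R => - p.1) (cst 0) (cst (-1)) (cst 0).
  split => //.
  - move=> p _; split; try exact: cst_continuous.
    by apply: cvgN; exact: cvg_fst.
  - move=> p _ _; have h := is_derive_fst p (ey : R * R).
    by apply: is_derive_eq.
  - by move=> p _; exact: is_derive_cst.
  - by move=> p _ _; rewrite normrN1.
  - move=> p p1 p2; rewrite normrN normr0 !mul1r; split; lra.
have mO := @measurable_Omega R.
apply: (@integrable_exhaust _ (\int[leb2]_(p in Omega) ((1 - p.2) * `|(gphi p).1|))) => // n.
have n0 : 0 < n.+1%:R :> R by [].
have [C' fl] := flux_trunc df n0.
have mchi : measOmega (chi (n.+1%:R : R)).
  by apply: measurable_funTS; apply: continuous_measurable_plane; exact: continuous_chi.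
have E := flux_calX fl hX.
have ip : intOmega (fun p => chi n.+1%:R p * cst (-1) p * phi p).
  by apply: (flux_integrable_L2 fl) => //; rewrite !inE eqxx ?orbT.
have ip' : intOmega (fun p => chi n.+1%:R p * `|phi p|).
  apply: eq_integrable (integrable_normR mO ip) => // p _ /=.
  by rewrite mulrN1 mulNr normrN normrM (ger0_norm (chi_ge0 _ _)).
have ig : intOmega (fun p => chi n.+1%:R p * - p.1 * (gphi p).1).
  by apply: (flux_integrable_L2 fl) => //; rewrite !inE eqxx.
split => //; rewrite -(ae_eq_RintegralM mchi mphi phi0).
have -> : \int[leb2]_(p in Omega) (chi n.+1%:R p * phi p) =
    \int[leb2]_(p in Omega) (chi n.+1%:R p * - p.1 * (gphi p).1).
  transitivity (- \int[leb2]_(p in Omega) (chi n.+1%:R p * cst (-1) p * phi p)).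
    rewrite -[RHS]mulN1r -RintegralZl//; apply: eq_Rintegral => p _.
    by rewrite /cst; ring.
  rewrite (_ : \int[leb2]_(p in Omega) (chi n.+1%:R p * cst (-1) p * phi p) =
    \int[leb2]_(p in Omega) ((chi n.+1%:R p * cst (-1) p +
      (chi n.+1%:R p * cst 0 p + dchi n.+1%:R p * cst 0 p)) * phi p)); last first.
    by apply: eq_Rintegral => p _; rewrite !mulr0 !addr0.
  rewrite -E; apply: eq_Rintegral => p _.
  by rewrite /cst mulr0 mul0r addr0.
apply: le_Rintegral => // p /Omega_bounds[p1 p2].
rewrite (le_trans (ler_norm _))// normrM ler_wpM2r// normrM normrN.
have := norm_chi n.+1%:R p; move: (normr_ge0 p.1) (normr_ge0 (chi n.+1%:R p)) p1.
by move: `|p.1| `|chi _ _| => a c; nra.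
Qed.

(** On the support of [dchi] one has |z| <= 2 N, so the factor 4 / N compensates the linear growth;
    12 is 4 (1 + 2). *)
Lemma dchi_growth (C f N : R) p : 1 <= N -> 0 <= C -> p.2 < 0 -> `|f| <= C * (1 - p.2) ->
  `|dchi N p * f| <= 12 * C.
Proof.
move=> N1 C0 p2 fC; have N0 : 0 < N by lra.
have [pN|Np] := leP p.2 (- (2 * N)).
  by have [_ ->] := chi0 N0 pN; rewrite mul0r normr0 mulr_ge0.
rewrite normrM (@le_trans _ _ (4 / N * (C * (1 + 2 * N))))//.
  rewrite ler_pM ?norm_dchi// (le_trans fC)// ler_wpM2l//; lra.
have -> : 4 / N * (C * (1 + 2 * N)) = 4 * C * (N^-1 + 2) by field; rewrite gt_eqF.
have i1 : N^-1 <= 1 by rewrite invf_le1.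
nra.
Qed.

Lemma cvg_chi p : chi n.+1%:R p @[n --> \oo] --> (1 : R).
Proof.
apply: cvg_near_cst; near=> n.
have : - n%:R <= p.2 by rewrite lerNl; near: n; exact: nbhs_infty_ger.
move=> h; have h' : - n.+1%:R <= p.2 by rewrite (le_trans _ h)// lerN2 ler_nat.
by have [] := chi1 (ltr0Sn _ n) h'.
Unshelve. all: by end_near. Qed.

Lemma cvg_dchi0 p (u_ : nat -> R) : dchi n.+1%:R p * u_ n @[n --> \oo] --> (0 : R).
Proof.
apply: cvg_near_cst; near=> n.
have : - n%:R <= p.2 by rewrite lerNl; near: n; exact: nbhs_infty_ger.
move=> h; have h' : - n.+1%:R <= p.2 by rewrite (le_trans _ h)// lerN2 ler_nat.
by have [_ ->] := chi1 (ltr0Sn _ n) h'; rewrite mul0r.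
Unshelve. all: by end_near. Qed.

Lemma trunc_arith (A c f w : R) : 0 <= A -> `|c| <= 1 ->
  `|f| <= A ->
  `|c * f * w| <= A * `|w|.
Proof.
by move=> A0 c1 fA; rewrite !normrM ler_wpM2r// -[leRHS]mul1r ler_pM.
Qed.

(** Integration by parts against the truncated field gives an integral equal to 0. Replacing the
    divergence by - mu and the cutoff error by its modulus turns the integrand into [h n], whose
    integral is therefore nonnegative. One dominated convergence then removes regularisation and
    truncation together; the majorant [D] uses phi in L1 and the weight 1 - z on its gradient. *)
Lemma divergence_inequality (mu C : R) (F1 F2 dF1 dF2 : nat -> R * R -> R)
    (G1 G2 : R * R -> R) phi gphi :
  (forall n, exists d K, div_field C d K (F1 n) (F2 n) (dF1 n) (dF2 n)) ->
  (forall n p, Omega p -> dF1 n p + dF2 n p <= - mu) ->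
  (forall p, Omega p -> F1 n p @[n --> \oo] --> G1 p) ->
  (forall p, Omega p -> F2 n p @[n --> \oo] --> G2 p) ->
  calX phi gphi -> {ae leb2, forall p, Omega p -> 0 <= phi p} ->
  (mu%:E * \int[leb2]_(p in Omega) (phi p)%:E <=
   \int[leb2]_(p in Omega) (G1 p * (gphi p).1 + G2 p * (gphi p).2)%:E)%E.
Proof.
move=> hF div cF1 cF2 hX phi0.
have mO := @measurable_Omega R.
have [iphi iw1 iw2] := calX_integrable hX phi0.
have [[Lphi L1 L2 _] _ _ _] := hX.
have [mphi _] := Lphi; have [m1 _] := L1; have [m2 _] := L2.
have C0 : 0 <= C by have [d [K []]] := hF 0%N.
have mlow f : (forall p, p.2 < 0 -> {for p, continuous f}) ->
    measOmega f.
  by move=> cf; apply: continuous_measurable_Omega => p [_ /cf].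
have mF1 n : measOmega (F1 n).
  by apply: mlow => p p2; have [d [K []]] := hF n => _ _ /(_ p p2)[].
have mF2 n : measOmega (F2 n).
  by apply: mlow => p p2; have [d [K []]] := hF n => _ _ /(_ p p2)[].
have md1 n : measOmega (dF1 n).
  by apply: mlow => p p2; have [d [K []]] := hF n => _ _ /(_ p p2)[].
have md2 n : measOmega (dF2 n).
  by apply: mlow => p p2; have [d [K []]] := hF n => _ _ /(_ p p2)[].
have mG1 : measOmega G1 by exact: measurable_fun_cvg cF1.
have mG2 : measOmega G2 by exact: measurable_fun_cvg cF2.
have mc n : measOmega (chi (n.+1%:R : R)).
  by apply: mlow => p _; exact: continuous_chi.
have mdc n : measOmega (dchi (n.+1%:R : R)).
  by apply: mlow => p _; exact: continuous_dchi.
have maphi : measOmega (fun p => `|phi p|).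
  exact: measurableT_comp.
pose D p := C * ((1 - p.2) * `|(gphi p).1|) + C * ((1 - p.2) * `|(gphi p).2|)
  + (`|mu| + 12 * C) * `|phi p|.
have iD : intOmega D.
  apply: integrableDR => //; last by apply: integrableZR => //; exact: integrable_normR.
  by apply: integrableDR => //; exact: integrableZR.
pose h n p := chi n.+1%:R p * F1 n p * (gphi p).1 + chi n.+1%:R p * F2 n p * (gphi p).2
  - mu * (chi n.+1%:R p * `|phi p|) + `|dchi n.+1%:R p * F2 n p| * `|phi p|.
have gr n p : Omega p -> `|F1 n p| <= C * (1 - p.2) /\ `|F2 n p| <= C * (1 - p.2).
  by move=> /Omega_bounds[p1 p2]; have [d [K []]] := hF n => _ _ _ _ _ _ _; exact.
have hD n p : Omega p -> `|h n p| <= D p.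
  move=> Op; have [_ p2] := Omega_bounds Op; have [g1 g2] := gr n p Op.
  have x0 : 0 <= C * (1 - p.2) by rewrite mulr_ge0//; lra.
  have c1 := norm_chi n.+1%:R p.
  have t1 := trunc_arith (gphi p).1 x0 c1 g1.
  have t2 := trunc_arith (gphi p).2 x0 c1 g2.
  have N1 : 1 <= n.+1%:R :> R by rewrite ler1n.
  have t3 := dchi_growth N1 C0 p2 g2.
  rewrite /h /D; apply: (le_trans (ler_normD _ _)).
  rewrite [X in _ <= _ + X]mulrDl addrA lerD//; last first.
    by rewrite normrM !normr_id ler_wpM2r.
  apply: (le_trans (ler_normB _ _)); rewrite lerD//.
    by rewrite (le_trans (ler_normD _ _))// lerD// mulrA.
  rewrite (normrM mu) ler_wpM2l// (normrM (chi _ _)) normr_id -[leRHS]mul1r.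
  by rewrite ler_wpM2r.
have mh n : measOmega (h n).
  apply: measurable_funD; last first.
    by apply: measurable_funM => //; apply: measurableT_comp => //; exact: measurable_funM.
  apply: measurable_funB; last by apply: measurable_funM => //; exact: measurable_funM.
  by apply: measurable_funD; apply: measurable_funM => //; exact: measurable_funM.
have ih n : intOmega (h n) by apply: (le_integrableR mO (mh n) (hD n)).
pose hl p := G1 p * (gphi p).1 + G2 p * (gphi p).2 - mu * `|phi p|.
have mhl : measOmega hl.
  apply: measurable_funB; last exact: measurable_funM.
  by apply: measurable_funD; exact: measurable_funM.
have ch p : Omega p -> h n p @[n --> \oo] --> hl p.
  move=> Op; have cc := cvg_chi p; have z := cvg_dchi0 p.
  rewrite /hl -[X in _ --> X]addr0.
  apply: cvgD.
    apply: cvgB.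
      have -> : G1 p * (gphi p).1 + G2 p * (gphi p).2 =
        1 * G1 p * (gphi p).1 + 1 * G2 p * (gphi p).2 by rewrite !mul1r.
      apply: cvgD.
        by apply: cvgMl; apply: cvgM => //; exact: cF1.
      by apply: cvgMl; apply: cvgM => //; exact: cF2.
    apply: cvgMr; rewrite -[X in _ --> X]mul1r.
    exact: cvgMl.
  rewrite -[X in _ --> X](mul0r `|phi p|) -(normr0 R).
  by apply: cvgMl; apply: cvg_norm; exact: z.
have h0 n : 0 <= \int[leb2]_(p in Omega) h n p.
  have [d [K hFn]] := hF n; have n0 : 0 < n.+1%:R :> R by [].
  have [C' fl] := flux_trunc hFn n0.
  have := flux_calX fl hX.
  set A1 := fun p => chi n.+1%:R p * F1 n p; set A2 := fun p => chi n.+1%:R p * F2 n p.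
  set B1 := fun p => chi n.+1%:R p * dF1 n p.
  set B2 := fun p => chi n.+1%:R p * dF2 n p + dchi n.+1%:R p * F2 n p => E.
  have i1 : intOmega (fun p => A1 p * (gphi p).1).
    by apply: (flux_integrable_L2 fl) => //; rewrite !inE eqxx.
  have i2 : intOmega (fun p => A2 p * (gphi p).2).
    by apply: (flux_integrable_L2 fl) => //; rewrite !inE eqxx ?orbT.
  have i12 : intOmega (fun p => A1 p * (gphi p).1 + A2 p * (gphi p).2).
    exact: integrableDR.
  have iB : intOmega (fun p => (B1 p + B2 p) * `|phi p|).
    have j1 : intOmega (fun p => B1 p * phi p).
      by apply: (flux_integrable_L2 fl) => //; rewrite !inE eqxx ?orbT.
    have j2 : intOmega (fun p => B2 p * phi p).
      by apply: (flux_integrable_L2 fl) => //; rewrite !inE eqxx ?orbT.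
    have mB : measOmega (fun p => (B1 p + B2 p) * `|phi p|).
      apply: measurable_funM => //; apply: measurable_funD; first exact: measurable_funM.
      by apply: measurable_funD; exact: measurable_funM.
    apply: (le_integrableR mO mB _ (integrable_normR mO (integrableDR mO j1 j2))).
    by move=> p _; rewrite -mulrDl !normrM normr_id.
  have mBB : measOmega (fun p => B1 p + B2 p).
    apply: measurable_funD; first exact: measurable_funM.
    by apply: measurable_funD; exact: measurable_funM.
  have -> : 0 = \int[leb2]_(p in Omega)
      (A1 p * (gphi p).1 + A2 p * (gphi p).2 + (B1 p + B2 p) * `|phi p|).
    by rewrite RintegralD// E -(ae_eq_RintegralM mBB mphi phi0) addNr.
  apply: le_Rintegral => //; first exact: integrableDR.
  move=> p Op; rewrite /h -[X in _ <= X]addrA lerD// mulrA -mulNr -mulrDl ler_wpM2r//.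
  have := div n p Op; have := chi_ge0 n.+1%:R p; have := ler_norm (dchi n.+1%:R p * F2 n p).
  rewrite /B1 /B2; move: (chi _ _) (dF1 n p) (dF2 n p) (dchi _ _ * _) (`|_|) => c a b q r.
  nra.
have lim := Rdominated_cvg mO mh mhl ch iD hD.
have ihl : intOmega hl.
  apply: (le_integrableR mO mhl _ iD) => p Op.
  by apply: (cvgr_to_le (cvg_norm (ch p Op))); apply: nearW => n; exact: hD.
have hl0 : 0 <= \int[leb2]_(p in Omega) hl p.
  by apply: (cvgr_to_ge lim); exact: nearW.
have iaphi : intOmega (fun p => mu * `|phi p|).
  by apply: integrableZR => //; exact: integrable_normR.
have iG : intOmega (fun p => G1 p * (gphi p).1 + G2 p * (gphi p).2).
  have := integrableDR mO ihl iaphi.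
  by apply: eq_integrable => // p _ /=; rewrite /hl subrK.
rewrite (EFin_Rintegral mO iphi) (EFin_Rintegral mO iG) -EFinM lee_fin -subr_ge0.
rewrite (_ : _ - _ = \int[leb2]_(p in Omega) hl p)// /hl RintegralB//; congr (_ - _).
rewrite -RintegralZl//.
rewrite (ae_eq_RintegralM (f := cst mu))//.
Qed.

End DivergenceInequality.

(** * Membership in the space X *)

Section SobolevApproximation.
Context {R : realType}.
Implicit Types (p : R * R) (f : R * R -> R).

Lemma compact_below (A : set (R * R)) : compact A ->
  exists2 M, 0 <= M & forall p, A p -> - M <= p.2.
Proof.
move=> /compact_bounded[K [_ hK]].
exists (`|K| + 1) => [|p Ap]; first by rewrite addr_ge0.
have h : K < `|K| + 1 by rewrite (le_lt_trans (ler_norm _))// ltrDl.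
have := hK _ h p Ap; rewrite /= prod_normE ge_max => /andP[_].
by rewrite ler_norml => /andP[].
Qed.

Lemma is_derive0_near (v : R * R) f p : (\forall q \near p, f q = 0) -> is_derive p v f 0.
Proof.
move=> h; apply: (@near_eq_is_derive _ _ _ (cst (0 : R))).
by apply: filterS h => q ->.
Qed.

Lemma test_function_flux psi : test_function psi -> exists M C,
  flux M C psi (cst 0) (fun p => 'D_ey psi p) (cst 0) /\
  flux M C (cst 0) psi (cst 0) (fun p => 'D_ez psi p).
Proof.
move=> [Cpsi cs sO]; have [c cy cz dy dz] := Ck1_slices (Cpsi 1%N).
have [M M0 hM] := compact_below cs.
have out p : ~ tsupport psi p -> \forall q \near p, psi q = 0.
  move=> np; have oC : open (~` tsupport psi) by apply: closed_openC; exact: closed_closure.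
  have := open_nbhs_nbhs (conj oC np); apply: filterS => q nq.
  by apply/eqP/negPn/negP => q0; apply: nq; exact: subset_closure.
have supp p : p.2 < - M -> [/\ psi p = 0, 'D_ey psi p = 0 & 'D_ez psi p = 0].
  move=> pM; have np : ~ tsupport psi p by move=> /hM; rewrite leNgt pM.
  have h := out p np; split; first exact: nbhs_singleton h.
    by have := is_derive0_near (ey : R * R) h => -[_].
  by have := is_derive0_near (ez : R * R) h => -[_].
have top (y : R) : psi (y, 0) = 0.
  apply: (nbhs_singleton (out (y, 0) _)) => /sO[_] /=; rewrite ltxx; exact: notF.
have bnd f : continuous f -> (forall p, p.2 < - M -> f p = 0) ->
    exists2 C, 0 <= C & forall p, -1 <= p.1 <= 1 -> p.2 < 0 -> `|f p| <= C.
  move=> cf f0; have [C C0 hC] := continuous_bounded_box (a := 0) (M := M) (fun p _ _ => cf p).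
  exists C => // p p1 p2; have [pM|Mp] := ltP p.2 (- M); first by rewrite f0// normr0.
  by rewrite hC// Mp ltW.
have [C1 C10 h1] := bnd psi c (fun p h => let: And3 a _ _ := supp p h in a).
have [C2 C20 h2] := bnd _ cy (fun p h => let: And3 _ a _ := supp p h in a).
have [C3 C30 h3] := bnd _ cz (fun p h => let: And3 _ _ a := supp p h in a).
have mm f : continuous f -> measurable_fun (lower : set (plane R)) f.
  by move=> cf; apply: measurable_funTS; exact: continuous_measurable_plane.
have m0 : measurable_fun (lower : set (plane R)) (cst (0 : R)) by exact: measurable_cst.
have c0 (x : R) : {for x, continuous (cst (0 : R))} by exact: cst_continuous.
have sum3 (x1 x2 : R) : x1 <= C1 -> x2 <= C2 + C3 -> [/\ x1 <= C1 + C2 + C3,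
    0 <= C1 + C2 + C3 & x2 <= C1 + C2 + C3] by split; lra.
exists M, (C1 + C2 + C3); split; split.
- exact: M0.
- exact: mm.
- exact: m0.
- exact: mm.
- exact: m0.
- move=> p p1 p2; have k2 : `|'D_ey psi p| <= C2 + C3 by rewrite (le_trans (h2 p p1 p2))// lerDl.
  by have [? ? ?] := sum3 _ _ (h1 p p1 p2) k2; rewrite /cst normr0.
- by move=> p /supp[].
- by [].
- by move=> y z _ _; exact: dy.
- by move=> y z _ _; apply: (@continuous_slice_y _ (fun p => 'D_ey psi p) y z); exact: cy.
- by move=> y z _ _; exact: is_derive_cst.
- by move=> y z _ _; exact: c0.
- exact: M0.
- exact: m0.
- exact: mm.
- exact: m0.
- exact: mm.
- move=> p p1 p2; have k3 : `|'D_ez psi p| <= C2 + C3 by rewrite (le_trans (h3 p p1 p2))// lerDr.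
  by have [? ? ?] := sum3 _ _ (h1 p p1 p2) k3; rewrite /cst normr0.
- by move=> p /supp[].
- by move=> y _; exact: top.
- by move=> y z _ _; exact: is_derive_cst.
- by move=> y z _ _; exact: c0.
- by move=> y z _ _; exact: dz.
- by move=> y z _ _; apply: (@continuous_slice_z _ (fun p => 'D_ez psi p) y z); exact: cz.
Qed.

Lemma weak_gradient_of_trace0 (u : R * R -> R) (g : R * R -> R * R) : inL2 u ->
  inL2 (fun p => (g p).1) -> inL2 (fun p => (g p).2) ->
  lateral_trace u g (cst 0) (cst 0) -> weak_gradient u g.
Proof.
move=> Lu L1 L2 tr psi /test_function_flux[M [C [fy fz]]].
have mO := @measurable_Omega R.
have key (w w' : R * R -> R) : intOmega (fun p => w p * psi p) ->
    intOmega (fun p => w' p * u p) ->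
    (\int[leb2]_(p in Omega) (w p * psi p) = - \int[leb2]_(p in Omega) (w' p * u p)) ->
    (\int[leb2]_(p in Omega) (u p * w' p)%:E = - \int[leb2]_(p in Omega) (w p * psi p)%:E)%E.
  move=> i1 i2 E; rewrite (EFin_Rintegral mO i1) E EFinN oppeK -(EFin_Rintegral mO i2).
  by apply: eq_integral => p _; rewrite mulrC.
split.
- apply: key.
  + have : intOmega (fun p => psi p * (g p).1).
      by apply: (flux_integrable_L2 fy) => //; rewrite inE eqxx.
    by apply: eq_integrable => // p _ /=; rewrite mulrC.
  + by apply: (flux_integrable_L2 fy) => //; rewrite !inE eqxx ?orbT.
  + rewrite (_ : \int[leb2]_(p in Omega) ('D_ey psi p * u p) =
      \int[leb2]_(p in Omega) (('D_ey psi p + cst 0 p) * u p)); last first.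
      by apply: eq_Rintegral => p _; rewrite addr0.
    rewrite -(flux_trace0 fy Lu L1 L2 tr); apply: eq_Rintegral => p _.
    by rewrite mul0r addr0 mulrC.
- apply: key.
  + have : intOmega (fun p => psi p * (g p).2).
      by apply: (flux_integrable_L2 fz) => //; rewrite !inE eqxx ?orbT.
    by apply: eq_integrable => // p _ /=; rewrite mulrC.
  + by apply: (flux_integrable_L2 fz) => //; rewrite !inE eqxx ?orbT.
  + rewrite (_ : \int[leb2]_(p in Omega) ('D_ez psi p * u p) =
      \int[leb2]_(p in Omega) ((cst 0 p + 'D_ez psi p) * u p)); last first.
      by apply: eq_Rintegral => p _; rewrite add0r.
    rewrite -(flux_trace0 fz Lu L1 L2 tr); apply: eq_Rintegral => p _.
    by rewrite mul0r add0r mulrC.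
Qed.

Lemma bsupp_cvg0 (f_ : nat -> R * R -> R) (M C : R) :
  (forall n, measOmega (f_ n)) ->
  (forall n p, Omega p -> `|f_ n p| <= C) ->
  (forall n p, Omega p -> p.2 < - M -> f_ n p = 0) ->
  (forall p, Omega p -> f_ n p @[n --> \oo] --> (0 : R)) ->
  (\int[leb2]_(p in Omega) (f_ n p)%:E @[n --> \oo] --> 0)%E.
Proof.
move=> mf fC f0 fc; have mO := @measurable_Omega R.
have mI : measurable (Omegab M : set (plane R)) by exact: measurable_Omegab.
pose g p := `|C| * \1_(Omegab M : set (plane R)) p.
have ig : intOmega g.
  apply: (@integrable_bsupp _ _ M `|C|).
  - exact: measurable_funM.
  - by move=> p _; rewrite /g indicE normrM normr_id normr_nat ler_piMr// lern1 leq_b1.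
  - by move=> p _ pM; rewrite /g indicE OmegabE (ltNge _ (- M)) in pM *;
      rewrite (negbTE pM) /= andbF mulr0.
have fg n p : Omega p -> `|f_ n p| <= g p.
  move=> Op; rewrite /g indicE OmegabE.
  have [-> ->] : -1 < p.1 < 1 /\ p.2 < 0 := Op; rewrite andbT /=.
  case: (leP (- M) p.2) => [_|h]; last by rewrite f0// normr0 mulr0.
  by rewrite mulr1 (le_trans (fC n p Op))// ler_norm.
have ifn n : intOmega (f_ n) by apply: (le_integrableR mO (mf n) (fg n)).
have := Rdominated_cvg mO mf (measurable_cst (0 : R)) fc ig fg.
rewrite Rintegral_cst// mul0r => h.
under eq_fun do rewrite (EFin_Rintegral mO (ifn _)).
by apply: cvg_EFin => //; exact: nearW.
Qed.

End SobolevApproximation.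

(** * Compactly supported approximants *)

Section SobolevConstruction.
Context {R : realType}.
Implicit Types (p : R * R) (f : R * R -> R).

Lemma is_derive_cutoff_comp f p v (d : R) : is_derive p v f d ->
  is_derive p v (fun q => cutoff (f q)) (dcutoff (f p) * d).
Proof. exact: is_derive_dir_comp (is_derive_cutoff _). Qed.

Lemma continuous_cutoff_comp f : continuous f ->
  continuous (fun q => cutoff (f q)) /\ continuous (fun q => dcutoff (f q)).
Proof.
move=> cf; split=> p.
  have h : cutoff t @[t --> f p] --> cutoff (f p).
    exact: is_derive_continuous (is_derive_cutoff _).
  exact: (cvg_comp _ _ (cf p) h).
exact: (cvg_comp _ _ (cf p) (@continuous_dcutoff _ (f p))).
Qed.

(** Approximants must have compact support in the whole plane while the functions at hand are
    regular only for |y| < b: the cutoff in y takes place between 1 and b, so that on the closed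
    half-strip nothing but [chi] acts. *)
Lemma box_cutoff (b M : R) : 1 < b -> 0 < M -> exists b' (eta etay etaz : R * R -> R),
  [/\ 1 < b' < b, continuous eta /\ continuous etay /\ continuous etaz,
   (forall p, is_derive p (ey : R * R) eta (etay p) /\ is_derive p (ez : R * R) eta (etaz p)),
   (forall p, b' <= `|p.1| \/ 1 <= p.2 \/ p.2 <= - (2 * M) -> eta p = 0) &
   (forall p, `|p.1| <= 1 -> p.2 <= 0 ->
      [/\ eta p = chi M p, etay p = 0 & etaz p = dchi M p])].
Proof.
move=> b1 M0; pose b' := (1 + b) / 2.
have bb : 1 < b' < b by rewrite /b'; apply/andP; split; lra.
have [b'1 b'b] := andP bb.
pose s := b' ^+ 2 - 1; have s0 : 0 < s by rewrite /s; nra.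
(* The argument of [cutoff] is 1 at |y| = 1 and 2 at |y| = b'; y^2 is used instead of |y| for
   smoothness. *)
pose h1 p := 1 + (p.1 ^+ 2 - 1) / s : R; pose h2 p := p.2 + 1 : R.
pose h3 p := - p.2 / M : R.
have c1 : continuous h1.
  move=> p; apply: cvgD; first exact: cvg_cst.
  apply: cvgMl; apply: cvgB; last exact: cvg_cst.
  by apply: cvg_exprn; exact: cvg_fst.
have c2 : continuous h2 by move=> p; apply: cvgD; [exact: cvg_snd|exact: cvg_cst].
have c3 : continuous h3 by move=> p; apply: cvgMl; apply: cvgN; exact: cvg_snd.
have d1 p v : is_derive p v h1 (2 * p.1 * v.1 / s).
  have d := is_derive_fst p v.
  by rewrite /h1; apply: is_derive_eq; rewrite /GRing.scale /=; field; rewrite gt_eqF.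
have d2 p v : is_derive p v h2 v.2.
  by have d := is_derive_snd p v; rewrite /h2; apply: is_derive_eq; rewrite addr0.
have d3 p v : is_derive p v h3 (- v.2 / M).
  have d := is_derive_snd p v.
  by rewrite /h3; apply: is_derive_eq; rewrite /GRing.scale /=; ring.
have [cc1 cd1] := continuous_cutoff_comp c1.
have [cc2 cd2] := continuous_cutoff_comp c2.
have [cc3 cd3] := continuous_cutoff_comp c3.
pose eta p := cutoff (h1 p) * cutoff (h2 p) * cutoff (h3 p).
pose deta (v : R * R) p := dcutoff (h1 p) * (2 * p.1 * v.1 / s) * cutoff (h2 p) * cutoff (h3 p)
  + cutoff (h1 p) * (dcutoff (h2 p) * v.2) * cutoff (h3 p)
  + cutoff (h1 p) * cutoff (h2 p) * (dcutoff (h3 p) * (- v.2 / M)).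
exists b', eta, (deta ey), (deta ez).
have ceta : continuous eta by move=> p; apply: cvgM; [apply: cvgM|]; [exact: cc1|exact: cc2|exact: cc3].
have cdeta v : continuous (deta v).
  have cp1 p : (2 * q.1 * v.1 / s) @[q --> p] --> 2 * p.1 * v.1 / s.
    by apply: cvgMl; apply: cvgMl; apply: cvgMr; exact: cvg_fst.
  move=> p; apply: cvgD; [apply: cvgD|].
  - apply: cvgM; last exact: cc3.
    by apply: cvgM; [apply: cvgM; [exact: cd1|exact: cp1]|exact: cc2].
  - apply: cvgM; last exact: cc3.
    by apply: cvgM; [exact: cc1|apply: cvgMl; exact: cd2].
  - apply: cvgM; last by apply: cvgMl; exact: cd3.
    by apply: cvgM; [exact: cc1|exact: cc2].
have deriv v p : is_derive p v eta (deta v p).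
  have e1 := is_derive_cutoff_comp (d1 p v); have e2 := is_derive_cutoff_comp (d2 p v).
  have e3 := is_derive_cutoff_comp (d3 p v).
  by rewrite /eta /deta; apply: is_derive_eq; rewrite /GRing.scale /=; ring.
split => //.
- move=> p [py|[pz|pz]]; rewrite /eta.
  + have h : 2 <= h1 p.
      have : b' ^+ 2 <= p.1 ^+ 2 by rewrite -(real_normK (num_real p.1)); nra.
      rewrite /h1 => h; have : 1 <= (p.1 ^+ 2 - 1) / s by rewrite ler_pdivlMr// /s; lra.
      lra.
    by have [-> _] := cutoff0 h; rewrite !mul0r.
  + have h : 2 <= h2 p by rewrite /h2; lra.
    by have [-> _] := cutoff0 h; rewrite mulr0 mul0r.
  + have h : 2 <= h3 p by rewrite /h3 ler_pdivlMr//; lra.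
    by have [-> _] := cutoff0 h; rewrite mulr0.
- move=> p py pz.
  have k1 : h1 p <= 1.
    have : p.1 ^+ 2 <= 1 by rewrite -(real_normK (num_real p.1)); have := normr_ge0 p.1; nra.
    move=> h; have : (p.1 ^+ 2 - 1) / s <= 0 by rewrite pmulr_lle0 ?invr_gt0//; lra.
    by rewrite /h1; lra.
  have k2 : h2 p <= 1 by rewrite /h2; lra.
  have [a1 b1'] := cutoff1 k1; have [a2 b2] := cutoff1 k2.
  rewrite /eta /deta a1 b1' a2 b2 /chi /dchi -/(h3 p) /ey /ez /=.
  by split; ring.
Qed.

Section Approximants.
Variables (b M C : R) (W Wy Wz : nat -> R * R -> R) (U : R * R -> R) (g : R * R -> R * R).
Hypotheses (b1 : 1 < b) (M0 : 0 < M).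
Hypothesis dW : forall n p, `|p.1| < b ->
  is_derive p (ey : R * R) (W n) (Wy n p) /\ is_derive p (ez : R * R) (W n) (Wz n p).
Hypothesis cW : forall n p, `|p.1| < b ->
  [/\ {for p, continuous (W n)}, {for p, continuous (Wy n)} & {for p, continuous (Wz n)}].
Hypothesis bW : forall n p, `|p.1| <= 1 -> p.2 < 0 ->
  [/\ `|W n p| <= C, `|Wy n p| <= C & `|Wz n p| <= C].
Hypothesis W1 : forall n z, z < 0 -> W n (1, z) = 0 /\ W n (-1, z) = 0.
Hypothesis WU : forall p, Omega p ->
  [/\ W n p @[n --> \oo] --> U p, Wy n p @[n --> \oo] --> (g p).1 &
      Wz n p @[n --> \oo] --> (g p).2].
Hypothesis U0 : forall p, Omega p -> p.2 < - M -> U p = 0 /\ g p = (0, 0).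

Let mO := @measurable_Omega R.

Let Ob p : Omega p -> `|p.1| < b.
Proof. by move=> /Omega_bounds[h _]; rewrite (le_lt_trans h). Qed.

Let mW n : [/\ measOmega (W n),
  measOmega (Wy n) &
  measOmega (Wz n)].
Proof. by split; apply: continuous_measurable_Omega => p /Ob /(cW n)[]. Qed.

Let mU : [/\ measOmega U,
  measOmega (fun p => (g p).1) &
  measOmega (fun p => (g p).2)].
Proof.
split.
- by apply: (@measurable_fun_cvg _ _ _ _ W) => [n|p /WU[]//]; have [] := mW n.
- by apply: (@measurable_fun_cvg _ _ _ _ Wy) => [n|p /WU[]//]; have [] := mW n.
- by apply: (@measurable_fun_cvg _ _ _ _ Wz) => [n|p /WU[]//]; have [] := mW n.
Qed.

Let bU p : Omega p -> [/\ `|U p| <= C, `|(g p).1| <= C & `|(g p).2| <= C].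
Proof.
move=> Op; have [h1 h2] := Omega_bounds Op; have [c1 c2 c3] := WU Op.
by split; [apply: (cvgr_to_le (cvg_norm c1))|apply: (cvgr_to_le (cvg_norm c2))|
  apply: (cvgr_to_le (cvg_norm c3))]; apply: nearW => n; have [] := bW n h1 h2.
Qed.

Let L2_bsupp f : measOmega f ->
  (forall p, Omega p -> `|f p| <= C) -> (forall p, Omega p -> p.2 < - M -> f p = 0) ->
  inL2 f.
Proof.
move=> mf fC f0; split=> //; apply: (@integrable_bsupp _ _ M (C * C)).
- exact: measurable_funX.
- by move=> p Op; rewrite normrX expr2 ler_pM// fC.
- by move=> p Op pM; rewrite f0// expr0n.
Qed.

Let zint f : measOmega f ->
  (forall p, Omega p -> `|f p| <= C) -> (forall p, Omega p -> p.2 < - M -> f p = 0) ->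
  intOmega (fun p => p.2 * f p).
Proof.
move=> mf fC f0; apply: (@integrable_bsupp _ _ M (M * C)).
- by apply: measurable_funM => //; exact: measurable_funTS measurable_snd.
- move=> p Op; have [_ p2] := Omega_bounds Op.
  have [pM|Mp] := ltP p.2 (- M).
    by rewrite f0// mulr0 normr0 mulr_ge0 ?(ltW M0)// (le_trans _ (fC p Op)).
  by rewrite normrM ler_pM// ?fC// ltr0_norm// lerNl.
- by move=> p Op pM; rewrite f0// mulr0.
Qed.

(** [eta] times [W n] vanishes on both sides for z < 0, so its traces are 0 for every n and not
    merely in the limit. *)
Let trace0 : lateral_trace U g (cst 0) (cst 0).
Proof.
have [b' [eta [etay [etaz [/andP[b'1 b'b] [ce [cey cez]] de e0 eO]]]]] := box_cutoff b1 M0.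
pose v n p := eta p * W n p.
pose vy n p := etay p * W n p + eta p * Wy n p.
pose vz n p := etaz p * W n p + eta p * Wz n p.
have far p : b' < `|p.1| -> \forall q \near p, eta q = 0.
  move=> h; have c : `|q.1| @[q --> p] --> `|p.1| by apply: cvg_norm; exact: cvg_fst.
  near=> q; apply: e0; left; rewrite ltW//; near: q; exact: (cvgr_gt _ c _ h).
have far' p : b' < `|p.1| -> \forall q \near p, etay q = 0 /\ etaz q = 0.
  move=> h; have c : `|q.1| @[q --> p] --> `|p.1| by apply: cvg_norm; exact: cvg_fst.
  near=> q; have hq : b' < `|q.1| by near: q; exact: (cvgr_gt _ c _ h).
  have [d1 d2] := de q; have n0 := far q hq.
  have uniq w d : is_derive q w eta d -> d = 0.
    by move=> [_ <-]; have [_ ->] := is_derive0_near w n0.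
  by split; [exact: uniq d1|exact: uniq d2].
have near0 (f : R * R -> R) p : (\forall q \near p, f q = 0) -> {for p, continuous f}.
  move=> h; rewrite /prop_for /continuous_at (nbhs_singleton h).
  by apply: cvg_near_cst.
have cv n : continuous (v n).
  move=> p; have [pb|bp] := ltP `|p.1| b.
    by have [c _ _] := cW n pb; apply: cvgM; [exact: ce|exact: c].
  apply: near0; have := far p (lt_le_trans b'b bp).
  by apply: filterS => q; rewrite /v => ->; rewrite mul0r.
have cvy n : continuous (vy n).
  move=> p; have [pb|bp] := ltP `|p.1| b.
    have [c cy _] := cW n pb.
    by apply: cvgD; apply: cvgM; [exact: cey|exact: c|exact: ce|exact: cy].
  apply: near0; have := far p (lt_le_trans b'b bp).
  have := far' p (lt_le_trans b'b bp).
  by apply: filterS2 => q [h _]; rewrite /vy h => ->; rewrite !mul0r addr0.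
have cvz n : continuous (vz n).
  move=> p; have [pb|bp] := ltP `|p.1| b.
    have [c _ cz] := cW n pb.
    by apply: cvgD; apply: cvgM; [exact: cez|exact: c|exact: ce|exact: cz].
  apply: near0; have := far p (lt_le_trans b'b bp).
  have := far' p (lt_le_trans b'b bp).
  by apply: filterS2 => q [_ h]; rewrite /vz h => ->; rewrite !mul0r addr0.
have dv n p : is_derive p (ey : R * R) (v n) (vy n p) /\ is_derive p (ez : R * R) (v n) (vz n p).
  have [pb|bp] := ltP `|p.1| b.
    have [h1 h2] := dW n pb; have [k1 k2] := de p.
    by split; rewrite /v; apply: is_derive_eq; rewrite /vy /vz /GRing.scale /=; ring.
  have n0 := far p (lt_le_trans b'b bp).
  have n0' : \forall q \near p, v n q = 0.
    by apply: filterS n0 => q; rewrite /v => ->; rewrite mul0r.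
  have [E1 E2] := nbhs_singleton (far' p (lt_le_trans b'b bp)).
  have E0 := nbhs_singleton n0.
  by rewrite /vy /vz E0 E1 E2 !mul0r addr0; split; exact: is_derive0_near.
have CkP n : [/\ Ck 1 (v n), (fun p => 'D_ey (v n) p) = vy n & (fun p => 'D_ez (v n) p) = vz n].
  apply: Ck1P; [exact: cv|exact: cvy|exact: cvz| |].
  - by move=> y z; apply/is_derive_ey; have [] := dv n (y, z).
  - by move=> y z; apply/is_derive_ez; have [] := dv n (y, z).
have Dy n p : 'D_ey (v n) p = vy n p by have [_ <- _] := CkP n.
have Dz n p : 'D_ez (v n) p = vz n p by have [_ _ <-] := CkP n.
have vO n p : Omega p -> [/\ v n p = chi M p * W n p, vy n p = chi M p * Wy n p &
    vz n p = dchi M p * W n p + chi M p * Wz n p].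
  move=> /Omega_bounds[p1 p2]; have [e1 e2 e3] := eO p p1 (ltW p2).
  by rewrite /v /vy /vz e1 e2 e3 mul0r add0r.
have lt2 p : p.2 < - (2 * M) -> p.2 < - M.
  by move=> h; apply: (lt_trans h); rewrite ltrN2 ltr_pMl// ltr1n.
have mv n : measOmega (v n) by apply: continuous_measurable_Omega => p _; exact: cv.
have mvy n : measOmega (vy n) by apply: continuous_measurable_Omega => p _; exact: cvy.
have mvz n : measOmega (vz n) by apply: continuous_measurable_Omega => p _; exact: cvz.
have cchi (p : R * R) (w : R) : `|w| <= C -> `|chi M p * w| <= C.
  by move=> wC; rewrite normrM (le_trans _ wC)// ler_piMl// norm_chi.
exists v; split.
- move=> n; split; first by have [] := CkP n.
  have cpt : compact (`[- b', b'] `*` `[- (2 * M), 1] : set (R * R)).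
    by apply: compact_setX; exact: segment_compact.
  apply: (subclosed_compact _ cpt); first exact: closed_closure.
  have ccl := compact_closed (@norm_hausdorff _ _) cpt.
  rewrite [X in _ `<=` X](closure_id _).1//; apply: closureS => p /= vn0.
  have en0 : eta p <> 0 by move=> h; move: vn0; rewrite /v h mul0r eqxx.
  split; rewrite /= in_itv /=.
    by rewrite -ler_norml leNgt; apply/negP => h; apply: en0; apply: e0; left; exact: ltW.
  by apply/andP; split; rewrite leNgt; apply/negP => h; apply: en0; apply: e0; right;
    [right|left]; exact: ltW.
- apply: (@bsupp_cvg0 _ (fun n p => (v n p - U p) ^+ 2) (2 * M) (2 * C * (2 * C))).
  + by move=> n; apply: measurable_funX; apply: measurable_funB; [exact: mv|have [] := mU].
  + move=> n p Op; rewrite normrX expr2; suff h : `|v n p - U p| <= 2 * C by rewrite ler_pM.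
    have [-> _ _] := vO n p Op; have [u _ _] := bU Op; have [p1 p2] := Omega_bounds Op.
    have [w _ _] := bW n p1 p2; rewrite (le_trans (ler_normB _ _))//.
    by have := cchi p _ w; lra.
  + move=> n p Op pM; have [-> _ _] := vO n p Op; have [-> _] := U0 Op (lt2 p pM).
    by have [-> _] := chi0 M0 (ltW pM); rewrite mul0r subr0 expr0n.
  (* The limit chi U - U is 0 at every depth: above - M because [chi] is 1, below because [U]
     vanishes. *)
  + move=> p Op; have -> : (0 : R) = (chi M p * U p - U p) ^+ 2.
      have [pM|Mp] := ltP p.2 (- M); first by have [-> _] := U0 Op pM; rewrite mulr0 subr0 expr0n.
      by have [-> _] := chi1 M0 Mp; rewrite mul1r subrr expr0n.
    rewrite (_ : (fun n => _) = (fun n => (chi M p * W n p - U p) ^+ 2)); last first.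
      by apply/funext => n; have [-> _ _] := vO n p Op.
    apply: cvg_exprn; apply: cvgB; last exact: cvg_cst.
    by apply: cvgMr; have [] := WU Op.
- pose C' := 2 * C + 4 / M * C.
  under eq_fun do under eq_integral do rewrite Dy Dz.
  apply: (@bsupp_cvg0 _ (fun n p => (vy n p - (g p).1) ^+ 2 + (vz n p - (g p).2) ^+ 2)
    (2 * M) (C' * C' + C' * C')).
  + move=> n; have [_ mg1 mg2] := mU.
    by apply: measurable_funD; apply: measurable_funX; exact: measurable_funB.
  + move=> n p Op; have [_ -> ->] := vO n p Op; have [_ u1 u2] := bU Op.
    have [p1 p2] := Omega_bounds Op; have [w w1 w2] := bW n p1 p2.
    have C0 : 0 <= C by rewrite (le_trans _ w).
    have q1 := cchi p _ w1; have q2 := cchi p _ w2.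
    have q3 : `|dchi M p * W n p| <= 4 / M * C by rewrite normrM ler_pM// norm_dchi.
    have M4 : 0 <= 4 / M * C by rewrite mulr_ge0// divr_ge0// ltW.
    have h1 : `|chi M p * Wy n p - (g p).1| <= C'.
      by rewrite (le_trans (ler_normB _ _))// /C'; lra.
    have h2 : `|dchi M p * W n p + chi M p * Wz n p - (g p).2| <= C'.
      rewrite (le_trans (ler_normB _ _))// (le_trans (lerD (ler_normD _ _) (lexx _)))//.
      by rewrite /C'; lra.
    by rewrite (le_trans (ler_normD _ _))// !normrX !expr2 lerD// ler_pM.
  + move=> n p Op pM; have [_ -> ->] := vO n p Op; have [_ ->] := U0 Op (lt2 p pM).
    by have [-> ->] := chi0 M0 (ltW pM); rewrite !mul0r addr0 subr0 expr0n addr0.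
  + move=> p Op; have [c c1 c2] := WU Op.
    have -> : (0 : R) = (chi M p * (g p).1 - (g p).1) ^+ 2 +
        (dchi M p * U p + chi M p * (g p).2 - (g p).2) ^+ 2.
      have [pM|Mp] := ltP p.2 (- M).
        by have [-> ->] := U0 Op pM; rewrite !mulr0 addr0 subr0 expr0n addr0.
      by have [-> ->] := chi1 M0 Mp; rewrite !mul1r mul0r add0r !subrr expr0n addr0.
    rewrite (_ : (fun n => _) = (fun n => (chi M p * Wy n p - (g p).1) ^+ 2 +
        (dchi M p * W n p + chi M p * Wz n p - (g p).2) ^+ 2)); last first.
      by apply/funext => n; have [_ -> ->] := vO n p Op.
    apply: cvgD; apply: cvg_exprn; apply: cvgB; try exact: cvg_cst.
      by apply: cvgMr.
    by apply: cvgD; apply: cvgMr.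
- apply: cvg_near_cst; apply: nearW => n; apply: integral0_eq => z.
  rewrite /= in_itv /= => z0; have [_ h] := W1 n z0.
  by rewrite /v h mulr0 subr0 expr0n.
- apply: cvg_near_cst; apply: nearW => n; apply: integral0_eq => z.
  rewrite /= in_itv /= => z0; have [h _] := W1 n z0.
  by rewrite /v h mulr0 subr0 expr0n.
Unshelve. all: by end_near. Qed.

Lemma calX_of_approximants : calX U g.
Proof.
have [mu m1 m2] := mU.
have bu p : Omega p -> `|U p| <= C by move=> /bU[].
have bg1 p : Omega p -> `|(g p).1| <= C by move=> /bU[].
have bg2 p : Omega p -> `|(g p).2| <= C by move=> /bU[].
have z p : Omega p -> p.2 < - M -> U p = 0 by move=> Op /(U0 Op)[].
have z1 p : Omega p -> p.2 < - M -> (g p).1 = 0 by move=> Op /(U0 Op)[_ ->].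
have z2 p : Omega p -> p.2 < - M -> (g p).2 = 0 by move=> Op /(U0 Op)[_ ->].
have [L L1 L2] : [/\ inL2 U, inL2 (fun p => (g p).1) & inL2 (fun p => (g p).2)].
  by split; exact: L2_bsupp.
split; [|exact: trace0|exact: zint|exact: zint].
by split => //; apply: weak_gradient_of_trace0 => //; exact: trace0.
Qed.

End Approximants.

End SobolevConstruction.

(** * The regularised barrier and field *)

Section Fields.
Context {R : realType}.
(** From here on [lam] is lambda_1 and [mu] is lambda. [hb] says that the second barrier equals the
    maximum lam / 2 of the first on the level L = 1; [hth] is the choice of theta. *)
Variables (lam mu th b : R).
Hypotheses (lam1 : 1 < lam) (mu_lam : mu < lam) (th0 : 0 < th) (b1 : 1 < b).
Hypothesis hb : th * (b - 1) ^+ 2 = lam / 2.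
Hypothesis hth : 2 * th * (1 + (lam / kk lam) ^+ 2) = lam - mu.
Implicit Types (p v : R * R) (e y z : R).
Local Notation kk := (kk lam).
Local Notation T1 := (T1 lam).
Local Notation DD := (DD lam).
Local Notation ddD := (ddD lam).
Local Notation AA := (AA lam).
Local Notation YY := (YY lam).
Local Notation L := (LLx lam).
Let k0 := kk_gt0 lam1.
Let l0 : 0 < lam := lt_trans ltr01 lam1.

Definition al p : R := AA (p.1 / - p.2).
Definition sn p : R := sin (al p).
Definition cs p : R := cos (al p).
Definition Dp p : R := DD (al p).

Lemma al_inI p : inI (al p). Proof. exact: AA_inI. Qed.
Lemma Dp_gt0 p : 0 < Dp p. Proof. by apply: DD_gt0 => //; exact: al_inI. Qed.
Lemma Dp_ge p : dmin lam <= Dp p. Proof. by apply: DD_ge => //; exact: al_inI. Qed.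
Lemma cs_ge0 p : 0 <= cs p. Proof. exact: inI_cos (al_inI p). Qed.
Lemma cs_le1 p : cs p <= 1. Proof. exact: cos_le1. Qed.
Lemma sn_cs p : sn p ^+ 2 = 1 - cs p ^+ 2. Proof. exact: sin2cos2. Qed.
Lemma sn_sqr_le1 p : sn p ^+ 2 <= 1. Proof. by rewrite sn_cs gerBl sqr_ge0. Qed.
Lemma norm_sn p : `|sn p| <= 1. Proof. by rewrite ler_norml sin_geN1 sin_le1. Qed.

Definition in_cone p : bool := (p.2 < 0) && (`|p.1 / - p.2| < T1).

Lemma in_coneE p : in_cone p = (p \in cone lam).
Proof.
case: p => y z; apply/idP/idP => [/andP[z0 h]|/(coneE lam1)[z0 h]].
  exact: coneP.
by rewrite /in_cone /= z0.
Qed.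

(** The second barrier, with the formula of u_2 kept below level 1 instead of an infinite value. The
    gradient of [vve] is [bet] times (- sn, cs), hence parallel to the cone field. *)
Definition vve e p : R := th * rr e (b - L p).
Definition vv p : R := th * pos (b - L p) ^+ 2.
Definition bet e p : R := th * drr e (b - L p) / (kk * Dp p).
Definition dif e p : R := u1 lam p - vve e p.
Definition HH e p : R := hh e (dif e p).
Definition WW e p : R := u1 lam p - mm e (dif e p).
Definition xx p : R := - p.2.
(** (K1, K2) is the regularised operator p + x p / |p| at the gradient of the second barrier minus
    its value at that of the first. *)
Definition K1 e p : R := lam * p.1 - bet e p * sn p + xx p * (sg e (sn p) - sn p).
Definition K2 e p : R := (bet e p + xx p) * cs p.
(* (F1, F2) = grad (WW e) + x q, where q mixes (- sg (sn), 0) and (- sn, cs) with weights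
   1 - HH and HH. *)
Definition F1 e p : R := - lam * p.1 - xx p * sg e (sn p) + HH e p * K1 e p.
Definition F2 e p : R := HH e p * K2 e p.

(** Derivatives along [v]. Those of the angle hold inside the cone, where [AA] is differentiable;
    outside it they are multiplied by quantities that vanish there, namely [HH], [dhh] or [cs]. *)
Definition dal v p : R := (v.1 * xx p + p.1 * v.2) / (xx p ^+ 2 * Dp p).
Definition dL v p : R := (sn p * v.1 - cs p * v.2) / (kk * Dp p).
Definition ddif e v p : R := - lam * p.1 * v.1 + bet e p * (sn p * v.1 - cs p * v.2).
Definition dWW e v p : R := - lam * p.1 * v.1 - HH e p * ddif e v p.
Definition dbet e v p : R :=
  th * (- ddrr e (b - L p) * dL v p / (kk * Dp p)
        - drr e (b - L p) * ddD (al p) * dal v p / (kk * Dp p ^+ 2)).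
Definition dHH e v p : R := dhh e (dif e p) * ddif e v p.
Definition dK1 e v p : R :=
  lam * v.1 - (dbet e v p * sn p + bet e p * cs p * dal v p)
  - v.2 * (sg e (sn p) - sn p) + xx p * ((dsg e (sn p) - 1) * cs p * dal v p).
Definition dK2 e v p : R :=
  (dbet e v p - v.2) * cs p - (bet e p + xx p) * sn p * dal v p.
Definition dF1 e v p : R :=
  - lam * v.1 + v.2 * sg e (sn p) - xx p * (dsg e (sn p) * cs p * dal v p)
  + (dHH e v p * K1 e p + HH e p * dK1 e v p).
Definition dF2 e v p : R := dHH e v p * K2 e p + HH e p * dK2 e v p.

Lemma u1_ge p : `|p.1| <= 1 -> 0 <= u1 lam p <= lam / 2.
Proof.
move=> h; have h2 : p.1 ^+ 2 <= 1.
  by rewrite -real_normK ?num_real// expr_le1.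
have := sqr_ge0 p.1; rewrite /u1; move: (p.1 ^+ 2) h2 => t h2 h3.
by have := l0 => ?; apply/andP; split; nra.
Qed.

Lemma vve_ge e p : 0 < e -> vv p <= vve e p.
Proof. by move=> e0; rewrite ler_wpM2l ?(ltW th0)// rr_ge. Qed.

Lemma vv_ge0 p : 0 <= vv p.
Proof. by rewrite mulr_ge0 ?(ltW th0)// sqr_ge0. Qed.

(* Below level 1 the barrier th (b - L)^2 exceeds lam / 2 >= u1, hence u1 wins. *)
Lemma vv_ge_u1 p : L p <= 1 \/ 1 <= `|p.1| -> u1 lam p <= vv p.
Proof.
have u1le (t : R) : 0 <= t -> lam / 2 * (1 - t) <= lam / 2 by have := l0; nra.
move=> [L1|y1].
  apply: (@le_trans _ _ (lam / 2)); first by rewrite /u1 u1le ?sqr_ge0.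
  rewrite -hb ler_wpM2l ?(ltW th0)// ler_pXn2r ?nnegrE ?pos_ge0 ?subr_ge0 ?(ltW b1)//.
  by apply: le_trans (pos_ge _); rewrite lerB.
apply: le_trans (vv_ge0 p).
have : 1 <= p.1 ^+ 2 by rewrite -real_normK ?num_real// expr_ge1.
by rewrite /u1; have := l0; move: (p.1 ^+ 2) => t; nra.
Qed.

Lemma dif_le0 e p : 0 < e -> L p <= 1 \/ 1 <= `|p.1| -> dif e p <= 0.
Proof.
by move=> e0 h; rewrite subr_le0; apply: le_trans (vve_ge _ e0); exact: vv_ge_u1.
Qed.

(* For z >= 0, L is nonpositive by the junk formula, so the same bound applies. *)
Lemma L_le p : - T1^-1 <= p.2 -> L p <= 1 \/ 1 <= `|p.1|.
Proof.
case: p => y z /= hz; have t0 := T1_gt0 lam1.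
have [z0|z0] := leP 0 z.
  left; apply: (@le_trans _ _ 0) => //.
  by rewrite /LLx /= mulNr oppr_le0 mulr_ge0// ltW// ell_gt0.
have x0 : 0 < - z by rewrite oppr_gt0.
rewrite /LLx /=; have [h|h] := leP `|y / - z| T1.
  left; apply: (@le_trans _ _ (- z * T1)).
    by rewrite ler_wpM2l ?(ltW x0)// ell_le_T1.
  by rewrite -ler_pdivlMr// mul1r lerNl.
rewrite ell_out ?(ltW h)// normrM normfV (gtr0_norm x0) mulrC divfK ?gt_eqF//.
by have [|/ltW] := leP `|y| 1; [left|right].
Qed.

Lemma L_out p : p.2 < 0 -> ~~ in_cone p -> L p = `|p.1|.
Proof.
case: p => y z /= z0; rewrite /in_cone z0 /= -leNgt => h.
have x0 : 0 < - z by rewrite oppr_gt0.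
by rewrite /LLx /= ell_out// normrM normfV (gtr0_norm x0) mulrC divfK ?gt_eqF.
Qed.

Lemma L_gt0 p : p.2 < 0 -> 0 < L p.
Proof. by move=> z0; rewrite mulr_gt0 ?oppr_gt0// ell_gt0. Qed.

Lemma cvg_tau p : p.2 < 0 -> (q.1 / - q.2) @[q --> p] --> p.1 / - p.2.
Proof.
move=> z0; apply: cvgM; first exact: cvg_fst.
apply: cvg_inv; first by rewrite oppr_eq0 lt_eqF.
by apply: cvgN; exact: cvg_snd.
Qed.

Lemma cvg_L p : p.2 < 0 -> L q @[q --> p] --> L p.
Proof.
move=> z0; apply: cvgM; first by apply: cvgN; exact: cvg_snd.
exact: (cvg_comp _ _ (cvg_tau z0) (@continuous_ell _ _ lam1 _)).
Qed.

Lemma cvg_al p : p.2 < 0 -> al q @[q --> p] --> al p.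
Proof.
by move=> z0; exact: (cvg_comp _ _ (cvg_tau z0) (@continuous_AA _ _ lam1 _)).
Qed.

Lemma cvg_u1 p : u1 lam q @[q --> p] --> u1 lam p.
Proof.
apply: cvgM; first exact: cvg_cst.
apply: cvgB; first exact: cvg_cst.
by apply: cvg_exprn; exact: cvg_fst.
Qed.

(** Outside the cone either z > - 1 / T1, and [L_le] applies to all nearby points, or |y| >= 1,
    where u_1 <= 0 < vv because |y| < b, a strict inequality that persists. Consequently [HH]
    vanishes near such points, and whatever it multiplies need only be differentiable inside the
    cone. *)
Lemma near_dif_le0 e p : 0 < e -> `|p.1| < b -> ~~ in_cone p ->
  \forall q \near p, dif e q <= 0.
Proof.
move=> e0 yb nc; have t0 := T1_gt0 lam1.
have [h|h] := ltP (- T1^-1) p.2.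
  have : \forall q \near p, - T1^-1 < q.2.
    have hs : q.2 @[q --> p] --> p.2 by exact: cvg_snd.
    exact: (cvgr_gt _ hs _ h).
  by apply: filterS => q /ltW hq; apply: dif_le0 => //; exact: L_le.
have z0 : p.2 < 0 by apply: le_lt_trans h _; rewrite oppr_lt0 invr_gt0.
have y1 : 1 <= `|p.1|.
  move: nc; rewrite /in_cone z0 /= -leNgt normrM normfV (gtr0_norm (_ : 0 < - p.2)) ?oppr_gt0//.
  rewrite ler_pdivlMr ?oppr_gt0//; apply: le_trans.
  by rewrite mulrC -ler_pdivrMr// mul1r lerNr.
have lt0 : u1 lam p < vv p.
  apply: (@le_lt_trans _ _ 0).
    have : 1 <= p.1 ^+ 2 by rewrite -real_normK ?num_real// expr_ge1.
    by rewrite /u1; have := l0; move: (p.1 ^+ 2) => t; nra.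
  rewrite /vv (L_out z0 nc) pos_id ?subr_ge0 ?(ltW yb)//.
  by rewrite mulr_gt0// exprn_gt0// subr_gt0.
have cv : vv q - u1 lam q @[q --> p] --> vv p - u1 lam p.
  apply: cvgB; last exact: cvg_u1.
  apply: cvgM; first exact: cvg_cst.
  apply: cvg_exprn; apply: cvg_pos; apply: cvgB; [exact: cvg_cst|exact: cvg_L].
rewrite -subr_gt0 in lt0.
have : \forall q \near p, 0 < vv q - u1 lam q by exact: (cvgr_gt _ cv _ lt0).
apply: filterS => q; rewrite subr_gt0 => /ltW hq.
by rewrite subr_le0 (le_trans hq)// vve_ge.
Qed.

(** * Derivatives of the barriers and of the fields *)

Section HalfPlaneDerivatives.
Variables (p v : R * R).
Hypothesis z0 : p.2 < 0.
Let x0 : xx p != 0. Proof. by rewrite /xx oppr_eq0 lt_eqF. Qed.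
Let D0 : Dp p != 0. Proof. by rewrite gt_eqF// Dp_gt0. Qed.

Lemma is_derive_xx : is_derive p v xx (- v.2).
Proof. by have := is_derive_snd p v => ?; rewrite /xx; apply: is_derive_eq. Qed.

Lemma is_derive_tau : is_derive p v (fun q => q.1 / - q.2)
  ((v.1 * xx p + p.1 * v.2) / xx p ^+ 2).
Proof.
have d1 := is_derive_fst p v; have d2 := is_derive_xx.
have d3 : is_derive p v (fun q => (xx q)^-1) (- xx p ^- 2 *: - v.2) by exact: is_derive_invf.
change (is_derive p v (fun q => q.1 * (xx q)^-1) ((v.1 * xx p + p.1 * v.2) / xx p ^+ 2)).
by apply: is_derive_eq; rewrite /GRing.scale /=; field.
Qed.

Lemma is_derive_sn : is_derive p v sn (cs p * dal v p).
Proof.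
have h := is_derive_dir_comp (is_derive_sinAA lam1 (p.1 / - p.2)) is_derive_tau.
rewrite /sn /al; apply: is_derive_eq; rewrite /dal -/(al p) -/(Dp p) -/(cs p); field.
by rewrite x0 D0.
Qed.

End HalfPlaneDerivatives.

Lemma is_derive_u1 p v : is_derive p v (u1 lam) (- lam * p.1 * v.1).
Proof.
have d1 := is_derive_fst p v; rewrite /u1; apply: is_derive_eq.
by rewrite /GRing.scale /=; field.
Qed.

Section ConeDerivatives.
Variables (e : R) (p v : R * R).
Hypotheses (e0 : 0 < e) (pc : in_cone p).

Let z0 : p.2 < 0. Proof. by case/andP: pc. Qed.
Let x0 : xx p != 0. Proof. by rewrite /xx oppr_eq0 lt_eqF. Qed.
Let D0 : Dp p != 0. Proof. by rewrite gt_eqF// Dp_gt0. Qed.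
Let kn : kk != 0. Proof. by rewrite gt_eqF. Qed.

Lemma tau_lt : `|p.1 / - p.2| < T1. Proof. by case/andP: pc. Qed.

Lemma is_derive_al : is_derive p v al (dal v p).
Proof.
have h := is_derive_dir_comp (is_derive_AA lam1 tau_lt) (is_derive_tau v z0).
rewrite /al; apply: is_derive_eq; rewrite /dal -/(al p) -/(Dp p); field.
by rewrite x0 D0.
Qed.

Lemma is_derive_cs : is_derive p v cs (- sn p * dal v p).
Proof. exact: is_derive_dir_comp (is_derive_cos _) is_derive_al. Qed.

Lemma is_derive_Dp : is_derive p v Dp (ddD (al p) * dal v p).
Proof.
apply: is_derive_dir_comp is_derive_al.
by apply: is_derive_DD => //; exact: cs_ge0.
Qed.

Lemma tauE : p.1 = xx p * (YY (al p) * (lam - cs p)).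
Proof.
have := TT_AA lam1 (p.1 / - p.2); rewrite clip_id ?(ltW tau_lt)// -/(al p) /TT -/(cs p) => ->.
by rewrite /xx mulrC divfK.
Qed.

Lemma LE : L p = xx p * ((lam - cs p) / kk).
Proof. by rewrite /LLx ell_in// ltW// tau_lt. Qed.

Lemma is_derive_L : is_derive p v L (dL v p).
Proof.
have d1 := is_derive_dir_comp (is_derive_ell lam1 tau_lt) (is_derive_tau v z0).
have d2 := is_derive_xx p v.
rewrite /LLx; apply: is_derive_eq; rewrite /GRing.scale /=.
have := LE; rewrite /LLx -/(xx p) => /(mulfI x0) ->.
rewrite -/(al p) -/(Dp p) -/(sn p) tauE /dL.
have lcn : lam - cs p != 0 by rewrite gt_eqF// lamB_gt0.
have DE : Dp p = cs p / (lam - cs p) + YY (al p) * sn p by [].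
apply/eqP; rewrite -subr_eq0; apply/eqP.
transitivity (v.2 * (lam - cs p) / (kk * Dp p) *
   (cs p / (lam - cs p) + YY (al p) * sn p - Dp p)); last by rewrite -DE subrr mulr0.
by field; rewrite x0 D0 kn lcn.
Qed.

Lemma is_derive_dif : is_derive p v (dif e) (ddif e v p).
Proof.
have dbL : is_derive p v (fun q => b - L q) (0 - dL v p).
  by have dl := is_derive_L; apply: is_derive_eq; rewrite !sub0r.
have dr := is_derive_dir_comp (is_derive_rr e0 (b - L p)) dbL.
have du := is_derive_u1 p v.
rewrite /dif /vve; apply: is_derive_eq; rewrite /GRing.scale /= /ddif /bet /dL; field.
by rewrite D0 kn.
Qed.

Lemma is_derive_bet : is_derive p v (bet e) (dbet e v p).
Proof.
have dbL : is_derive p v (fun q => b - L q) (0 - dL v p).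
  by have dl := is_derive_L; apply: is_derive_eq; rewrite !sub0r.
have dr := is_derive_dir_comp (is_derive_drr e0 (b - L p)) dbL.
have dD := is_derive_Dp.
have di : is_derive p v (fun q => (kk * Dp q)^-1) (- (kk * Dp p) ^- 2 *: (kk * (ddD (al p) * dal v p))).
  by apply: is_derive_invf; rewrite mulf_neq0.
change (is_derive p v (fun q => th * drr e (b - L q) * (kk * Dp q)^-1) (dbet e v p)).
apply: is_derive_eq; rewrite /GRing.scale /= /dbet; field.
by rewrite D0 kn.
Qed.

Lemma is_derive_HH_cone : is_derive p v (HH e) (dHH e v p).
Proof. exact: is_derive_dir_comp (is_derive_hh e0 _) is_derive_dif. Qed.

Hypothesis e1 : e <= 1.

Lemma is_derive_sgsn : is_derive p v (fun q => sg e (sn q)) (dsg e (sn p) * (cs p * dal v p)).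
Proof.
apply: is_derive_dir_comp (is_derive_sn v z0).
by apply: is_derive_sg => //; exact: sn_sqr_le1.
Qed.

Lemma is_derive_K1 : is_derive p v (K1 e) (dK1 e v p).
Proof.
have db := is_derive_bet; have ds := is_derive_sn v z0; have dx := is_derive_xx p v.
have dsg := is_derive_sgsn; have df := is_derive_fst p v.
by rewrite /K1; apply: is_derive_eq; rewrite /GRing.scale /= /dK1; ring.
Qed.

Lemma is_derive_K2 : is_derive p v (K2 e) (dK2 e v p).
Proof.
have db := is_derive_bet; have dc := is_derive_cs; have dx := is_derive_xx p v.
by rewrite /K2; apply: is_derive_eq; rewrite /GRing.scale /= /dK2; ring.
Qed.

End ConeDerivatives.

Section GlobalDerivatives.
Variables (e : R) (p v : R * R).
Hypotheses (e0 : 0 < e) (e1 : e <= 1) (yb : `|p.1| < b).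

Lemma dif_out : ~~ in_cone p -> dif e p <= 0.
Proof. by move=> nc; exact: nbhs_singleton (near_dif_le0 e0 yb nc). Qed.

Lemma HH_out : ~~ in_cone p -> HH e p = 0.
Proof. by move=> nc; rewrite /HH hh_le0// dif_out. Qed.

Lemma dHH_out : ~~ in_cone p -> dHH e v p = 0.
Proof. by move=> nc; rewrite /dHH dhh_le0 ?mul0r// dif_out. Qed.

Lemma is_derive_HHM (K dK : R * R -> R) : (in_cone p -> is_derive p v K (dK p)) ->
  is_derive p v (fun q => HH e q * K q) (dHH e v p * K p + HH e p * dK p).
Proof.
move=> hK; have [pc|nc] := boolP (in_cone p).
  have h1 := is_derive_HH_cone v e0 pc; have h2 := hK pc.
  by apply: is_derive_eq; rewrite /GRing.scale /=; ring.
rewrite HH_out// dHH_out// !mul0r addr0.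
apply: (@near_eq_is_derive _ _ _ (cst (0 : R))).
by apply: filterS (near_dif_le0 e0 yb nc) => q hq; rewrite /HH hh_le0 ?mul0r.
Qed.

Lemma is_derive_WW : is_derive p v (WW e) (dWW e v p).
Proof.
have du := is_derive_u1 p v.
have [pc|nc] := boolP (in_cone p).
  have h1 := is_derive_dir_comp (is_derive_mm e0 _) (is_derive_dif v e0 pc).
  by rewrite /WW; apply: is_derive_eq; rewrite /dWW /HH.
rewrite /dWW HH_out// mul0r subr0.
apply: (@near_eq_is_derive _ _ _ (u1 lam)) => //.
by apply: filterS (near_dif_le0 e0 yb nc) => q hq; rewrite /WW mm_le0 ?subr0.
Qed.

Lemma is_derive_F2 : is_derive p v (F2 e) (dF2 e v p).
Proof.
apply: (is_derive_HHM (K := K2 e) (dK := dK2 e v)) => pc.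
exact: is_derive_K2.
Qed.

Lemma is_derive_F1 : p.2 < 0 -> is_derive p v (F1 e) (dF1 e v p).
Proof.
move=> z0.
have h1 : is_derive p v (fun q => HH e q * K1 e q) (dHH e v p * K1 e p + HH e p * dK1 e v p).
  by apply: (is_derive_HHM (K := K1 e) (dK := dK1 e v)) => pc; exact: is_derive_K1.
have h2 : is_derive p v (fun q => sg e (sn q)) (dsg e (sn p) * (cs p * dal v p)).
  apply: is_derive_dir_comp (is_derive_sn v z0).
  by apply: is_derive_sg => //; exact: sn_sqr_le1.
have h3 := is_derive_xx p v; have h4 := is_derive_fst p v.
by rewrite /F1; apply: is_derive_eq; rewrite /GRing.scale /= /dF1; ring.
Qed.

End GlobalDerivatives.

(** * The divergence estimate *)

Section Divergence.
Variable e : R.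
Hypotheses (e0 : 0 < e) (e1 : e <= 1).

Lemma bet_ge0 p : 0 <= bet e p.
Proof.
apply: divr_ge0; apply: mulr_ge0; rewrite ?drr_ge0 ?(ltW th0) ?(ltW k0)//.
exact: ltW (Dp_gt0 p).
Qed.

Lemma cs_out p : p.2 < 0 -> ~~ in_cone p -> cs p = 0.
Proof. by move=> z0; rewrite /in_cone z0 /= -leNgt => h; exact: cosAA0. Qed.

Lemma Dp_sqr_bound p : 2 * th / (kk * Dp p) ^+ 2 <= lam - mu.
Proof.
have D0 := Dp_gt0 p; have hB := DD_bound lam1 (al_inI p).
rewrite -hth; apply: ler_wpM2l; first by rewrite mulr_ge0// ltW.
rewrite exprMn expr_div_n -[_^-1]mul1r ler_pdivrMr; last by rewrite mulr_gt0 ?exprn_gt0.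
apply: le_trans hB _; rewrite -/(Dp p) le_eqVlt; apply/orP; left; apply/eqP.
by field; rewrite gt_eqF.
Qed.

(** y and [sn] have the same sign and the regularised sign exceeds its argument in modulus;
    multiplying by sn^2 separates the two facts. *)
Lemma sg_sn_ge0 p : in_cone p -> 0 <= p.1 * (sg e (sn p) - sn p).
Proof.
move=> pc; have z0 : p.2 < 0 by case/andP: pc.
have ys : 0 <= p.1 * sn p.
  rewrite {1}(tauE pc) /xx.
  have -> : - p.2 * (YY (al p) * (lam - cs p)) * sn p =
     - p.2 * (YY (al p) * sn p) * (lam - cs p) by ring.
  rewrite mulr_ge0 ?(ltW (lamB_gt0 lam1 _))// mulr_ge0 ?oppr_ge0 ?(ltW z0)//.
  by rewrite (YYsin_ge0 lam1)// al_inI.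
have [s0|s0] := eqVneq (sn p) 0; first by rewrite s0 /sg mul0r subr0 mulr0.
have sp : 0 < sn p ^+ 2 by rewrite exprn_even_gt0.
rewrite -(pmulr_lge0 _ sp).
have -> : p.1 * (sg e (sn p) - sn p) * sn p ^+ 2 =
  (p.1 * sn p) * (sn p * sg e (sn p) - sn p ^+ 2) by ring.
by rewrite mulr_ge0// subr_ge0 sg_ge// sn_sqr_le1.
Qed.

(* Monotonicity of the regularised operator between the two barriers. *)
Lemma jump_le0 p : in_cone p ->
  ddif e ey p * K1 e p + ddif e ez p * K2 e p <= 0.
Proof.
move=> pc; have x0 : 0 <= xx p by case/andP: pc => /ltW z0 _; rewrite oppr_ge0.
have h1 := sg_sn_ge0 pc; have b0 := bet_ge0 p.
have h2 : sn p * sg e (sn p) <= 1.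
  apply: le_trans (ler_norm _) _; rewrite normrM mulr_ile1// ?norm_sn//.
  exact: sg_sqr_le1 (sn_sqr_le1 p).
(* The Laplacian yields minus the square of the difference of the two gradients; the part in [xx] is
   the monotonicity of p / |p|, with one nonnegative defect for each barrier. *)
have -> : ddif e ey p * K1 e p + ddif e ez p * K2 e p =
   - (lam * p.1 - bet e p * sn p) ^+ 2 - (bet e p * cs p) ^+ 2
   - xx p * (lam * (p.1 * (sg e (sn p) - sn p)) + bet e p * (1 - sn p * sg e (sn p))).
  have s2 := sn_cs p; rewrite /ddif /K1 /K2 /=.
  have -> : 1 - sn p * sg e (sn p) = sn p ^+ 2 + cs p ^+ 2 - sn p * sg e (sn p).
    by rewrite s2; ring.
  by ring.
rewrite -opprD -opprD oppr_le0 addr_ge0// ?addr_ge0 ?sqr_ge0//.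
rewrite mulr_ge0// addr_ge0// mulr_ge0// ?(ltW l0)//.
by rewrite subr_ge0.
Qed.

(** The profile makes the divergence of xx (- sn, cs) equal to - lam: this is [e1'], and it cancels
    the [lam] coming from u_1. There remain the derivative of the regularised sign, the second
    derivative of the square times theta |grad L|^2, and a nonpositive term. *)
Lemma divK p : in_cone p -> dK1 e ey p + dK2 e ez p =
  dsg e (sn p) * cs p / Dp p + (th * ddrr e (b - L p) / (kk * Dp p) ^+ 2
  - th * drr e (b - L p) * (lam - cs p) * (ddD (al p) ^+ 2 + Dp p ^+ 2) /
    (kk * xx p * Dp p ^+ 3)).
Proof.
move=> pc; have z0 : p.2 < 0 by case/andP: pc.
have xn : xx p != 0 by rewrite /xx oppr_eq0 lt_eqF.
have Dn : Dp p != 0 by rewrite gt_eqF// Dp_gt0.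
have kn : kk != 0 by rewrite gt_eqF.
have lcn : lam - cs p != 0 by rewrite gt_eqF// lamB_gt0.
have ty := tauE pc.
have e4 : xx p * dal ey p = (Dp p)^-1.
  by rewrite /dal /=; field; rewrite xn Dn.
have e1' : cs p * dal ey p + sn p * dal ez p = (lam - cs p) / xx p.
  have -> : (lam - cs p) / xx p = (lam - cs p) * Dp p / (xx p * Dp p).
    by field; rewrite xn Dn.
  have hD : (lam - cs p) * Dp p = cs p + sn p * (YY (al p) * (lam - cs p)).
    by rewrite /Dp /DD -/(cs p) -/(sn p); field.
  rewrite hD /dal /= ty; field.
  by rewrite xn Dn.
have e2 : cs p * dal ez p - sn p * dal ey p = ddD (al p) * (lam - cs p) / (xx p * Dp p).
  rewrite /ddD -/(cs p) -/(sn p) /dal /= ty; field.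
  by rewrite xn Dn lcn.
have e3 : cs p * dL ez p - sn p * dL ey p = - (kk * Dp p)^-1.
  have -> : - (kk * Dp p)^-1 = - (sn p ^+ 2 + cs p ^+ 2) / (kk * Dp p).
    by rewrite sn_cs subrK mulN1r.
  by rewrite /dL /=; field; rewrite kn Dn.
rewrite /dK1 /dK2 /=.
transitivity (lam - cs p + (dbet e ez p * cs p - dbet e ey p * sn p)
  - (bet e p + xx p) * (cs p * dal ey p + sn p * dal ez p)
  + dsg e (sn p) * cs p * (xx p * dal ey p)); first by ring.
have -> : dbet e ez p * cs p - dbet e ey p * sn p =
  th * (- ddrr e (b - L p) * (cs p * dL ez p - sn p * dL ey p) / (kk * Dp p)
   - drr e (b - L p) * ddD (al p) * (cs p * dal ez p - sn p * dal ey p) / (kk * Dp p ^+ 2)).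
  by rewrite /dbet; ring.
rewrite e1' e2 e3 e4 /bet; field.
by rewrite xn Dn kn.
Qed.

Lemma div_F_le p : Omega p -> dF1 e ey p + dF2 e ez p <= - mu.
Proof.
move=> [y1 z0].
have yb : `|p.1| < b by apply: lt_trans b1; rewrite ltr_norml.
have [pc|nc] := boolP (in_cone p); last first.
  rewrite /dF1 /dF2 HH_out// !dHH_out// (cs_out z0 nc) /= !mul0r !mulr0 !mul0r !mulr0.
  by have := mu_lam; lra.
have x0 : 0 < xx p by rewrite oppr_gt0.
have D0 := Dp_gt0 p.
have lc : 0 < lam - cs p by exact: lamB_gt0.
have J : dhh e (dif e p) * (ddif e ey p * K1 e p + ddif e ez p * K2 e p) <= 0.
  by rewrite mulr_ge0_le0 ?dhh_ge0 ?jump_le0.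
pose A := dsg e (sn p) * cs p / Dp p.
have A0 : 0 <= A.
  by rewrite divr_ge0 ?(ltW D0)// mulr_ge0 ?cs_ge0 ?dsg_ge0.
pose E := th * ddrr e (b - L p) / (kk * Dp p) ^+ 2
  - th * drr e (b - L p) * (lam - cs p) * (ddD (al p) ^+ 2 + Dp p ^+ 2) /
    (kk * xx p * Dp p ^+ 3).
have EM : E <= lam - mu.
  apply: le_trans (Dp_sqr_bound p).
  rewrite /E lerBlDr -[leLHS]addr0; apply: lerD.
    apply: ler_wpM2r; first by rewrite invr_ge0 sqr_ge0.
    by rewrite mulrC; apply: ler_wpM2r; [exact: ltW|exact: ddrr_le].
  rewrite divr_ge0//; last by rewrite !mulr_ge0 ?exprn_ge0 ?(ltW k0) ?(ltW x0) ?(ltW D0).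
  by rewrite mulr_ge0 ?addr_ge0 ?sqr_ge0// mulr_ge0 ?(ltW lc)// mulr_ge0 ?drr_ge0 ?(ltW th0).
(* With weight 1 - [HH] the divergence is - lam - A, with weight [HH] it is - lam + E; the last term
   comes from the variation of the weights. *)
have dE : dF1 e ey p + dF2 e ez p = - lam - A + HH e p * (A + E) +
    dhh e (dif e p) * (ddif e ey p * K1 e p + ddif e ez p * K2 e p).
  rewrite -(divK pc) /dF1 /dF2 /dHH /A.
  have e4 : xx p * (dsg e (sn p) * cs p * dal ey p) = dsg e (sn p) * cs p / Dp p.
    by rewrite /dal /=; field; rewrite !gt_eqF.
  by rewrite e4 /=; ring.
rewrite dE.
have H0 : 0 <= HH e p by exact: hh_ge0.
have H1 : HH e p <= 1 by exact: hh_le1.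
have HA : HH e p * A <= A by rewrite ler_piMl.
have HE : HH e p * E <= lam - mu.
  have [E0|E0] := leP 0 E; first by apply: le_trans EM; rewrite ler_piMl.
  by rewrite (@le_trans _ _ 0)// ?mulr_ge0_le0 ?(ltW E0)// subr_ge0 ltW.
by rewrite (mulrDr (HH e p)); exact: divergence_arith.
Qed.

End Divergence.

Lemma is_derive_cvg (T : Type) (F : set_system T) (FF : Filter F) (g : R -> R) (u : T -> R) (x d : R) :
  is_derive x 1 g d -> u t @[t --> F] --> x -> g (u t) @[t --> F] --> g x.
Proof. by move=> dg ux; exact: (cvg_comp _ _ ux (is_derive_continuous dg)). Qed.

(** * Continuity of the fields and of their derivatives for z < 0 *)

Section Continuity.
Variables (e : R) (p v : R * R).
Hypotheses (e0 : 0 < e) (e1 : e <= 1) (z0 : p.2 < 0).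
Let x0 : xx p != 0. Proof. by rewrite /xx oppr_eq0 lt_eqF. Qed.
Let D0 : Dp p != 0. Proof. by rewrite gt_eqF// Dp_gt0. Qed.
Let kn : kk != 0. Proof. by rewrite gt_eqF. Qed.

Lemma cvg_1 : q.1 @[q --> p] --> p.1. Proof. exact: cvg_fst. Qed.
Lemma cvg_xx : xx q @[q --> p] --> xx p. Proof. by apply: cvgN; exact: cvg_snd. Qed.
Lemma cvg_sn : sn q @[q --> p] --> sn p. Proof. by apply: cvg_sin; exact: cvg_al. Qed.
Lemma cvg_cs : cs q @[q --> p] --> cs p. Proof. by apply: cvg_cos; exact: cvg_al. Qed.

Lemma cvg_Dp : Dp q @[q --> p] --> Dp p.
Proof. exact: is_derive_cvg (is_derive_DD lam1 (cs_ge0 p)) (cvg_al z0). Qed.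

Lemma cvg_ddD : ddD (al q) @[q --> p] --> ddD (al p).
Proof.
apply: cvgB; apply: cvgM.
- exact: is_derive_cvg (is_derive_YY lam1 (cs_ge0 p)) (cvg_al z0).
- exact: cvg_cs.
- exact: cvg_sn.
- apply: cvg_inv; first by rewrite gt_eqF// lamB_gt0.
  by apply: cvgB; [exact: cvg_cst|exact: cvg_cs].
Qed.

Lemma cvg_bL : b - L q @[q --> p] --> b - L p.
Proof. by apply: cvgB; [exact: cvg_cst|exact: cvg_L]. Qed.

Lemma cvg_ikD : (kk * Dp q)^-1 @[q --> p] --> (kk * Dp p)^-1.
Proof.
apply: cvg_inv; first by rewrite mulf_neq0.
by apply: cvgM; [exact: cvg_cst|exact: cvg_Dp].
Qed.

Lemma cvg_dif : dif e q @[q --> p] --> dif e p.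
Proof.
apply: cvgB; first exact: cvg_u1.
apply: cvgM; first exact: cvg_cst.
exact: is_derive_cvg (is_derive_rr e0 _) cvg_bL.
Qed.

Lemma cvg_HH : HH e q @[q --> p] --> HH e p.
Proof. exact: is_derive_cvg (is_derive_hh e0 _) cvg_dif. Qed.

Lemma cvg_bet : bet e q @[q --> p] --> bet e p.
Proof.
apply: cvgM; last exact: cvg_ikD.
apply: cvgM; first exact: cvg_cst.
exact: is_derive_cvg (is_derive_drr e0 _) cvg_bL.
Qed.

Lemma cvg_ddif : ddif e v q @[q --> p] --> ddif e v p.
Proof.
have := (cvg_1, cvg_bet, cvg_sn, cvg_cs) => -[[[c1 c2] c3] c4].
apply: cvgD.
  by apply: cvgM; [apply: cvgM; [exact: cvg_cst|exact: c1]|exact: cvg_cst].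
apply: cvgM => //; apply: cvgB; apply: cvgM => //; exact: cvg_cst.
Qed.

Lemma cvg_dHH : dHH e v q @[q --> p] --> dHH e v p.
Proof.
apply: cvgM; last exact: cvg_ddif.
have c := cvg_pos cvg_dif.
apply: cvgM.
  by apply: cvgM; [apply: cvgM; [exact: cvg_cst|exact: c]|exact: cvg_cst].
apply: cvg_inv; first by rewrite expf_neq0// gt_eqF// ltr_wpDl ?sqr_ge0// exprn_gt0.
by apply: cvg_exprn; apply: cvgD; [exact: cvg_exprn|exact: cvg_cst].
Qed.

Lemma cvg_dal : dal v q @[q --> p] --> dal v p.
Proof.
apply: cvgM.
  by apply: cvgD; apply: cvgM; try exact: cvg_cst; [exact: cvg_xx|exact: cvg_1].
apply: cvg_inv; first by rewrite mulf_neq0// expf_neq0.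
by apply: cvgM; [apply: cvg_exprn; exact: cvg_xx|exact: cvg_Dp].
Qed.

Lemma cvg_dL : dL v q @[q --> p] --> dL v p.
Proof.
apply: cvgM; last exact: cvg_ikD.
by apply: cvgB; apply: cvgM; try exact: cvg_cst; [exact: cvg_sn|exact: cvg_cs].
Qed.

Lemma cvg_dbet : dbet e v q @[q --> p] --> dbet e v p.
Proof.
have c := cvg_bL.
apply: cvgM; first exact: cvg_cst.
apply: cvgB; apply: cvgM.
- apply: cvgM; last exact: cvg_dL.
  apply: cvgN; apply: cvgM; last exact: cvg_cst.
  apply: cvgM; first exact: cvg_cst.
  apply: cvgB; last exact: cvg_pos.
  by apply: cvg_pos; apply: cvgD => //; exact: cvg_cst.
- exact: cvg_ikD.
- apply: cvgM; last exact: cvg_dal.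
  apply: cvgM; last exact: cvg_ddD.
  exact: is_derive_cvg (is_derive_drr e0 _) c.
- apply: cvg_inv; first by rewrite mulf_neq0// expf_neq0.
  by apply: cvgM; [exact: cvg_cst|apply: cvg_exprn; exact: cvg_Dp].
Qed.

Lemma cvg_sg : sg e (sn q) @[q --> p] --> sg e (sn p).
Proof. exact: is_derive_cvg (is_derive_sg e0 e1 (sn_sqr_le1 p)) cvg_sn. Qed.

Lemma cvg_dsg : dsg e (sn q) @[q --> p] --> dsg e (sn p).
Proof.
have [Q0 _ _ _] := sgQ e0 e1 (sn_sqr_le1 p).
apply: cvgM; first exact: cvg_cst.
apply: cvg_inv; first by rewrite expf_neq0// gt_eqF// sqrtr_gt0.
apply: cvg_exprn; apply: cvg_sqrt; have c := cvg_exprn (n := 2) cvg_sn.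
apply: cvgD => //; apply: cvgM; first exact: cvg_cst.
by apply: cvgB => //; exact: cvg_cst.
Qed.

Lemma cvg_K1 : K1 e q @[q --> p] --> K1 e p.
Proof.
apply: cvgD; last first.
  by apply: cvgM; [exact: cvg_xx|apply: cvgB; [exact: cvg_sg|exact: cvg_sn]].
apply: cvgB; apply: cvgM; [exact: cvg_cst|exact: cvg_1|exact: cvg_bet|exact: cvg_sn].
Qed.

Lemma cvg_K2 : K2 e q @[q --> p] --> K2 e p.
Proof.
apply: cvgM; last exact: cvg_cs.
by apply: cvgD; [exact: cvg_bet|exact: cvg_xx].
Qed.

Lemma cvg_dK1 : dK1 e v q @[q --> p] --> dK1 e v p.
Proof.
apply: cvgD; last first.
  apply: cvgM; first exact: cvg_xx.
  apply: cvgM; last exact: cvg_dal.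
  by apply: cvgM; [apply: cvgB; [exact: cvg_dsg|exact: cvg_cst]|exact: cvg_cs].
apply: cvgB; last first.
  by apply: cvgM; [exact: cvg_cst|apply: cvgB; [exact: cvg_sg|exact: cvg_sn]].
apply: cvgB; first exact: cvg_cst.
apply: cvgD; first by apply: cvgM; [exact: cvg_dbet|exact: cvg_sn].
by apply: cvgM; [apply: cvgM; [exact: cvg_bet|exact: cvg_cs]|exact: cvg_dal].
Qed.

Lemma cvg_dK2 : dK2 e v q @[q --> p] --> dK2 e v p.
Proof.
apply: cvgB; apply: cvgM; [|exact: cvg_cs| |exact: cvg_dal].
  by apply: cvgB; [exact: cvg_dbet|exact: cvg_cst].
by apply: cvgM; [apply: cvgD; [exact: cvg_bet|exact: cvg_xx]|exact: cvg_sn].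
Qed.

Lemma cvg_F1 : F1 e q @[q --> p] --> F1 e p.
Proof.
apply: cvgD; last by apply: cvgM; [exact: cvg_HH|exact: cvg_K1].
apply: cvgB; apply: cvgM; [exact: cvg_cst|exact: cvg_1|exact: cvg_xx|exact: cvg_sg].
Qed.

Lemma cvg_F2 : F2 e q @[q --> p] --> F2 e p.
Proof. by apply: cvgM; [exact: cvg_HH|exact: cvg_K2]. Qed.

Lemma cvg_dF1 : dF1 e v q @[q --> p] --> dF1 e v p.
Proof.
apply: cvgD; last first.
  apply: cvgD; apply: cvgM; [exact: cvg_dHH|exact: cvg_K1|exact: cvg_HH|exact: cvg_dK1].
apply: cvgB; last first.
  apply: cvgM; first exact: cvg_xx.
  by apply: cvgM; [apply: cvgM; [exact: cvg_dsg|exact: cvg_cs]|exact: cvg_dal].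
by apply: cvgD; [exact: cvg_cst|apply: cvgM; [exact: cvg_cst|exact: cvg_sg]].
Qed.

Lemma cvg_dF2 : dF2 e v q @[q --> p] --> dF2 e v p.
Proof.
apply: cvgD; apply: cvgM; [exact: cvg_dHH|exact: cvg_K2|exact: cvg_HH|exact: cvg_dK2].
Qed.

Lemma cvg_WW : WW e q @[q --> p] --> WW e p.
Proof.
apply: cvgB; first exact: cvg_u1.
exact: is_derive_cvg (is_derive_mm e0 _) cvg_dif.
Qed.

Lemma cvg_dWW : dWW e v q @[q --> p] --> dWW e v p.
Proof.
apply: cvgB; last by apply: cvgM; [exact: cvg_HH|exact: cvg_ddif].
by apply: cvgM; [apply: cvgM; [exact: cvg_cst|exact: cvg_1]|exact: cvg_cst].
Qed.

End Continuity.

(** * Uniform bounds and limits *)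

(** Bounds [bet] for every e <= 1: drr <= 2 pos (b - L + e) <= 2 (b + 1), and Dp >= dmin. *)
Definition Bm : R := th * (2 * (b + 1)) / (kk * dmin lam).

Lemma Bm_ge0 : 0 <= Bm.
Proof.
apply: divr_ge0; apply: mulr_ge0; rewrite ?(ltW th0) ?(ltW k0) ?(ltW (dmin_gt0 lam1))//.
by have := b1; lra.
Qed.

Lemma bet_le e p : 0 < e -> e <= 1 -> p.2 < 0 -> bet e p <= Bm.
Proof.
move=> e0 e1 z0; have L0 := L_gt0 z0.
apply: ler_pM.
- by rewrite mulr_ge0 ?drr_ge0// ltW.
- by rewrite invr_ge0 mulr_ge0// ltW// Dp_gt0.
- apply: ler_wpM2l; first exact: ltW.
  apply: le_trans (drr_le e0 _) _; apply: ler_wpM2l => //.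
  by rewrite /pos ge_max; apply/andP; split; have := b1; lra.
- rewrite lef_pV2 ?posrE ?mulr_gt0 ?Dp_gt0 ?dmin_gt0//.
  by rewrite ler_pM2l// Dp_ge.
Qed.

Section UniformBounds.
Variables (e : R) (p : R * R).
Hypotheses (e0 : 0 < e) (e1 : e <= 1) (y1 : `|p.1| <= 1) (z0 : p.2 < 0).

Let H01 : `|HH e p| <= 1.
Proof. by rewrite ger0_norm ?hh_ge0 ?hh_le1. Qed.

Let bm : `|bet e p| <= Bm.
Proof. by rewrite ger0_norm ?bet_ge0 ?bet_le. Qed.

Let ly : `|lam * p.1| <= lam.
Proof. by rewrite normrM (gtr0_norm l0) ler_piMr// ltW. Qed.

Let x0 : 0 < xx p. Proof. by rewrite oppr_gt0. Qed.

Lemma norm_bet_sn : `|bet e p * sn p| <= Bm.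
Proof. by rewrite normrM -[leRHS]mulr1 ler_pM// norm_sn. Qed.

Lemma norm_bet_cs : `|bet e p * cs p| <= Bm.
Proof.
by rewrite normrM -[leRHS]mulr1 ler_pM// ger0_norm ?cs_ge0 ?cs_le1.
Qed.

Lemma norm_dWWy : `|dWW e ey p| <= 2 * lam + Bm.
Proof.
have -> : dWW e ey p = - (lam * p.1) - HH e p * (bet e p * sn p - lam * p.1).
  by rewrite /dWW /ddif /=; ring.
rewrite (le_trans (ler_normB _ _))// normrN.
have : `|HH e p * (bet e p * sn p - lam * p.1)| <= Bm + lam.
  rewrite normrM -[leRHS]mul1r ler_pM// (le_trans (ler_normB _ _))//.
  by apply: lerD => //; exact: norm_bet_sn.
by move: ly; lra.
Qed.

Lemma dWWzE : dWW e ez p = HH e p * (bet e p * cs p).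
Proof. by rewrite /dWW /ddif /=; ring. Qed.

Lemma norm_dWWz : `|dWW e ez p| <= Bm.
Proof. by rewrite dWWzE normrM -[leRHS]mul1r ler_pM// norm_bet_cs. Qed.

Lemma WW_bnd : 0 <= WW e p <= lam / 2.
Proof.
have /andP[u0 u2] := u1_ge y1.
have v0 : 0 <= vve e p by apply: le_trans (vve_ge p e0); exact: vv_ge0.
have m1 := mm_le e0 (dif e p); have m0 := mm_ge0 e0 (dif e p).
have m2 : pos (dif e p) <= u1 lam p by rewrite /pos ge_max u0 andbT /dif gerBl.
by rewrite /WW; apply/andP; split; lra.
Qed.

Lemma norm_F1 : `|F1 e p| <= (2 * lam + Bm + 3) * (1 + xx p).
Proof.
have sg1 : `|xx p * sg e (sn p)| <= xx p.
  by rewrite normrM (gtr0_norm x0) ler_piMr ?(ltW x0)// sg_sqr_le1// sn_sqr_le1.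
have sn1 : `|xx p * sn p| <= xx p.
  by rewrite normrM (gtr0_norm x0) ler_piMr ?(ltW x0)// norm_sn.
have k1 : `|K1 e p| <= lam + Bm + 2 * xx p.
  rewrite /K1 mulrBr.
  have := ler_normD (lam * p.1 - bet e p * sn p) (xx p * sg e (sn p) - xx p * sn p).
  have := ler_normB (lam * p.1) (bet e p * sn p).
  have := ler_normB (xx p * sg e (sn p)) (xx p * sn p).
  by have := norm_bet_sn; move: ly sg1 sn1; lra.
have hk : `|HH e p * K1 e p| <= lam + Bm + 2 * xx p.
  by rewrite normrM -[leRHS]mul1r ler_pM.
have := ler_normD (- (lam * p.1) - xx p * sg e (sn p)) (HH e p * K1 e p).
have := ler_normB (- (lam * p.1)) (xx p * sg e (sn p)).
rewrite normrN.
have -> : F1 e p = - (lam * p.1) - xx p * sg e (sn p) + HH e p * K1 e p.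
  by rewrite /F1; ring.
have B0 := Bm_ge0.
have c0 : 0 <= xx p * (2 * lam + Bm) by apply: mulr_ge0; [exact: ltW|apply: addr_ge0 => //; apply: mulr_ge0 => //; exact: ltW].
by move: ly sg1 hk c0 B0 x0; lra.
Qed.

Lemma norm_F2 : `|F2 e p| <= (2 * lam + Bm + 3) * (1 + xx p).
Proof.
have k1 : `|K2 e p| <= Bm + xx p.
  rewrite /K2 mulrDl (le_trans (ler_normD _ _))// lerD ?norm_bet_cs//.
  by rewrite normrM (gtr0_norm x0) ler_piMr ?(ltW x0)// ger0_norm ?cs_ge0 ?cs_le1.
have hk : `|F2 e p| <= Bm + xx p by rewrite normrM -[leRHS]mul1r ler_pM.
apply: le_trans hk _.
have B0 := Bm_ge0.
have c0 : 0 <= xx p * (2 * lam + Bm) by apply: mulr_ge0; [exact: ltW|apply: addr_ge0 => //; apply: mulr_ge0 => //; exact: ltW].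
by move: c0 B0 x0 l0; lra.
Qed.

End UniformBounds.

(** The limit of [HH]. On the interface itself it is 0, because the regularised barrier approaches
    [vv] from above. *)
Definition Ind p : R := if vv p < u1 lam p then 1 else 0.
Definition bet0 p : R := th * (2 * pos (b - L p)) / (kk * Dp p).
Definition gU p : R * R :=
  (- lam * p.1 - Ind p * (- lam * p.1 + bet0 p * sn p), Ind p * (bet0 p * cs p)).
(** To be compared with [qext] off the interface: on it [qext] is (0, 0), whereas this is (- sg (sn
    p), 0). *)
Definition qlim p : R * R :=
  (- (1 - Ind p) * Num.sg (sn p) - Ind p * sn p, Ind p * cs p).

Section LimitFields.
Variable e_ : nat -> R.
Hypotheses (e_gt0 : forall n, 0 < e_ n) (e_le1 : forall n, e_ n <= 1).
Hypothesis e_cvg0 : e_ n @[n --> \oo] --> (0 : R).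
Variable p : R * R.

Lemma lim_dif : dif (e_ n) p @[n --> \oo] --> u1 lam p - vv p.
Proof.
apply: cvgB; first exact: cvg_cst.
by apply: cvgM; [exact: cvg_cst|exact: rr_cvg].
Qed.

Lemma lim_bet : bet (e_ n) p @[n --> \oo] --> bet0 p.
Proof.
apply: cvgM; last exact: cvg_cst.
by apply: cvgM; [exact: cvg_cst|exact: drr_cvg].
Qed.

Lemma lim_WW : WW (e_ n) p @[n --> \oo] --> u1 lam p - pos (u1 lam p - vv p).
Proof.
apply: cvgB; first exact: cvg_cst.
by apply: mm_cvg => //; exact: lim_dif.
Qed.

Lemma lim_HH : HH (e_ n) p @[n --> \oo] --> Ind p.
Proof.
rewrite /Ind; case: ltP => [h|h].
  by apply: (hh_cvg1 e_cvg0 (s := u1 lam p - vv p)); [rewrite subr_gt0|exact: lim_dif].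
rewrite (_ : (fun n => HH (e_ n) p) = cst 0); first exact: cvg_cst.
apply/funext => n; rewrite /HH hh_le0// subr_le0 (le_trans h)//.
exact: vve_ge.
Qed.

Lemma lim_dWWy : dWW (e_ n) ey p @[n --> \oo] --> (gU p).1.
Proof.
rewrite /gU /= /dWW /ddif /= !mulr1 !mulr0 subr0.
apply: cvgB; first exact: cvg_cst.
apply: cvgM; first exact: lim_HH.
apply: cvgD; first exact: cvg_cst.
by apply: cvgM; [exact: lim_bet|exact: cvg_cst].
Qed.

Lemma lim_dWWz : dWW (e_ n) ez p @[n --> \oo] --> (gU p).2.
Proof.
under eq_fun do rewrite dWWzE.
apply: cvgM; first exact: lim_HH.
by apply: cvgM; [exact: lim_bet|exact: cvg_cst].
Qed.

Lemma lim_F1 : F1 (e_ n) p @[n --> \oo] --> (gU p).1 + xx p * (qlim p).1.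
Proof.
have -> : (gU p).1 + xx p * (qlim p).1 = - lam * p.1 - xx p * Num.sg (sn p) +
   Ind p * (lam * p.1 - bet0 p * sn p + xx p * (Num.sg (sn p) - sn p)).
  by rewrite /gU /qlim /=; ring.
have c := sg_cvg e_cvg0 (s := sn p).
apply: cvgD.
  by apply: cvgB; [exact: cvg_cst|apply: cvgM => //; exact: cvg_cst].
apply: cvgM; first exact: lim_HH.
apply: cvgD.
  apply: cvgB; first exact: cvg_cst.
  by apply: cvgM; [exact: lim_bet|exact: cvg_cst].
apply: cvgM; first exact: cvg_cst.
by apply: cvgB => //; exact: cvg_cst.
Qed.

Lemma lim_F2 : F2 (e_ n) p @[n --> \oo] --> (gU p).2 + xx p * (qlim p).2.
Proof.
have -> : (gU p).2 + xx p * (qlim p).2 = Ind p * ((bet0 p + xx p) * cs p).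
  by rewrite /gU /qlim /=; ring.
apply: cvgM; first exact: lim_HH.
apply: cvgM; last exact: cvg_cst.
by apply: cvgD; [exact: lim_bet|exact: cvg_cst].
Qed.

End LimitFields.

(** * Closed forms of the barrier and of the field *)

Section OnOmega.

Lemma lam_th : lam / (2 * th) = (b - 1) ^+ 2.
Proof.
have th1 : th != 0 by rewrite gt_eqF.
apply: (mulfI th1); rewrite hb; field.
by rewrite th1.
Qed.

Lemma Omega_u1 p : Omega p -> [/\ 0 < u1 lam p, u1 lam p <= lam / 2, `|p.1| < 1 & p.2 < 0].
Proof.
move=> [y1 z0]; have y2 : `|p.1| < 1 by rewrite ltr_norml.
have /andP[_ h] := u1_ge (ltW y2); split => //.
rewrite /u1 mulr_gt0 ?divr_gt0// subr_gt0 -real_normK ?num_real// expr_lt1//.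
Qed.

Lemma L_ge1_cone p : Omega p -> 1 <= L p -> in_cone p.
Proof.
move=> /Omega_u1[_ _ y1 z0] L1; apply/negPn/negP => nc.
by move: L1; rewrite (L_out z0 nc) leNgt y1.
Qed.

Lemma LL_L p : in_cone p -> LL lam p = L p.
Proof. by case: p => y z; rewrite in_coneE => /(LLE lam1)[]. Qed.

(** min (a, c) = a - pos (a - c). Where [u2] is infinite, L < 1 by [phiK_lt], hence u_1 <= vv and
    both descriptions give u_1. *)
Lemma UUE p : Omega p -> UU lam th b p = u1 lam p - pos (u1 lam p - vv p).
Proof.
move=> Op; have [u0 ub y1 z0] := Omega_u1 Op.
rewrite /UU /u2; have -> : (phiK lam p.1 < p.2) = (L p < 1).
  by case: p Op {u0 ub y1 z0} => y z Op; exact: phiK_lt.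
have [L1|L1] := ltP (L p) 1.
  have h : u1 lam p <= vv p by apply: vv_ge_u1; left; exact: ltW.
  rewrite (min_idPl _) ?leey//= pos0E ?subr0// subr_le0//.
have pc := L_ge1_cone Op L1.
rewrite -in_coneE pc /= LL_L// L1 /=.
have vE : (if L p <= b then (th * (L p - b) ^+ 2)%:E else 0%E) = (vv p)%:E.
  rewrite /vv; case: leP => h; first by rewrite pos_id ?subr_ge0// -sqrrN opprB.
  by rewrite pos0E ?expr0n ?mulr0// subr_le0 ltW.
rewrite vE -EFin_min /=.
rewrite /pos; have [h|h] := leP (u1 lam p) (vv p).
  by rewrite (max_idPr _) ?subr0// subr_le0.
by rewrite (max_idPl _) ?subr_ge0 ?(ltW h)// opprB addrCA subrr addr0.
Qed.

Lemma LintE y : `|y| <= 1 ->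
  Lint lam th b y = b - (b - 1) * Num.sqrt (1 - y ^+ 2).
Proof.
move=> y1; rewrite /Lint lam_th sqrtrM ?sqr_ge0// sqrtr_sqr ger0_norm//.
by rewrite subr_ge0 ltW.
Qed.

(** By the choice of b, u_1 = th w^2 with w = (b - 1) sqrt (1 - y^2), while vv = th pos (b - L)^2
    and [Lint] is b - w. *)
Lemma u1_vv p : Omega p ->
  (L p < Lint lam th b p.1) = (u1 lam p < vv p) /\
  (Lint lam th b p.1 < L p) = (vv p < u1 lam p).
Proof.
move=> Op; have [u0 ub y1 z0] := Omega_u1 Op.
rewrite LintE ?(ltW y1)//; set w := (b - 1) * _.
have y2 : 0 < 1 - p.1 ^+ 2 by rewrite subr_gt0 -real_normK ?num_real// expr_lt1.
have w0 : 0 < w by rewrite mulr_gt0 ?subr_gt0// sqrtr_gt0.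
have uE : u1 lam p = th * w ^+ 2.
  by rewrite /u1 -hb /w exprMn sqr_sqrtr ?(ltW y2)//; ring.
rewrite uE /vv !ltr_pM2l// !ltr_pXn2r ?nnegrE ?pos_ge0 ?(ltW w0)//; split.
  rewrite ltrBrDl -ltrBrDr; have [h|h] := leP 0 (b - L p); first by rewrite pos_id.
  by rewrite pos0E ?(ltW h)//; apply/idP/idP; move: w0 h; lra.
rewrite ltrBlDl -ltrBlDr; have [h|h] := leP 0 (b - L p); first by rewrite pos_id.
by rewrite pos0E ?(ltW h)// w0; move: w0 h; lra.
Qed.

Lemma Lint_ge1 y : `|y| <= 1 -> 1 <= Lint lam th b y.
Proof.
move=> y1; rewrite LintE//.
have : Num.sqrt (1 - y ^+ 2) <= 1.
  by rewrite -[leRHS]sqrtr1 ler_sqrt// gerBl sqr_ge0.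
by have := b1; nra.
Qed.

Lemma qextE p : Omega p -> qext lam th b p =
  if u1 lam p < vv p then (- Num.sg p.1, 0)
  else if vv p < u1 lam p then (- sn p, cs p) else (0, 0).
Proof.
move=> Op; have [u0 ub y1 z0] := Omega_u1 Op; have [h1 h2] := u1_vv Op.
have LI := Lint_ge1 (ltW y1).
have sgE : p.1 != 0 -> p.1 / `|p.1| = Num.sg p.1.
  by move=> y0; rewrite {1}[p.1]numEsg mulfK// normr_eq0.
rewrite /qext; have -> : (phiK lam p.1 < p.2) = (L p < 1).
  by case: p Op {u0 ub y1 z0 h1 h2 LI sgE} => y z Op; exact: phiK_lt.
rewrite -in_coneE -h1 -h2.
have e1 : (in_cone p && (1 <= LL lam p < Lint lam th b p.1) || (L p < 1)) =
    (L p < Lint lam th b p.1).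
  have [L1|L1] := ltP (L p) 1; first by rewrite orbT (lt_le_trans L1 LI).
  by have pc := L_ge1_cone Op L1; rewrite pc LL_L// L1 orbF.
have e2 : (in_cone p && (Lint lam th b p.1 < LL lam p)) = (Lint lam th b p.1 < L p).
  have [pc|nc] := boolP (in_cone p); first by rewrite LL_L.
  apply/esym; apply/negbTE; rewrite -leNgt (le_trans _ LI)// leNgt; apply/negP => /ltW.
  by move=> /(L_ge1_cone Op); rewrite (negbTE nc).
rewrite e1 e2 {e1 e2}.
have [h|h] := ltP (L p) (Lint lam th b p.1).
  have h' : (Lint lam th b p.1 < L p) = false by apply/negbTE; rewrite -leNgt ltW.
  (* On the axis y = 0 the definition of [qext] falls through to (0, 0), which agrees with - sg
     0. *)
  rewrite h' andTb; have [y0|y0] := eqVneq p.1 0; last by rewrite sgE.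
  by rewrite y0 sgr0 oppr0.
rewrite andFb; have [h'|//] := ltP (Lint lam th b p.1) (L p).
have pc : in_cone p by apply: (L_ge1_cone Op); apply: le_trans LI (ltW h').
case: p pc {Op u0 ub y1 z0 h1 h2 LI sgE h h'} => y z; rewrite in_coneE => pc.
by rewrite (qconeE lam1 pc).
Qed.

Lemma qext_qlim p : Omega p -> u1 lam p != vv p -> qext lam th b p = qlim p.
Proof.
move=> Op ne; rewrite qextE// /qlim /Ind.
have sE : Num.sg (sn p) = Num.sg p.1.
  have [_ _ _ z0] := Omega_u1 Op.
  by rewrite /sn /al sgr_sinAA// sgrM [Num.sg (- p.2)^-1]gtr0_sg ?mulr1// invr_gt0 oppr_gt0.
case: (ltgtP (u1 lam p) (vv p)) ne => // h _.
  by rewrite !mul0r subr0 subr0 mulN1r sE.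
by rewrite !mul1r subrr oppr0 mul0r sub0r.
Qed.

End OnOmega.

(** In the layer - 1 / T1 <= z < 0 the first barrier is the minimum: [HH] vanishes and the
    y-derivative of [F1] is - lam - dsg cs / Dp, bounded although it has no limit at the origin. *)
Lemma div_field_F e : 0 < e -> e <= 1 -> exists d K,
  div_field (2 * lam + Bm + 3) d K (F1 e) (F2 e) (dF1 e ey) (dF2 e ez).
Proof.
move=> e0 e1; have B0 := Bm_ge0; have t0 := T1_gt0 lam1.
have b1' (y : R) : `|y| <= 1 -> `|y| < b by move=> h; rewrite (le_lt_trans h).
exists T1^-1, (lam + e / Num.sqrt e ^+ 3 * (dmin lam)^-1); split.
- by rewrite !addr_ge0// mulr_ge0// ltW.
- by rewrite invr_gt0.
- move=> p p2; split.
  + exact: cvg_F1.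
  + exact: cvg_F2.
  + exact: cvg_dF1.
  + exact: cvg_dF2.
- by move=> p p2 p1; apply: is_derive_F1 => //; exact: b1'.
- by move=> p p1; apply: is_derive_F2 => //; exact: b1'.
- move=> p p1 pT; have d0 := dif_le0 e0 (L_le pT).
  by rewrite /F2 /dF2 /HH /dHH hh_le0// dhh_le0// !mul0r addr0.
- move=> p p1 /andP[pT p2]; have d0 := dif_le0 e0 (L_le pT).
  have x0 : xx p != 0 by rewrite gt_eqF// oppr_gt0.
  have D0 : Dp p != 0 by rewrite gt_eqF// Dp_gt0.
  have -> : dF1 e ey p = - lam - dsg e (sn p) * (cs p * (Dp p)^-1).
    rewrite /dF1 /HH /dHH hh_le0// dhh_le0// /dal /ey /=; field.
    by rewrite x0 D0.
  have h1 := dsg_ge0 e0 (sn p); have h2 := dsg_le e0 e1 (sn_sqr_le1 p).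
  have h3 : 0 <= cs p * (Dp p)^-1 by rewrite mulr_ge0 ?cs_ge0// invr_ge0 ltW// Dp_gt0.
  have h4 : cs p * (Dp p)^-1 <= (dmin lam)^-1.
    rewrite -[leRHS]mul1r ler_pM ?cs_ge0 ?cs_le1//; first by rewrite invr_ge0 ltW// Dp_gt0.
    by rewrite lef_pV2 ?posrE ?Dp_gt0 ?dmin_gt0// Dp_ge.
  rewrite (le_trans (ler_normB _ _))// normrN (gtr0_norm l0) lerD2l ger0_norm.
    by rewrite ler_pM.
  by rewrite mulr_ge0.
- by move=> p p1 p2; split; [exact: norm_F1|exact: norm_F2].
Qed.

Definition e_ (n : nat) : R := n.+1%:R^-1.

Lemma e_gt0 n : 0 < e_ n. Proof. by rewrite invr_gt0. Qed.

Lemma e_le1 n : e_ n <= 1. Proof. by rewrite invf_le1// ler1n. Qed.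

Lemma e_cvg0 : e_ n @[n --> \oo] --> (0 : R).
Proof. exact: cvg_harmonic. Qed.

(** Since L >= - z (lam - 1) / kk, below this depth L >= b and the second barrier is 0. *)
Definition depth : R := b * kk / (lam - 1).

Lemma depth_gt0 : 0 < depth.
Proof.
have l1 : 0 < lam - 1 by have := lam1; lra.
have b0 : 0 < b by have := b1; lra.
by rewrite divr_gt0// mulr_gt0.
Qed.

Lemma UU_deep p : Omega p -> p.2 < - depth -> UU lam th b p = 0 /\ gU p = (0, 0).
Proof.
move=> Op pd; have [u0 u1h p1 p2] := Omega_u1 Op.
have l1 : 0 < lam - 1 by have := lam1; lra.
have x0 : 0 < xx p by rewrite oppr_gt0.
have bL : b - L p <= 0.
  rewrite subr_le0 (@le_trans _ _ (xx p * ((lam - 1) / kk)))//.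
    have h : depth <= xx p by rewrite /xx; lra.
    have k1 : 0 < (lam - 1) / kk by rewrite divr_gt0.
    have -> : b = depth * ((lam - 1) / kk).
      by rewrite /depth; field; rewrite !gt_eqF.
    by rewrite ler_pM2r.
  by rewrite /LLx ler_pM2l// ell_ge.
have v0 : vv p = 0 by rewrite /vv pos0E// expr0n mulr0.
rewrite UUE// v0 subr0 (pos_id (ltW u0)) subrr; split=> //.
by rewrite /gU /Ind v0 u0 /bet0 pos0E// !mulr0 !mul0r mulr0; congr pair; ring.
Qed.

(** The regularised minima are C^1 for |y| < b, that is, beyond the sides, which leaves room for the
    cutoff in y; on the sides they vanish because they coincide with u_1. *)
Lemma calX_UU : calX (UU lam th b) gU.
Proof.
have B0 := Bm_ge0.
apply: (@calX_of_approximants _ b depth (2 * lam + Bm) (fun n => WW (e_ n))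
  (fun n => dWW (e_ n) ey) (fun n => dWW (e_ n) ez)) => //.
- exact: depth_gt0.
- by move=> n p pb; split; apply: is_derive_WW => //; exact: e_gt0.
- move=> n p pb; have [z0|z0] := ltP p.2 0.
    by split; [exact: cvg_WW (e_gt0 n) z0|exact: cvg_dWW (e_gt0 n) z0|exact: cvg_dWW (e_gt0 n) z0].
  (* Points with z >= 0 count as outside the cone: near them [dif] <= 0, and [WW] is u_1. *)
  have nc : ~~ in_cone p by rewrite /in_cone ltNge z0.
  have nr := near_dif_le0 (e_gt0 n) pb nc; have d0 := nbhs_singleton nr.
  have cdW v : {for p, continuous (dWW (e_ n) v)}.
    rewrite /prop_for /continuous_at {2}/dWW /HH hh_le0// mul0r subr0.
    have h : (- lam * q.1 * v.1) @[q --> p] --> - lam * p.1 * v.1.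
      by apply: cvgMl; apply: cvgMr; exact: cvg_fst.
    have := h; apply: cvg_trans; apply: near_eq_cvg.
    by apply: filterS nr => q hq; rewrite /dWW /HH hh_le0 ?e_gt0// mul0r subr0.
  split => //.
  rewrite /prop_for /continuous_at {2}/WW mm_le0// subr0.
  have := @cvg_u1 p; apply: cvg_trans; apply: near_eq_cvg.
  by apply: filterS nr => q hq; rewrite /WW mm_le0// subr0.
- move=> n p p1 p2; have e0 := e_gt0 n; have e1 := e_le1 n.
  have /andP[w0 w1] := WW_bnd e0 p1; split.
  + by rewrite ger0_norm// (le_trans w1)//; have := l0; lra.
  + exact: norm_dWWy.
  + by rewrite (le_trans (norm_dWWz e0 e1 p2))// lerDr mulr_ge0// ltW.
- move=> n z z0; have key (y : R) : y ^+ 2 = 1 -> `|y| = 1 -> WW (e_ n) (y, z) = 0.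
    move=> y2 y1; have d0 : dif (e_ n) (y, z) <= 0.
      by apply: dif_le0; [exact: e_gt0|right; rewrite /= y1].
    by rewrite /WW mm_le0// /u1 /= y2 subrr mulr0 subr0.
  by split; apply: key; rewrite ?sqrrN ?expr1n ?normrN1 ?normr1.
- move=> p Op; split.
  + by rewrite UUE//; apply: lim_WW => //; [exact: e_gt0|exact: e_cvg0].
  + by apply: lim_dWWy => //; [exact: e_gt0|exact: e_cvg0].
  + by apply: lim_dWWz => //; [exact: e_gt0|exact: e_cvg0].
- by move=> p Op; exact: UU_deep.
Qed.

(** * The interface between the two barriers is negligible *)

Lemma interface_L p : Omega p -> u1 lam p = vv p -> L p = Lint lam th b p.1.
Proof.
move=> Op uv; have [] := u1_vv Op; rewrite uv ltxx => h1 h2.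
by apply/eqP; rewrite eq_le !leNgt h1 h2.
Qed.

(* On the interface L is prescribed by y, and L determines the angle, hence z. *)
Lemma interface_unique (y z z' : R) : Omega (y, z) -> Omega (y, z') ->
  u1 lam (y, z) = vv (y, z) -> u1 lam (y, z') = vv (y, z') -> z = z'.
Proof.
move=> Op Op' /(interface_L Op) LI /(interface_L Op') LI'.
have [_ _ y1 _] := Omega_u1 Op; have l1 := Lint_ge1 (ltW y1).
have pc : in_cone (y, z) by apply: L_ge1_cone => //; rewrite LI.
have pc' : in_cone (y, z') by apply: L_ge1_cone => //; rewrite LI'.
have LL' : L (y, z) = L (y, z') by rewrite LI LI'.
have := pc; have := pc'; rewrite !in_coneE.
move=> /(LLE lam1)[_ _ _ B'] /(LLE lam1)[_ _ _ B].
have E : al (y, z) = al (y, z') by rewrite /al /= -B -B' LL'.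
move: LL'; rewrite (LE pc) (LE pc') /cs E => /mulIf h.
have c0 : (lam - cos (al (y, z'))) / kk != 0.
  by rewrite gt_eqF// divr_gt0// lamB_gt0.
by apply: oppr_inj; exact: h.
Qed.

Let measurable_Omegafun (f : R * R -> R) : (forall p, p.2 < 0 -> {for p, continuous f}) ->
  measOmega f.
Proof. by move=> cf; apply: continuous_measurable_Omega => p [_ /cf]. Qed.

Lemma cvg_vv p : p.2 < 0 -> {for p, continuous vv}.
Proof.
move=> z0; apply: cvgMr; apply: cvg_exprn; apply: cvg_pos.
by apply: cvgB; [exact: cvg_cst|exact: cvg_L].
Qed.

Let measurable_u1 : measOmega (u1 lam).
Proof. by apply: measurable_Omegafun => p _; exact: cvg_u1. Qed.

Let measurable_vv : measOmega vv.
Proof. by apply: measurable_Omegafun => p; exact: cvg_vv. Qed.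

(** By [interface_unique] every section at fixed y has at most one point; Fubini concludes. *)
Lemma ae_off_interface : {ae leb2, forall p, Omega p -> u1 lam p != vv p}.
Proof.
pose A : set (plane R) := Omega `&` (fun p => u1 lam p - vv p) @^-1` [set 0].
have mA : measurable A.
  by apply: (measurable_funB measurable_u1 measurable_vv); [exact: measurable_Omega|].
apply: (@negligibleS _ (plane R) R leb2 A).
  move=> p /= /not_implyP[Op /negP]; rewrite negbK => /eqP E.
  by split => //=; rewrite E subrr.
apply/(negligibleP _ mA)/eqP; rewrite eq_le measure_ge0 andbT.
have E : leb2 A = (\int[leb]_y leb (xsection A y : set (measurableTypeR R)))%E by [].
suff I0 : (\int[leb]_y leb (xsection A y : set (measurableTypeR R)) = 0)%E.
  by rewrite [leLHS]E [leLHS]I0.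
apply: integral0_eq => y _ /=.
have [[z zA]|nA] := pselect (exists z, xsection A y z); last first.
  by rewrite (_ : xsection A y = set0) ?measure0// -subset0 => z hz; apply: nA; exists z.
rewrite (_ : xsection A y = [set z]) ?lebesgue_measure_set1//.
apply/seteqP; split => [z' z'A|_ ->] //=.
move: zA z'A; rewrite /xsection /= !inE => -[Op hz] [Op' hz'].
exact: (interface_unique Op' Op (subr0_eq hz') (subr0_eq hz)).
Qed.

Lemma measurable_piecewise (f g h : R * R -> R) :
  measOmega f -> measOmega g ->
  (forall p, Omega p -> h p = if u1 lam p < vv p then f p
    else if vv p < u1 lam p then g p else 0) ->
  measOmega h.
Proof.
move=> mf mg hE; have mO := @measurable_Omega R.
apply: (@eq_measurable_fun _ _ (plane R) _ _ (fun p => if u1 lam p < vv p then f p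
    else if vv p < u1 lam p then g p else 0)).
  by move=> p; rewrite inE => Op; rewrite hE.
have sub (k : R * R -> R) (A : set (R * R)) : measOmega k ->
    measurable_fun (Omega `&` A : set (plane R)) k.
  by apply: measurable_funS => //; exact: subIsetl.
apply: measurable_fun_if => //; first exact: measurable_fun_ltr.
  exact: sub.
apply: (sub _ _ _); apply: measurable_fun_if => //; first exact: measurable_fun_ltr.
exact: sub.
Qed.

Lemma dot_qext_le1 p : Omega p -> dot (qext lam th b p) (qext lam th b p) <= 1.
Proof.
move=> Op; rewrite qextE// /dot; case: ifP => _ /=.
  by rewrite mul0r addr0 mulrNN -expr2 sqr_sg; case: eqP.
case: ifP => _ /=; last by rewrite mul0r addr0.
by rewrite mulrNN -!expr2 sn_cs subrK.
Qed.

Lemma enorm_qext_le1 p : Omega p -> enorm (qext lam th b p) <= 1.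
Proof.
by move=> Op; rewrite /enorm -[leRHS]sqrtr1 ler_wsqrtr// dot_qext_le1.
Qed.

Lemma measurable_qext :
  measOmega (fun p => (qext lam th b p).1) /\
  measOmega (fun p => (qext lam th b p).2).
Proof.
have mO := @measurable_Omega R.
have msn : measOmega sn.
  by apply: measurable_Omegafun => p z0; exact: cvg_sn.
have mcs : measOmega cs.
  by apply: measurable_Omegafun => p z0; exact: cvg_cs.
have m1 : measOmega (fun p : R * R => p.1).
  exact: measurable_funTS measurable_fst.
have msg : measOmega (fun p : R * R => - Num.sg p.1).
  have -> : (fun p : R * R => - Num.sg p.1) =
      (fun y : R => if y < 0 then 1 else if 0 < y then -1 else 0) \o fst.
    by apply/funext => p /=; case: sgrP; rewrite ?oppr0 ?opprK.
  apply: measurableT_comp m1.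
  by apply: measurable_fun_ifT => //; [|apply: measurable_fun_ifT => //];
    exact: measurable_fun_ltr.
split.
- apply: (measurable_piecewise (f := fun p => - Num.sg p.1) (g := fun p => - sn p)) => //.
    exact: measurableT_comp.
  by move=> p Op; rewrite qextE//; case: ifP => // _; case: ifP.
- apply: (measurable_piecewise (f := cst 0) (g := cs)) => //.
  by move=> p Op; rewrite qextE//; case: ifP => // _; case: ifP.
Qed.

Lemma Lam_qext : Lam (qext lam th b).
Proof.
have [m1 m2] := measurable_qext; split=> //; last first.
  by apply: aeW => p; exact: enorm_qext_le1.
move=> C cC CO; have mC := compact_measurable_plane cC.
have [M M0 hM] := compact_below cC.
have mE : measOmega (fun p => enorm (qext lam th b p) ^+ 2).
  apply: (@eq_measurable_fun _ _ (plane R) _ _ (fun p => (qext lam th b p).1 ^+ 2 +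
    (qext lam th b p).2 ^+ 2)).
    move=> p _; rewrite /enorm sqr_sqrtr /dot -?expr2//.
    by rewrite addr_ge0// sqr_ge0.
  by apply: measurable_funD; exact: measurable_funX.
apply: (@le_lt_trans _ _ (\int[leb2]_(p in C) (cst 1%E) p)%E).
  apply: ge0_le_integral => //.
  - by move=> p _; rewrite lee_fin sqr_ge0.
  - apply/measurable_EFinP; apply: measurable_funS mE => //; exact: measurable_Omega.
  - move=> p /CO Op; rewrite lee_fin -[leRHS](expr1n _ 2) ler_pXn2r ?nnegrE ?sqrtr_ge0//.
    exact: enorm_qext_le1.
rewrite integral_cst// mul1e (le_lt_trans _ (leb2_Omegab M))//.
apply: le_measure; rewrite ?inE//; first exact: measurable_Omegab.
move=> p Cp; have [h1 h2] := CO p Cp; rewrite /Omegab /= !in_itv /= h2 andbT.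
by split=> //; exact: hM.
Qed.

(** In each region [gU] is a nonnegative multiple of the field: lam |y| times (- sg y, 0), or [bet0]
    times the unit vector (- sn, cs). *)
Lemma dot_qext_gU p : Omega p -> u1 lam p != vv p ->
  dot (qext lam th b p) (gU p) = enorm (gU p).
Proof.
move=> Op; rewrite qextE//; have [u0 ub y1 z0] := Omega_u1 Op.
case: (ltgtP (u1 lam p) (vv p)) => // h _; rewrite /gU /Ind /dot /enorm /dot /=.
  have -> : (vv p < u1 lam p) = false by apply/negbTE; rewrite -leNgt ltW.
  rewrite !(mul0r, subr0, addr0) -expr2 sqrtr_sqr normrM normrN (gtr0_norm l0).
  by rewrite normrEsg; ring.
rewrite h !mul1r.
have be0 : 0 <= bet0 p.
  by rewrite /bet0 divr_ge0// mulr_ge0 ?pos_ge0 ?(ltW th0) ?(ltW k0) ?(ltW (Dp_gt0 p))// mulr_ge0 ?pos_ge0.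
have sc : sn p ^+ 2 + cs p ^+ 2 = 1 by rewrite sn_cs subrK.
have -> : - sn p * (- lam * p.1 - (- lam * p.1 + bet0 p * sn p)) + cs p * (bet0 p * cs p) =
  bet0 p * (sn p ^+ 2 + cs p ^+ 2) by ring.
rewrite [X in Num.sqrt X](_ : _ = bet0 p ^+ 2 * (sn p ^+ 2 + cs p ^+ 2)); last by ring.
by rewrite sc !mulr1 sqrtr_sqr ger0_norm.
Qed.

Lemma supersolution_UU : supersolution mu (UU lam th b) (qext lam th b).
Proof.
have LQ := Lam_qext; have [mq1 mq2 _ _] := LQ.
have cX := calX_UU; have [[_ [mg1 _] [mg2 _] _] _ _ _] := cX.
have mO := @measurable_Omega R.
have mx : measOmega (fun p : R * R => `|p.2|).
  by apply: measurable_funTS; apply: measurableT_comp => //; exact: measurable_snd.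
exists gU; split=> //.
- apply: aeW => p Op; rewrite UUE//; have [u0 _ _ _] := Omega_u1 Op.
  by rewrite subr_ge0 /pos ge_max (ltW u0) andbT gerBl vv_ge0.
- move=> phi gphi hX phi0; have [[_ [mp1 _] [mp2 _] _] _ _ _] := hX.
  have lF1 p : Omega p -> F1 (e_ n) p @[n --> \oo] --> (gU p).1 + xx p * (qlim p).1.
    by move=> /Omega_bounds[p1 p2]; apply: lim_F1 => //; [exact: e_gt0|exact: e_cvg0].
  have lF2 p : Omega p -> F2 (e_ n) p @[n --> \oo] --> (gU p).2 + xx p * (qlim p).2.
    by move=> /Omega_bounds[p1 p2]; apply: lim_F2 => //; [exact: e_gt0|exact: e_cvg0].
  have := @divergence_inequality _ mu (2 * lam + Bm + 3) (fun n => F1 (e_ n))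
    (fun n => F2 (e_ n)) (fun n => dF1 (e_ n) ey) (fun n => dF2 (e_ n) ez) _ _ phi gphi
    (fun n => div_field_F (e_gt0 n) (e_le1 n)) _ lF1 lF2 hX phi0.
  have dv n p : Omega p -> dF1 (e_ n) ey p + dF2 (e_ n) ez p <= - mu.
    by move=> Op; apply: div_F_le => //; [exact: e_gt0|exact: e_le1].
  move=> /(_ dv) ineq; apply: (le_trans ineq); rewrite le_eqVlt; apply/orP; left.
  apply/eqP; apply: ae_eq_integral => //.
  + apply/measurable_EFinP; apply: measurable_funD; apply: measurable_funM => //.
    * apply: (measurable_fun_cvg _ lF1) => n; apply: measurable_Omegafun => p z0.
      exact: cvg_F1 (e_gt0 n) (e_le1 n) z0.
    * apply: (measurable_fun_cvg _ lF2) => n; apply: measurable_Omegafun => p z0.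
      exact: cvg_F2 (e_gt0 n) z0.
  + apply/measurable_EFinP; rewrite /dot; apply: measurable_funD; last first.
      by apply: measurable_funM => //; apply: measurable_funD; exact: measurable_funM.
    by apply: measurable_funD; exact: measurable_funM.
  (* The limit field is grad U + |z| q off the interface, so the two integrands agree almost
     everywhere. *)
  + apply: ae_leb2S ae_off_interface => p h Op; rewrite qext_qlim ?h//.
    have [_ p2] := Omega_bounds Op; congr EFin.
    by rewrite /dot (ltr0_norm p2) /xx; ring.
- by apply: ae_leb2S ae_off_interface => p h Op; exact: dot_qext_gU (h Op).
Qed.

End Fields.

Theorem proposition4p10 (R : realType) (lam lam1 : R)
    (hlam : 1 < lam) (hlam1 : lam < lam1) :
  supersolution lam
    (UU lam1 (theta lam lam1) (bb lam lam1))
    (qext lam1 (theta lam lam1) (bb lam lam1)).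
Proof.
have l1 : 1 < lam1 := lt_trans hlam hlam1.
set c := 1 + (lam1 / kk lam1) ^+ 2.
have c0 : 0 < c by rewrite ltr_pwDl// sqr_ge0.
have tE : theta lam lam1 = (lam1 - lam) / (2 * c).
  by rewrite /theta KKE// invrN mulrN sqrrN.
have t0 : 0 < theta lam lam1 by rewrite tE divr_gt0 ?mulr_gt0// subr_gt0.
have r0 : 0 < lam1 / (2 * theta lam lam1).
  by apply: divr_gt0; [exact: (lt_trans ltr01 l1)|exact: mulr_gt0].
apply: supersolution_UU => //.
- by rewrite /bb ltrDl sqrtr_gt0.
- rewrite /bb addrC addKr sqr_sqrtr ?ltW//.
  by field; rewrite gt_eqF.
- by rewrite -/c tE; field; rewrite gt_eqF.
Qed.
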